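(* Let $\psi:\mathbb{R}\times\mathbb{R}^k\to\mathbb{R}^k$ be continuously differentiable and $T$-periodic in $t$, let $U\subset\mathbb{R}^k$ be open and bounded, and assume (A0): $\Omega(T,0,\xi)=\xi$ for all $\xi\in\partial U$. Let $\phi_1,\phi_2:\mathbb{R}\times\mathbb{R}^k\to\mathbb{R}^k$ be continuously differentiable and $T$-periodic in $t$, and for $\lambda\in[0,1]$ put $\phi_\lambda=\lambda\phi_1+(1-\lambda)\phi_2$. Let $\eta_\lambda(\cdot,s,\xi)$ denote the solution of $$\dot y=\phi_\lambda(t,\Omega(t,0,\xi))+\psi'_{x}(t,\Omega(t,0,\xi))\,y,\qquad y(s)=0.$$ Assume that for every $\lambda\in[0,1]$, $\eta_\lambda(T,s,\xi)-\eta_\lambda(0,s,\xi)\neq0$ for all $s\in[0,T]$, $\xi\in\partial U$. Then $\gamma(\eta_1(T,0,\cdot),U)=\gamma(\eta_2(T,0,\cdot),U)$ (where $\eta_1,\eta_2$ correspond to $\lambda=1$, i.e. $\phi_1$, and $\lambda=0$, i.e. $\phi_2$, respectively).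
   Context: Standing assumption: solutions of $\dot x=\psi(t,x)$ exist for all times. $\Omega(\cdot,t_0,\xi)$ denotes the solution of $\dot x=\psi(t,x)$ with $x(t_0)=\xi$. $\psi'_x$ is the Jacobian matrix of $\psi$ with respect to its spatial variable. For a continuous map $F:\bar U\to\mathbb{R}^k$ on the closure of a bounded open set $U$ with $F\neq0$ on $\partial U$, $\gamma(F,U)$ denotes the rotation number (Brouwer degree $\deg(F,U,0)$) of the vector field $F$. *)

(* Defs.v *)
From mathcomp Require Import ssreflect ssrbool eqtype ssrnat seq fintype.
From Stdlib Require Import Reals ZArith List.
Open Scope R_scope.

Definition Vec (k : nat) := 'I_k -> R.
Definition Mat (k : nat) := 'I_k -> 'I_k -> R.

Definition sumk {k : nat} (f : 'I_k -> R) : R :=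
  fold_right Rplus 0 (map f (enum 'I_k)).

Definition vadd {k} (x y : Vec k) : Vec k := fun i => x i + y i.
Definition vsub {k} (x y : Vec k) : Vec k := fun i => x i - y i.
Definition vscal {k} (a : R) (x : Vec k) : Vec k := fun i => a * x i.
Definition vzero {k} : Vec k := fun _ => 0.
Definition evec {k} (j : 'I_k) : Vec k := fun i => if i == j then 1 else 0.
Definition vnorm {k} (x : Vec k) : R := sqrt (sumk (fun i => x i * x i)).
Definition mulmv {k} (A : Mat k) (y : Vec k) : Vec k :=
  fun i => sumk (fun j => A i j * y j).

Definition is_open {k} (U : Vec k -> Prop) : Prop :=
  forall x, U x -> exists r, 0 < r /\ forall y, vnorm (vsub y x) < r -> U y.
Definition is_bounded {k} (U : Vec k -> Prop) : Prop :=
  exists M, forall x, U x -> vnorm x <= M.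
Definition closure {k} (U : Vec k -> Prop) (x : Vec k) : Prop :=
  forall r, 0 < r -> exists y, U y /\ vnorm (vsub y x) < r.
Definition boundary {k} (U : Vec k -> Prop) (x : Vec k) : Prop :=
  closure U x /\ ~ U x.

Definition cont_vec {k} (g : Vec k -> R) : Prop :=
  forall x eps, 0 < eps -> exists d, 0 < d /\
    forall y, vnorm (vsub y x) < d -> Rabs (g y - g x) < eps.
Definition cont_tvec {k} (g : R -> Vec k -> R) : Prop :=
  forall t x eps, 0 < eps -> exists d, 0 < d /\
    forall s y, Rabs (s - t) < d -> vnorm (vsub y x) < d ->
      Rabs (g s y - g t x) < eps.

Definition is_jacobian {k} (G : Vec k -> Vec k) (J : Vec k -> Mat k) : Prop :=
  forall x i j,
    derivable_pt_lim (fun h => G (vadd x (vscal h (evec j))) i) 0 (J x i j).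
Definition C1_map {k} (G : Vec k -> Vec k) : Prop :=
  exists J, is_jacobian G J /\ forall i j, cont_vec (fun x => J x i j).

Definition is_jacobian_x {k} (f : R -> Vec k -> Vec k) (J : R -> Vec k -> Mat k)
  : Prop :=
  forall t x i j,
    derivable_pt_lim (fun h => f t (vadd x (vscal h (evec j))) i) 0 (J t x i j).
Definition C1_tx {k} (f : R -> Vec k -> Vec k) : Prop :=
  exists (Dt : R -> Vec k -> Vec k) (Dx : R -> Vec k -> Mat k),
    (forall t x i, derivable_pt_lim (fun s => f s x i) t (Dt t x i)) /\
    is_jacobian_x f Dx /\
    (forall i, cont_tvec (fun t x => Dt t x i)) /\
    (forall i j, cont_tvec (fun t x => Dx t x i j)).

Definition periodic_t {k} (T : R) (f : R -> Vec k -> Vec k) : Prop :=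
  forall t x, f (t + T) x = f t x.

Definition solves_ode {k} (F : R -> Vec k -> Vec k) (u : R -> Vec k) : Prop :=
  forall t i, derivable_pt_lim (fun s => u s i) t (F t (u t) i).

(* Determinant via Laplace expansion along the first row, on nat-indexed
   matrices of size n. *)
Fixpoint detn (n : nat) (A : nat -> nat -> R) {struct n} : R :=
  match n with
  | O => 1
  | S m =>
      fold_right Rplus 0
        (map (fun j => (-1) ^ j * A O j *
                detn m (fun r c => A (S r) (if (c < j)%nat then c else S c)))
             (iota 0 (S m)))
  end.
Definition ext_mat {k} (A : Mat k) : nat -> nat -> R :=
  fun r c => match @insub _ (fun n => n < k)%nat _ r,
                   @insub _ (fun n => n < k)%nat _ c with
             | Some i, Some j => A i j
             | _, _ => 0
             end.
Definition det {k} (A : Mat k) : R := detn k (ext_mat A).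

Definition sgnZ (x : R) : Z :=
  if Rlt_dec 0 x then 1%Z else if Rlt_dec x 0 then (-1)%Z else 0%Z.

(* Brouwer degree (rotation number) gamma(F,U) = d, defined as usual:
   d = sum of sign det G'(x) over the (finitely many) zeros x in U of a C^1
   map G having 0 as a regular value in U and with
   sup_{cl U} |G - F| < dist(0, F(bd U)). *)
Definition is_degree {k} (F : Vec k -> Vec k) (U : Vec k -> Prop) (d : Z)
  : Prop :=
  exists (G : Vec k -> Vec k) (JG : Vec k -> Mat k) (r : R) (zs : list (Vec k)),
    is_jacobian G JG /\ (forall i j, cont_vec (fun x => JG x i j)) /\
    (forall x, closure U x -> vnorm (vsub (G x) (F x)) < r) /\
    (forall y, boundary U y -> r <= vnorm (F y)) /\
    (forall x, U x -> G x = vzero -> det (JG x) <> 0) /\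
    NoDup zs /\ (forall x, In x zs <-> (U x /\ G x = vzero)) /\
    d = fold_right Z.add 0%Z (map (fun x => sgnZ (det (JG x))) zs).

(* Main.v *)
From Stdlib Require Import ZArith Reals Lra Lia List.
From Stdlib Require Import Classical FunctionalExtensionality ClassicalEpsilon.
From HB Require Import structures.
From mathcomp Require Import all_boot all_order all_algebra all_fingroup.
From mathcomp Require ring lra.
From mathcomp Require Import zify ssrZ Rstruct.
Require Import Defs.
Set Implicit Arguments.
Unset Strict Implicit.
Unset Printing Implicit Defensive.

(** The map [xi |-> eta lam T 0 xi] is continuous (Gronwall) and affine in
    [lam] (uniqueness for linear equations), and the hypothesis at [s = 0] says
    that it has no zero on the boundary of [U]. So everything reduces to the
    invariance of the degree under affine homotopies.

    Degrees are computed with piecewise linear maps. Give every vertex of a fine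
    Kuhn triangulation a label close to the value of the map there, in general
    position. The simplicial degree counts, with orientation, the simplices
    whose labels surround the origin. For k + 2 labels in general position the
    signed number of facets surrounding the origin is 0; summed over the
    triangulation, where interior facets cancel in pairs, this shows that
    changing one label does not change the degree as long as the labels near the
    boundary of [U] stay in an open half space. Moving all labels one after the
    other through the homotopy gives the invariance. Finally the piecewise
    linear interpolation of the labels, with the absolute values in its formula
    rounded off, is a C^1 map which is affine near its zeros, so it is admissible
    in [is_degree] and yields the simplicial degree. *)

(** * Simplices around the origin *)

(** The conclusion asks for one integer that is a degree of both maps, and [is_degree] only asserts
    that some C^1 approximation with regular zeros exists; the simplicial degree is the integer that
    both ends share. Three choices shape the details. The lattice is a torus, coordinates being
    taken modulo [N.+2], so that every facet has a simplex on its other side and the cancellation is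
    an involution; a margin of one cell around [U] keeps wrap-around away from the simplices that
    matter. A simplex is counted according to its base vertex alone, which is harmless: where
    membership in [U] changes within a cell, a boundary point is nearby and the labels lie in a half
    space. Finally every vertex has a spare label serving as apex of cones, because the cocycle
    identity needs one more point, in general position with the labels and in the same half space
    near the boundary. *)

Section SignedIncidence.
Import mathcomp.algebra_tactics.ring mathcomp.algebra_tactics.lra.
Import Order.TTheory GRing.Theory Num.Theory.
Local Open Scope ring_scope.
Context (F : realFieldType).

Definition coef n (f : 'M[F]_(n.+1, n)) (j : 'I_n.+1) : F :=
  (-1) ^+ j * \det (row' j f).

(** [coef f] spans the left kernel of [f], so the origin lies inside the simplex
    spanned by the rows of [f] iff its entries have one sign; that sign is then
    the orientation of the simplex (see [det_differences]). *)
Definition simplex_sign n (f : 'M[F]_(n.+1, n)) : Z :=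
  if [forall j, 0 < coef f j] then 1
  else if [forall j, coef f j < 0] then -1 else 0.

Lemma row_mx_col0 m n (t : 'cV[F]_m) (f : 'M_(m, n)) i :
  (row_mx t f : 'M_(m, n.+1)) i ord0 = t i 0.
Proof. by rewrite mxE; case: splitP => // c _; rewrite ord1. Qed.

Lemma row_mx_colS m n (t : 'cV[F]_m) (f : 'M_(m, n)) i j :
  (row_mx t f : 'M_(m, n.+1)) i (lift ord0 j) = f i j.
Proof.
by rewrite mxE; case: splitP => c; [rewrite ord1 | move=> /= -[/val_inj ->]].
Qed.

Lemma mul_mx_row1 m p n (A : 'M[F]_(m, p)) (t : 'cV_p) (f : 'M_(p, n)) :
  A *m (row_mx t f : 'M_(p, n.+1)) = row_mx (A *m t) (A *m f).
Proof. exact: (mul_mx_row A t f). Qed.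

Lemma cofactor_col0 n (t : 'cV[F]_n.+1) (f : 'M_(n.+1, n)) j :
  cofactor (row_mx t f : 'M_(n.+1)) j ord0 = coef f j.
Proof.
rewrite /cofactor addn0; congr (_ * \det _).
apply/matrixP=> a b; transitivity ((row_mx t f : 'M_(n.+1)) (lift j a) (lift ord0 b)).
  by rewrite !mxE.
by rewrite row_mx_colS mxE.
Qed.

Lemma det_row_mx n (t : 'cV[F]_n.+1) (f : 'M_(n.+1, n)) :
  \det (row_mx t f : 'M_(n.+1)) = \sum_i t i 0 * coef f i.
Proof.
rewrite (expand_det_col _ ord0); apply: eq_bigr => i _.
by rewrite cofactor_col0 row_mx_col0.
Qed.

Lemma det_delta_mx n j (f : 'M_(n.+1, n)) :
  \det (row_mx (delta_mx j (ord0 : 'I_1)) f : 'M_(n.+1)) = coef f j.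
Proof.
rewrite det_row_mx (bigD1 j) //= !mxE !eqxx mul1r big1 ?addr0 // => i ij.
by rewrite mxE (negPf ij) mul0r.
Qed.

(** Let [A] be [f] with the [i]-th unit column prepended. As [A *m \adj A] is the scalar [coef f i],
    multiplying by [b] on the left and reading entry [j] gives the identity. The error term carries
    the entries of [b *m f]: it vanishes for kernel vectors and can be estimated for near-kernel
    vectors. *)
Lemma coef_relation n (f : 'M_(n.+1, n)) (b : 'rV[F]_n.+1) i j :
  b 0 j * coef f i = b 0 i * coef f j +
    \sum_m (b *m f) 0 m *
       (\adj (row_mx (delta_mx i (ord0 : 'I_1)) f : 'M_(n.+1))) (lift ord0 m) j.
Proof.
pose A : 'M_(n.+1) := row_mx (delta_mx i (ord0 : 'I_1)) f; rewrite -/A.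
have := mul_mx_adj A; rewrite [\det A]det_delta_mx => E.
have: (b *m A *m \adj A) 0 j = b 0 j * coef f i.
  by rewrite -mulmxA E mul_mx_scalar !mxE mulrC.
have -> : b *m A = row_mx (b *m delta_mx i (ord0 : 'I_1)) (b *m f).
  exact: mul_mx_row1.
rewrite mxE => <-; rewrite big_ord_recl row_mx_col0.
congr (_ + _).
  rewrite mxE (bigD1 i) //= mxE !eqxx mulr1 big1 ?addr0; last first.
    by move=> l li; rewrite mxE (negPf li) mulr0.
  by rewrite [\adj A _ _]mxE cofactor_col0.
by apply: eq_bigr => m _; rewrite row_mx_colS.
Qed.

Lemma coef_kernel n (f : 'M_(n.+1, n)) (b : 'rV[F]_n.+1) i j :
  b *m f = 0 -> b 0 j * coef f i = b 0 i * coef f j.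
Proof.
move=> bf; rewrite coef_relation bf big1 ?addr0 // => m _.
by rewrite mxE mul0r.
Qed.

Lemma coef_mulmx n (f : 'M_(n.+1, n)) : (\row_j coef f j) *m f = 0.
Proof.
apply/matrixP=> i m; rewrite !mxE.
have := det_row_mx (col m f) f.
rewrite -det_tr (@determinant_alternate _ _ _ ord0 (lift ord0 m)).
- by move=> E; rewrite [RHS]E; apply: eq_bigr => j _; rewrite !mxE mulrC.
- by [].
by move=> j; rewrite mxE [RHS]mxE row_mx_col0 row_mx_colS mxE.
Qed.

(** Pluecker coordinates of the two-dimensional left kernel of [f]. *)
Definition pairing n (f : 'M[F]_(n.+2, n)) (i j : 'I_n.+2) : F :=
  @coef n.+1 (row_mx (delta_mx i (ord0 : 'I_1)) f : 'M_(n.+2, n.+1)) j.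

(** Deleting row [j] turns the unit column at [lift j i] into the one at [i]. Up to a sign depending
    on [j] only, the pairings with [j] are thus the coefficients of the facet opposite to [j]. *)
Lemma pairing_lift n (f : 'M[F]_(n.+2, n)) j i :
  pairing f (lift j i) j = (-1) ^+ j * coef (row' j f) i.
Proof.
rewrite -[coef (row' j f) i]det_delta_mx /pairing /coef; congr (_ * \det _).
apply/matrixP=> a b; rewrite [LHS]mxE.
case: (unliftP ord0 b) => [b' ->|->]; first by rewrite !row_mx_colS mxE.
by rewrite !row_mx_col0 !mxE (inj_eq lift_inj).
Qed.

Lemma pairing_antisym n (f : 'M[F]_(n.+2, n)) i j :
  pairing f i j = - pairing f j i.
Proof.
rewrite /pairing -!det_delta_mx.
pose m (i j : 'I_n.+2) : 'M_(n.+2) := row_mx (delta_mx j (ord0 : 'I_1))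
  (row_mx (delta_mx i (ord0 : 'I_1)) f : 'M_(n.+2, n.+1)).
rewrite -/(m i j) -/(m j i); set A := m i j; set B := m j i.
pose i1 : 'I_n.+2 := lift ord0 ord0.
have -> : A = xcol ord0 i1 B.
  apply/matrixP=> a b; rewrite [RHS]mxE.
  case: (unliftP ord0 b) => [b' ->|->]; last first.
    by rewrite tpermL row_mx_col0 row_mx_colS row_mx_col0.
  case: (unliftP ord0 b') => [b'' ->|->]; last first.
    by rewrite tpermR row_mx_col0 row_mx_colS row_mx_col0.
  by rewrite tpermD // !row_mx_colS.
by rewrite xcolE det_mulmx det_perm odd_tperm /= mulrN1.
Qed.

(** For [b] in the left kernel of [f], only the prepended unit column contributes an error term to
    [coef_relation]; the row of the pairings with [l] is such a [b]. *)
Lemma pairing_plucker n (f : 'M[F]_(n.+2, n)) i j l m :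
  pairing f i j * pairing f l m =
  pairing f l j * pairing f i m - pairing f l i * pairing f j m.
Proof.
have H (b : 'rV[F]_n.+2) : b *m f = 0 ->
    b 0 m * pairing f i j = b 0 j * pairing f i m - b 0 i * pairing f j m.
  move=> bf.
  have := @coef_relation n.+1 (row_mx (delta_mx i (ord0 : 'I_1)) f : 'M_(n.+2, n.+1)) b j m.
  rewrite -/(pairing f i j) -/(pairing f i m) => ->; congr (_ + _).
  rewrite big_ord_recl mul_mx_row1 row_mx_col0.
  rewrite [X in _ + X]big1 ?addr0; last first.
    by move=> a _; rewrite row_mx_colS bf mxE mul0r.
  rewrite mxE (bigD1 i) //= mxE !eqxx mulr1 big1 ?addr0; last first.
    by move=> a ai; rewrite mxE (negPf ai) mulr0.
  rewrite -mulrN -pairing_antisym /pairing; congr (_ * _).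
  (* A cofactor in column [i1] does not see that column, so the [m]-th unit column may be put there;
     the cofactor is then all of [\det (A m)]. *)
  pose i1 : 'I_n.+2 := lift ord0 ord0.
  pose A x : 'M_(n.+2) := row_mx (delta_mx j (ord0 : 'I_1))
    (row_mx (delta_mx x (ord0 : 'I_1)) f : 'M_(n.+2, n.+1)).
  rewrite -det_delta_mx -/(A i) -/(A m) (expand_det_col (A m) i1) (bigD1 m) //=.
  rewrite row_mx_colS row_mx_col0 [delta_mx _ _ _ _]mxE !eqxx mul1r big1 ?addr0.
    rewrite mxE /cofactor; congr (_ * \det _).
    apply/matrixP=> c d; rewrite [LHS]mxE [RHS]mxE [in LHS]mxE [in RHS]mxE.
    case: (unliftP ord0 d) => [d' ->|->].
      have -> : lift i1 (lift ord0 d') = lift ord0 (lift ord0 d') by apply: val_inj.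
      by rewrite !row_mx_colS.
    have -> : lift i1 ord0 = ord0 by apply: val_inj.
    by rewrite !row_mx_col0.
  by move=> a am; rewrite row_mx_colS row_mx_col0 mxE (negPf am) mul0r.
have := H (\row_j pairing f l j).
rewrite !mxE mulrC => -> //.
have := @coef_mulmx n.+1 (row_mx (delta_mx l (ord0 : 'I_1)) f : 'M_(n.+2, n.+1)).
rewrite mul_mx_row1 => E; apply/matrixP=> x y.
have := congr1 (fun A : 'M_(_, n.+1) => A x (lift ord0 y)) E.
by rewrite row_mx_colS mxE [RHS]mxE => ->; rewrite mxE.
Qed.

Lemma signed_count_cycle m (a : 'I_m.+2 -> 'I_m.+2 -> F) :
  (forall i j, a i j = - a j i) ->
  (forall i j, i != j -> a i j != 0) ->
  (forall i j p q, a i j * a p q = a p j * a i q - a p i * a j q) ->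
  (exists i, forall j, j != i -> 0 < a i j) ->
  exists i, forall j, j != i -> a i j < 0.
Proof.
move=> anti nz pl [i0 pos0].
pose i1 : 'I_m.+2 := if i0 == ord0 then ord_max else ord0.
have i10 : i1 != i0 by rewrite /i1; case: ifP => [/eqP ->|/negbT]; rewrite // eq_sym.
(* Think of [a i j] as the oriented area of two plane vectors: if they all lie on
   one side of [i0], the one of extreme slope has them all on its other side. *)
pose r j := a i1 j / a i0 j.
case: (@arg_maxP _ _ _ i1 (fun j => j != i0) r i10) => s si0 smax.
exists s => j js.
have [->|ji0] := eqVneq j i0; first by rewrite anti oppr_lt0 pos0.
have p0j := pos0 _ ji0; have p0s := pos0 _ si0.
rewrite lt_neqAle nz 1?eq_sym //=.
have := smax j ji0; rewrite /r /=.
rewrite ler_pdivrMr // mulrAC ler_pdivlMr // => le1.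
have := pl i0 i1 s j; have p01 := pos0 _ i10.
rewrite (anti s i1) (anti s i0) => e.
have : a i0 i1 * a s j <= 0 by rewrite e; lra.
by rewrite pmulr_rle0.
Qed.

Lemma signed_count_unique m (a : 'I_m.+2 -> 'I_m.+2 -> F) :
  (forall i j, a i j = - a j i) ->
  forall i i', (forall j, j != i -> 0 < a i j) -> (forall j, j != i' -> 0 < a i' j) -> i = i'.
Proof.
move=> anti i i' Hi Hi'; apply/eqP/negPn/negP => ii'.
have := Hi i'; rewrite eq_sym ii' anti oppr_gt0 => /(_ isT).
by rewrite ltNge ltW // Hi'.
Qed.

Definition general_position n m (f : 'M[F]_(m, n)) :=
  forall s : 'I_n -> 'I_m, injective s -> \det (rowsub s f) != 0.

(** Gale duality: the left kernel of [f] is a plane, in which the rows turn into vectors with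
    oriented areas [a i j], and the facet opposite to [i] surrounds the origin iff all other vectors
    lie on one side of vector [i]. The two sides count with opposite signs. Either there is exactly
    one extreme vector of each kind, or there is none of either kind. *)
Lemma simplex_sign_cocycle n (f : 'M[F]_(n.+2, n)) : general_position f ->
  \sum_(i < n.+2) (-1) ^+ i * simplex_sign (row' i f) = 0.
Proof.
move=> gp; pose a i j := pairing f j i.
have anti i j : a i j = - a j i by rewrite /a pairing_antisym.
have nz i j : i != j -> a i j != 0.
  move=> ij; rewrite /a; case: (unliftP i j) ij => [j' -> _|->]; last by rewrite eqxx.
  rewrite pairing_lift /coef !mulf_neq0 ?signr_eq0 //.
  have := gp (lift i \o lift j') (inj_comp lift_inj lift_inj).
  by congr (\det _ != 0); apply/matrixP=> x y; rewrite !mxE.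
have pl i j p q : a i j * a p q = a p j * a i q - a p i * a j q.
  by rewrite /a pairing_plucker; ring.
pose P i := [forall (j | j != i), 0 < a i j].
pose Q i := [forall (j | j != i), 0 < - a i j].
have term (i : 'I_n.+2) : (-1) ^+ i * simplex_sign (row' i f) = (P i)%:R - (Q i)%:R :> Z.
  have cE j : coef (row' i f) j = (-1) ^+ odd i * a i (lift i j).
    by rewrite signr_odd /a pairing_lift signrMK.
  have PE : P i = [forall j, 0 < a i (lift i j)].
    apply/forall_inP/forallP => H j; first by rewrite H // eq_sym neq_lift.
    by case: (unliftP i j) => [j' ->|->]; rewrite ?eqxx.
  have QE : Q i = [forall j, 0 < - a i (lift i j)].
    apply/forall_inP/forallP => H j; first by rewrite H // eq_sym neq_lift.
    by case: (unliftP i j) => [j' ->|->]; rewrite ?eqxx.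
  have PQ : ~~ (P i && Q i).
    rewrite PE QE; apply/negP => /andP[/forallP/(_ ord0) p /forallP/(_ ord0)].
    by rewrite oppr_gt0 ltNge ltW.
  rewrite /simplex_sign; under eq_forallb do rewrite cE.
  under [in X in if _ then _ else X]eq_forallb do rewrite cE -oppr_gt0 -mulrN.
  move: PQ; rewrite -signr_odd; case: (odd i); rewrite /= ?expr0 ?expr1.
    under eq_forallb do rewrite mulN1r.
    under [in X in if _ then _ else X]eq_forallb do rewrite mulN1r opprK.
    by rewrite -PE -QE; case: (P i); case: (Q i).
  under eq_forallb do rewrite mul1r.
  under [in X in if _ then _ else X]eq_forallb do rewrite mul1r.
  by rewrite -PE -QE; case: (P i); case: (Q i).
under eq_bigr do rewrite term.
rewrite sumrB; apply/eqP; rewrite subr_eq0; apply/eqP.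
have sum1 (p : pred 'I_n.+2) : (forall i j, p i -> p j -> i = j) ->
    \sum_i (p i)%:R = [exists i, p i]%:R :> Z.
  move=> uniqp; case: existsP => [[i pi]|np]; last first.
    by rewrite big1 // => i _; case: (boolP (p i)) => // pi; case: np; exists i.
  rewrite (bigD1 i) //= pi big1 ?addr0 // => j ji.
  by case: (boolP (p j)) => // pj; rewrite (uniqp _ _ pj pi) eqxx in ji.
have antiN i j : - a i j = - - a j i by rewrite anti.
have plN i j p q : - a i j * - a p q = - a p j * - a i q - - a p i * - a j q.
  by rewrite !mulrNN pl.
have nzN i j : i != j -> - a i j != 0 by rewrite oppr_eq0; apply: nz.
rewrite !sum1; last 2 first.
- by move=> i j /forall_inP Hi /forall_inP Hj; apply: (signed_count_unique antiN).
- by move=> i j /forall_inP Hi /forall_inP Hj; apply: (signed_count_unique anti).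
congr ((nat_of_bool _)%:R); apply/existsP/existsP => -[i /forall_inP Hi].
  have [|j Hj] := signed_count_cycle anti nz pl; first by exists i.
  by exists j; apply/forall_inP => l lj; rewrite oppr_gt0 Hj.
have [|j Hj] := signed_count_cycle antiN nzN plN; first by exists i.
by exists j; apply/forall_inP => l lj; rewrite -oppr_lt0 Hj.
Qed.

(** This is the cocycle identity with the apex [a] put in front of the labels: the facet without [a]
    is the simplex itself, and the shift of the other indices by one absorbs the minus sign. *)
Lemma simplex_sign_cone n (a : 'rV[F]_n) (f : 'I_n.+1 -> 'rV[F]_n) :
  general_position (\matrix_(i < n.+2) oapp f a (unlift ord0 i)) ->
  simplex_sign (\matrix_i f i) = \sum_(i < n.+1) (-1) ^+ i *
    simplex_sign (\matrix_(j < n.+1) oapp (f \o lift i) a (unlift ord0 j)).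
Proof.
move=> /simplex_sign_cocycle; rewrite big_ord_recl expr0 mul1r => /eqP.
rewrite addr_eq0 -sumrN => /eqP E.
have -> : \matrix_i f i = row' ord0 (\matrix_(i < n.+2) oapp f a (unlift ord0 i)).
  by apply/matrixP=> i j; rewrite !mxE liftK.
rewrite E; apply: eq_bigr => i _; rewrite -mulNr /= /bump /= exprS mulN1r opprK.
congr (_ * simplex_sign _); apply/matrixP=> j l; rewrite !mxE.
case: (unliftP ord0 j) => [j' ->|->].
  have -> : lift (lift ord0 i) (lift ord0 j') = lift ord0 (lift i j') :> 'I_n.+2.
    by apply: val_inj; rewrite /= /bump /=; lia.
  by rewrite liftK.
have -> : lift (lift ord0 i) ord0 = ord0 :> 'I_n.+2 by apply: val_inj.
by rewrite !unlift_none.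
Qed.

Lemma simplex_sign_halfspace n (f : 'M[F]_(n.+1, n)) l :
  (forall i, 0 < f i l) \/ (forall i, f i l < 0) -> simplex_sign f = 0.
Proof.
have sum0 : \sum_i coef f i * f i l = 0.
  have /(congr1 (fun A : 'rV_n => A 0 l)) := coef_mulmx f.
  rewrite !mxE => E; rewrite -[RHS]E.
  by apply: eq_bigr => i _; rewrite mxE.
have pos (g h : 'I_n.+1 -> F) : (forall i, 0 < g i) -> (forall i, 0 < h i) ->
    \sum_i g i * h i <> 0.
  move=> gp hp; apply/eqP; rewrite gt_eqF // big_ord_recl ltr_wpDr ?mulr_gt0 //.
  by apply: sumr_ge0 => i _; rewrite mulr_ge0 // ltW.
rewrite /simplex_sign => fl; case: forallP => [cp|_].
  case: fl => fl; first by have := pos _ _ cp fl.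
  have := pos _ (fun i => - f i l) cp (fun i => _).
  case=> [i|]; first by rewrite oppr_gt0.
  by under eq_bigr do rewrite mulrN; rewrite sumrN sum0 oppr0.
case: forallP => [cn|//].
have cp i : 0 < - coef f i by rewrite oppr_gt0.
case: fl => fl.
  have := pos _ _ cp fl; case.
  by under eq_bigr do rewrite mulNr; rewrite sumrN sum0 oppr0.
have := pos _ (fun i => - f i l) cp (fun i => _).
case=> [i|]; first by rewrite oppr_gt0.
by under eq_bigr do rewrite mulrNN; rewrite sum0.
Qed.

(** Both sides are the determinant of [f] with a column of ones prepended: the unipotent [L]
    subtracts from every row its predecessor, which reduces that column to its top entry.
    Differences of consecutive labels are, up to order and scale, the partial derivatives of the
    affine map on a Kuhn simplex. *)
Lemma det_differences n (f : 'M[F]_(n.+1, n)) :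
  \det (\matrix_(i < n) (row (lift ord0 i) f - row (widen_ord (leqnSn n) i) f))
  = \sum_i coef f i.
Proof.
pose A : 'M_(n.+1) := row_mx (const_mx 1 : 'cV_n.+1) f.
pose L : 'M[F]_(n.+1) := \matrix_(i, j) ((i == j)%:R - (i == j.+1 :> nat)%:R).
have LE (i : 'I_n.+1) j : (L *m A) i j =
    A i j - (if unlift ord0 i is Some i' then A (widen_ord (leqnSn n) i') j else 0).
  rewrite mxE; under eq_bigr do rewrite mxE mulrBl.
  rewrite sumrB; congr (_ - _).
    rewrite (bigD1 i) //= eqxx mul1r big1 ?addr0 // => k ki.
    by rewrite eq_sym (negPf ki) mul0r.
  case: (unliftP ord0 i) => [i' ->|->]; last by rewrite big1 // => k _; rewrite mul0r.
  rewrite (bigD1 (widen_ord (leqnSn n) i')) //= eqxx mul1r big1 ?addr0 // => k.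
  rewrite -val_eqE /= => ki; rewrite (_ : (_ == _) = false) ?mul0r //.
  by rewrite /bump /= add1n eqSS eq_sym; apply/negbTE.
have detL : \det L = 1.
  rewrite det_trig; last first.
    apply/is_trig_mxP => i j ij; rewrite mxE -val_eqE /=.
    by rewrite !ltn_eqF ?subr0 // ltnW.
  by rewrite big1 // => i _; rewrite mxE eqxx ltn_eqF ?subr0.
have : \det (L *m A) = \sum_i coef f i.
  rewrite det_mulmx detL mul1r det_row_mx; apply: eq_bigr => i _.
  by rewrite mxE mul1r.
move=> <-; rewrite (expand_det_col _ ord0) big_ord_recl big1 ?addr0; last first.
  by move=> i _; rewrite LE liftK !row_mx_col0 !mxE subrr mul0r.
rewrite LE unlift_none row_mx_col0 mxE subr0 mul1r /cofactor addn0 expr0 mul1r.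
congr (\det _); apply/matrixP=> i j; rewrite [RHS]mxE [in RHS]mxE LE liftK.
by rewrite !row_mx_colS !mxE.
Qed.

Lemma sign_det_differences n (f : 'M[F]_(n.+1, n)) : simplex_sign f != 0 ->
  let d := \det (\matrix_(i < n)
     (row (lift ord0 i) f - row (widen_ord (leqnSn n) i) f)) in
  (simplex_sign f = 1 /\ 0 < d) \/ (simplex_sign f = -1 /\ d < 0).
Proof.
rewrite det_differences /simplex_sign; case: forallP => [cp _|_].
  left; split=> //; rewrite big_ord_recl ltr_wpDr //.
  by apply: sumr_ge0 => i _; rewrite ltW.
case: forallP => [cn _|_]; last by rewrite eqxx.
right; split=> //; rewrite big_ord_recl ltr_wnDr //.
by apply: sumr_le0 => i _; rewrite ltW.
Qed.

Lemma barycentric_zero n (f : 'M[F]_(n.+1, n)) (b : 'rV[F]_n.+1) :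
  simplex_sign f != 0 -> b *m f = 0 -> \sum_i b 0 i = 1 ->
  forall i, b 0 i = coef f i / \sum_j coef f j.
Proof.
move=> Df bf b1 i.
have cs : \sum_j coef f j != 0.
  rewrite -det_differences; have /= := sign_det_differences Df.
  by case=> -[_]; [move/gt_eqF->|move/lt_eqF->].
apply: (mulIf cs); rewrite divfK // mulr_sumr.
under eq_bigr do rewrite (coef_kernel _ _ bf).
by rewrite -mulr_suml b1 mul1r.
Qed.

Lemma barycentric_gt0 n (f : 'M[F]_(n.+1, n)) : simplex_sign f != 0 ->
  let b := \row_i (coef f i / \sum_j coef f j) in
  [/\ b *m f = 0, \sum_i b 0 i = 1 & forall i, 0 < b 0 i].
Proof.
move=> Df b; rewrite {}/b.
have cs : \sum_j coef f j != 0.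
  rewrite -det_differences; have /= := sign_det_differences Df.
  by case=> -[_]; [move/gt_eqF->|move/lt_eqF->].
split.
- have -> : \row_i (coef f i / \sum_j coef f j) =
      (\sum_j coef f j)^-1 *: \row_i coef f i.
    by apply/matrixP=> i j; rewrite !mxE mulrC.
  by rewrite -scalemxAl coef_mulmx scaler0.
- by under eq_bigr do rewrite mxE; rewrite -mulr_suml divff.
move=> i; rewrite mxE; have := sign_det_differences Df.
rewrite det_differences /simplex_sign; case: forallP => [cp|_].
  by case=> -[] // _ sp; rewrite divr_gt0.
case: forallP => [cn|_]; last by case=> -[].
by case=> -[] // _ sp; rewrite nmulr_rgt0 ?invr_lt0.
Qed.

(** Some [b 0 i] is at least [1 / (n + 1)]. For this [i], [coef_relation] makes [b 0 j * coef f i]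
    close to [b 0 i * coef f j], which is bounded away from 0. As [b] is nonnegative, every
    [coef f j] has the sign of [coef f i], and every [b 0 j] is bounded below. *)
Lemma small_combination n (f : 'M[F]_(n.+1, n)) : (forall i, coef f i != 0) ->
  exists2 e, 0 < e & forall b : 'rV[F]_n.+1,
    (forall i, 0 <= b 0 i) -> \sum_i b 0 i = 1 ->
    (forall m, `|(b *m f) 0 m| <= e) -> simplex_sign f != 0 /\ forall i, e <= b 0 i.
Proof.
move=> c0.
pose A i := \adj (row_mx (delta_mx i (ord0 : 'I_1)) f : 'M_(n.+1)).
pose K := \sum_i \sum_j \sum_m `|A i (lift ord0 m) j|.
pose S := \sum_i `|coef f i|^-1.
pose C := \sum_i `|coef f i|.
have K0 : 0 <= K by do 3!apply: sumr_ge0 => ? _.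
have cp i : 0 < `|coef f i| by rewrite normr_gt0.
have C0 : 0 < C.
  by rewrite /C big_ord_recl ltr_wpDr // sumr_ge0.
have S0 : 0 < S.
  by rewrite /S big_ord_recl ltr_wpDr ?invr_gt0 // sumr_ge0 // => i _; rewrite invr_ge0 ltW.
have cC i : `|coef f i| <= C.
  by rewrite /C (bigD1 i) //= lerDl sumr_ge0.
have cS i : S^-1 <= `|coef f i|.
  rewrite -[leRHS]invrK lef_pV2 ?posrE ?invr_gt0 //.
  by rewrite /S (bigD1 i) //= lerDl sumr_ge0 // => j _; rewrite invr_ge0 ltW.
(* [S^-1] and [C] bound all [|coef f j|] from below and above, so [q] bounds [b 0 i * |coef f j|]
   from below for the large [b 0 i]. The first entry of the minimum keeps the error within [q / 2];
   the second turns [q / 2 <= b 0 j * |coef f i|] into [e <= b 0 j]. *)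
pose q := S^-1 / n.+1%:R.
have q0 : 0 < q by rewrite divr_gt0 ?invr_gt0 ?ltr0n.
exists (Num.min (q / (2 * (K + 1))) (q / (2 * C))).
  by rewrite lt_min; apply/andP; split; apply: divr_gt0 => //; lra.
set e := Num.min _ _ => b b0 b1 be.
have eK : e * K <= q / 2.
  apply: (@le_trans _ _ (q / (2 * (K + 1)) * K)).
    by rewrite ler_wpM2r // ge_min lexx.
  rewrite mulrAC ler_pdivrMr; last by lra.
  by nra.
have [i bi] : exists i, n.+1%:R^-1 <= b 0 i.
  apply/existsP; apply: contraT; rewrite negb_exists => /forallP H.
  have : \sum_i b 0 i < \sum_(i < n.+1) n.+1%:R^-1.
    apply: ltr_sum => [|j _]; first by apply/hasP; exists ord0; rewrite ?mem_index_enum.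
    by rewrite ltNge.
  by rewrite b1 sumr_const card_ord -[_ *+ n.+1]mulr_natr mulVf ?pnatr_eq0 // ltxx.
have R j : `|b 0 j * coef f i - b 0 i * coef f j| <= q / 2.
  rewrite (coef_relation f b i j) addrC addKr.
  apply: le_trans eK; apply: le_trans (ler_norm_sum _ _ _) _.
  apply: (@le_trans _ _ (e * \sum_m `|A i (lift ord0 m) j|)).
    rewrite mulr_sumr; apply: ler_sum => m _.
    by rewrite normrM ler_wpM2r // be.
  apply: ler_wpM2l; first by rewrite le_min; apply/andP; split; apply: divr_ge0; lra.
  rewrite /K (bigD1 i) //= (bigD1 j) //= -addrA lerDl addr_ge0 //.
    by rewrite !sumr_ge0 // => *; rewrite sumr_ge0.
  by rewrite sumr_ge0 // => *; rewrite sumr_ge0 // => *; rewrite sumr_ge0.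
have big j : q <= b 0 i * `|coef f j|.
  by rewrite /q mulrC; apply: ler_pM => //; rewrite invr_ge0 ?ltW.
have e1 : e * C <= q / 2.
  apply: (@le_trans _ _ (q / (2 * C) * C)); first by rewrite ler_wpM2r ?ge_min ?lexx ?orbT // ltW.
  by rewrite invfM mulrA divfK // gt_eqF.
have [ci|ci] := ltrP 0 (coef f i).
  have cj j : 0 < coef f j /\ q / 2 <= b 0 j * coef f i.
    have := R j; rewrite ler_norml => /andP[R1 R2].
    have bc : 0 <= b 0 j * coef f i by rewrite mulr_ge0 // ltW.
    have := big j; have [cj|cj] := ltrP 0 (coef f j).
      by rewrite gtr0_norm // => ?; split=> //; lra.
    by rewrite ler0_norm // mulrN => ?; exfalso; lra.
  split; first by rewrite /simplex_sign (introT forallP (fun j => (cj j).1)).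
  move=> j; rewrite -(ler_pM2r ci).
  apply: le_trans (cj j).2; apply: le_trans e1; rewrite ler_wpM2l //.
    by rewrite le_min; apply/andP; split; apply: divr_ge0; lra.
  by have := cC i; rewrite gtr0_norm.
have {}ci : coef f i < 0 by rewrite lt_neqAle c0.
have cj j : coef f j < 0 /\ q / 2 <= b 0 j * - coef f i.
  have := R j; rewrite ler_norml => /andP[R1 R2].
  have bc : 0 <= b 0 j * - coef f i by rewrite mulr_ge0 // oppr_ge0 ltW.
  rewrite mulrN in bc *.
  have := big j; have [cj|cj] := ltrP 0 (coef f j).
    by rewrite gtr0_norm // => ?; exfalso; lra.
  by rewrite ler0_norm // mulrN => ?; split; [rewrite lt_neqAle c0 | lra].
split.
  rewrite /simplex_sign; case: ifP => // _.
  by rewrite (introT forallP (fun j => (cj j).1)).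
move=> j; have ni : 0 < - coef f i by rewrite oppr_gt0.
rewrite -(ler_pM2r ni).
apply: le_trans (cj j).2; apply: le_trans e1; rewrite ler_wpM2l //.
  by rewrite le_min; apply/andP; split; apply: divr_ge0; lra.
by have := cC i; rewrite ltr0_norm.
Qed.

Lemma perturb (I : finType) n (f : I -> 'rV[F]_n) (e : F) : 0 < e ->
  exists g : I -> 'rV[F]_n, (forall i j, `|g i 0 j - f i 0 j| < e) /\
    forall s : 'I_n -> I, injective s -> \det (\matrix_k g (s k)) != 0.
Proof.
move=> e0.
(* Perturb along the moment curve: the determinants of [x *: f + m] are polynomials
   in [x], nonzero because their values at 0 are Vandermonde determinants. *)
pose m (i : I) : 'rV[F]_n := \row_j (enum_rank i)%:R ^+ j.
pose B := 1 + \sum_i \sum_j `|m i 0 j| / e.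
have B0 : 0 < B.
  rewrite ltr_pwDl // !sumr_ge0 // => i _; rewrite sumr_ge0 // => j _.
  by rewrite divr_ge0 // ltW.
pose q (s : {ffun 'I_n -> I}) : {poly F} :=
  \det (\matrix_(k, j) ('X * (f (s k) 0 j)%:P + (m (s k) 0 j)%:P)).
have qE s x : (q s).[x] = \det (\matrix_(k, j) (x * f (s k) 0 j + m (s k) 0 j)).
  rewrite -[LHS]/(horner_eval x _) -det_map_mx; congr (\det _).
  by apply/matrixP=> k j; rewrite !mxE /= /horner_eval !hornerE.
have q0 (s : {ffun 'I_n -> I}) : injectiveb s -> q s != 0.
  move/injectiveP=> inj_s; apply/eqP => qs.
  have := qE s 0; rewrite qs horner0 => /esym/eqP; apply/negP.
  pose v : 'rV[F]_n := \row_k (enum_rank (s k))%:R.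
  have -> : \matrix_(k, j) (0 * f (s k) 0 j + m (s k) 0 j) = (Vandermonde n v)^T.
    by apply/matrixP=> k j; rewrite !mxE mul0r add0r.
  rewrite det_tr det_Vandermonde; apply/prodf_neq0 => i _.
  apply/prodf_neq0 => j ij; rewrite !mxE subr_eq0 eqr_nat val_eqE.
  by rewrite (inj_eq enum_rank_inj) (inj_eq inj_s) gt_eqF // ltEord.
pose Q := \prod_(s : {ffun 'I_n -> I} | injectiveb s) q s.
have Q0 : Q != 0 by apply/prodf_neq0 => s; apply: q0.
(* These are more candidates than [Q] can have roots, and all are at least [B], which makes
   [x^-1 *: m i] smaller than [e]. *)
pose rs := [seq B + k%:R | k <- iota 0 (size Q)].
have : ~~ all (root Q) rs.
  apply/negP => /(max_poly_roots Q0); rewrite size_map size_iota ltnn.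
  rewrite map_inj_uniq ?iota_uniq => [/(_ isT)//|] x y /addrI /eqP.
  by rewrite eqr_nat => /eqP.
move=> /allPn[x /mapP[k _ xE]]; rewrite /root => Qx.
have Bx : B <= x by rewrite xE lerDl.
have x0 : 0 < x by apply: lt_le_trans Bx.
exists (fun i => f i + x^-1 *: m i); split.
  move=> i j; have d0 a b : 0 <= `|m a 0 b| / e by rewrite divr_ge0 // ltW.
  have mB : `|m i 0 j| / e < B.
    have : `|m i 0 j| / e <= \sum_b `|m i 0 b| / e.
      by rewrite (bigD1 j) //= lerDl sumr_ge0.
    have : \sum_b `|m i 0 b| / e <= \sum_a \sum_b `|m a 0 b| / e.
      by rewrite [leRHS](bigD1 i) //= lerDl sumr_ge0 // => ? _; rewrite sumr_ge0.
    by rewrite /B; lra.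
  have -> : (f i + x^-1 *: m i) 0 j - f i 0 j = x^-1 * m i 0 j.
    by rewrite !mxE addrAC subrr add0r.
  rewrite normrM normfV (gtr0_norm x0) mulrC ltr_pdivrMr // mulrC -ltr_pdivrMr //.
  exact: lt_le_trans Bx.
move=> s inj_s.
have sE : injectiveb (finfun s) by apply/injectiveP=> a b; rewrite !ffunE => /inj_s.
have : (q (finfun s)).[x] != 0.
  by move: Qx; rewrite horner_prod => /prodf_neq0; apply.
rewrite qE; set M := \matrix_(_, _) _.
have -> : M = x *: \matrix_k (f (s k) + x^-1 *: m (s k)).
  by apply/matrixP=> i j; rewrite !mxE ffunE mulrDr mulrA divff ?mul1r // gt_eqF.
by rewrite detZ mulf_eq0 => /norP[].
Qed.

End SignedIncidence.

(** * Simplicial degree on the Kuhn triangulation of a torus *)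

Section KuhnTorus.
Import Order.TTheory GRing.Theory Num.Theory.
Local Open Scope ring_scope.
Context (n N : nat).
Local Notation k := n.+1.
Local Notation V := {ffun 'I_k -> 'I_N.+2}.

(** The Kuhn simplex at [z] raises the coordinates one after the other, [r l] being
    the rank of coordinate [l]; coordinates are modulo [N.+2]. *)
Definition vert (z : V) (r : 'S_k) (i : nat) : V :=
  [ffun l => z l + (r l < i)%:R].

Definition facet (z : V) (r : 'S_k) (i : 'I_k.+1) : {ffun 'I_k -> V} :=
  [ffun j => vert z r (lift i j)].

Definition rank_shift : 'S_k := lift_perm ord0 ord_max 1%g.

Lemma rank_shiftE (x : 'I_k) : rank_shift x = (if x == ord0 then n else x.-1) :> nat.
Proof.
case: (unliftP ord0 x) => [y ->|->]; last by rewrite /rank_shift lift_perm_id eqxx.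
by rewrite /rank_shift lift_perm_lift perm1 /= /bump leqNgt ltn_ord.
Qed.

Lemma odd_rank_shift : odd_perm rank_shift = odd n.
Proof. by rewrite /rank_shift odd_lift_perm odd_perm1 /= addbF. Qed.

(** The simplex on the other side of the facet opposite to vertex [i], with the
    index of that facet in it. *)
Definition pivot (p : V * 'S_k * 'I_k.+1) : V * 'S_k * 'I_k.+1 :=
  let: (z, r, i) := p in
  if i == ord0 then ([ffun l => z l + (r l == ord0)%:R], (r * rank_shift)%g, ord_max)
  else if i == ord_max then
    ([ffun l => z l - (r l == ord_max)%:R], (r * rank_shift^-1)%g, ord0)
  else (z, (r * tperm (inord i.-1) (inord i))%g, i).

Lemma pivotK : involutive pivot.
Proof.
move=> [[z r] i]; rewrite /pivot.
have rot_max x : (rank_shift x == ord_max) = (x == ord0).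
  rewrite -val_eqE /= rank_shiftE.
  case: (eqVneq x ord0) => [_|x0]; first by rewrite eqxx.
  by have := ltn_ord x; rewrite -val_eqE /= in x0; lia.
case: (eqVneq i ord0) => [->|i0].
  rewrite /= eqxx mulgK; congr (_, _, _).
  by apply/ffunP=> l; rewrite !ffunE permM rot_max addrK.
case: (eqVneq i ord_max) => [->|im].
  rewrite /= mulgKV; congr (_, _, _).
  by apply/ffunP=> l; rewrite !ffunE permM -rot_max permKV subrK.
by rewrite (negPf i0) (negPf im) -mulgA tperm2 mulg1.
Qed.

(** For inner [i], exchanging the ranks [i - 1] and [i] alters only vertex [i], the one left out. At
    the two ends the vertices of the facet stay in place while their indices move by one. *)
Lemma facet_pivot z r i :
  facet (pivot (z, r, i)).1.1 (pivot (z, r, i)).1.2 (pivot (z, r, i)).2 = facet z r i.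
Proof.
have rot_case x (j : 'I_k) : ((x == ord0) + (rank_shift x < j) = (x < j.+1))%N.
  rewrite rank_shiftE -val_eqE /=; case: (val x =P 0%N) => /= [->|x0].
    by rewrite ltnNge -ltnS ltn_ord.
  by rewrite add0n; case: (val x) x0.
apply/ffunP=> j; rewrite !ffunE /pivot.
have bmax : bump k j = j by rewrite /bump leqNgt ltn_ord.
case: (eqVneq i ord0) => [->|i0] /=.
  apply/ffunP=> l; rewrite !ffunE permM -addrA -natrD bmax.
  by rewrite rot_case.
case: (eqVneq i ord_max) => [->|im] /=.
  apply/ffunP=> l; rewrite !ffunE permM bmax.
  rewrite -(rot_case (rank_shift^-1 (r l))%g) permKV natrD -addrA; congr (_ + _).
  rewrite addrA (_ : (_ == ord0) = (r l == ord_max)) ?addNr ?add0r //.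
  have rot0 : ord_max = rank_shift ord0 by apply: val_inj; rewrite /= rank_shiftE eqxx.
  by rewrite rot0 -[X in _ = (X == _)](permKV rank_shift) (inj_eq perm_inj).
apply/ffunP=> l; rewrite !ffunE permM; congr (_ + (nat_of_bool _)%:R).
have il : (i.-1 < k)%N by have := ltn_ord i; lia.
have i0' : (0 < i)%N by rewrite lt0n.
have ik : (i < k)%N by have := ltn_ord i; rewrite -val_eqE /= in im; lia.
case: tpermP => [->|->|//] ; rewrite !inordK // /bump; lia.
Qed.

(** Inner facets: a transposition, with [i] unchanged. End facets: a cycle of length [n.+1], of sign
    [(-1) ^+ n], while the index jumps between 0 and [n.+1]. *)
Lemma sign_pivot z r i : (-1) ^+ (pivot (z, r, i)).1.2 * (-1) ^+ (pivot (z, r, i)).2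
  = - ((-1) ^+ r * (-1) ^+ i) :> Z.
Proof.
rewrite /pivot.
case: (eqVneq i ord0) => [->|i0] /=.
  by rewrite odd_permM odd_rank_shift signr_addb signr_odd expr0 mulr1 exprS mulN1r mulrN
    -mulrA -expr2 sqrr_sign mulr1.
case: (eqVneq i ord_max) => [->|im] /=.
  rewrite odd_permM odd_permV odd_rank_shift signr_addb signr_odd expr0 mulr1.
  by rewrite exprS mulN1r mulrN opprK.
rewrite odd_permM odd_tperm signr_addb -mulrA mulrCA mulrA.
rewrite (_ : inord i.-1 != inord i) ?expr1 ?mulN1r ?mulNr //.
rewrite -val_eqE /= !inordK; move: i0 im (ltn_ord i); rewrite -!val_eqE /=; lia.
Qed.

(** The involution [pivot] reverses the sign of a facet, so the sum equals its own negative as soon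
    as the two sides of every facet have the same weight. Facets with different weights bound the
    region selected by [w], and there [Phi] is 0 by [jump]. *)
Lemma pivot_sum0 (w : pred V) (Phi : {ffun 'I_k -> V} -> Z) :
  (forall z r (i : 'I_k.+1), w z != w (pivot (z, r, i)).1.1 -> Phi (facet z r i) = 0) ->
  \sum_(z | w z) \sum_(r : 'S_k) (-1) ^+ r * (\sum_(i : 'I_k.+1) (-1) ^+ i * Phi (facet z r i)) = 0.
Proof.
move=> jump.
pose T (p : V * 'S_k * 'I_k.+1) := (-1) ^+ p.1.2 * (-1) ^+ p.2 * Phi (facet p.1.1 p.1.2 p.2).
have TN p : T (pivot p) = - T p.
  by case: p => [[z r] i]; rewrite /T facet_pivot sign_pivot mulNr.
have Tw p : (w (pivot p).1.1)%:R * T p = (w p.1.1)%:R * T p.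
  case: p => [[z r] i] /=; have [->//|/jump E] := eqVneq (w z) (w (pivot (z, r, i)).1.1).
  by rewrite /T /= E !mulr0.
set S := LHS.
have SE : S = \sum_p (w p.1.1)%:R * T p.
  rewrite -(pair_bigA _ (fun q i => (w q.1)%:R * T (q, i))) /=.
  rewrite -(pair_bigA _ (fun z r => \sum_(i : 'I_k.+1) (w z)%:R * T ((z, r), i))) /=.
  rewrite /S big_mkcond /=; apply: eq_bigr => z _; case: ifP => wz.
    apply: eq_bigr => r _; rewrite mulr_sumr; apply: eq_bigr => i _.
    by rewrite mul1r /T mulrA.
  by rewrite big1 // => r _; rewrite big1 // => i _; rewrite mul0r.
have : S = - S.
  rewrite {1}SE (reindex_inj (inv_inj pivotK)) /= SE -sumrN.
  by apply: eq_bigr => p _; rewrite TN mulrN Tw.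
by lia.
Qed.

End KuhnTorus.

Section SimplicialDegree.
Import Order.TTheory GRing.Theory Num.Theory.
Local Open Scope ring_scope.
Context (F : realFieldType) (n N : nat).
Local Notation k := n.+1.
Local Notation V := {ffun 'I_k -> 'I_N.+2}.

Definition simplex (g : V -> 'rV[F]_k) z r : 'M_(k.+1, k) :=
  \matrix_(i < k.+1) g (vert z r i).

(** The factor [(-1) ^+ r] is the orientation of the Kuhn simplex in space, so every term compares
    it with the orientation of the labels. *)
Definition sdeg (w : pred V) (g : V -> 'rV[F]_k) : Z :=
  \sum_(z | w z) \sum_(r : 'S_k) (-1) ^+ r * simplex_sign (simplex g z r).

Lemma vert_inj z r (i j : 'I_k.+1) : vert z r i = vert z r j :> V -> i = j.
Proof.
wlog lt_ij : i j / (i < j)%N => [H E|].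
  case: (ltngtP i j) => [ij|ji|/val_inj//]; first exact: H.
  by apply/esym/H.
move=> /ffunP/(_ ((r^-1)%g (inord i))); rewrite !ffunE permKV inordK; last first.
  by have := ltn_ord j; lia.
rewrite lt_ij ltnn => /addrI /(congr1 val) /=.
by rewrite modn_small.
Qed.

Definition family_in_gp (I : finType) m (L : I -> 'rV[F]_m) :=
  forall s : 'I_m -> I, injective s -> \det (\matrix_i L (s i)) != 0.

Lemma family_gp (I : finType) m p (L : I -> 'rV[F]_m) (s : 'I_p -> I) :
  family_in_gp L -> injective s -> general_position (\matrix_i L (s i)).
Proof.
move=> gp inj_s t inj_t; have := gp (s \o t) (inj_comp inj_s inj_t).
by congr (\det _ != 0); apply/matrixP=> i j; rewrite !mxE.
Qed.

Lemma coef_neq0 (I : finType) (L : I -> 'rV[F]_k) (a : V -> I) z r i :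
  family_in_gp L -> injective a -> coef (simplex (L \o a) z r) i != 0.
Proof.
move=> gp inj_a; rewrite /coef mulf_neq0 ?signr_eq0 //.
have := gp (fun j => a (vert z r (lift i j))) (fun x y E => lift_inj (vert_inj (inj_a _ _ E))).
by congr (\det _ != 0); apply/matrixP=> x y; rewrite !mxE.
Qed.

(** The degree becomes a sum over signed facets, the form in which [pivot_sum0] applies. The apex
    must differ from all labels in use, since general position concerns distinct indices only. *)
Lemma sdeg_cone (w : pred V) (I : finType) (L : I -> 'rV[F]_k) (m : V -> I) c :
  family_in_gp L -> injective m -> (forall u, m u != c) ->
  sdeg w (L \o m) = \sum_(z | w z) \sum_(r : 'S_k) (-1) ^+ r *
    \sum_(i < k.+1) (-1) ^+ i *
      simplex_sign (\matrix_(j < k.+1) oapp (L \o m \o facet z r i) (L c) (unlift ord0 j)).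
Proof.
move=> gp inj_m mc; rewrite /sdeg; apply: eq_bigr => z _; apply: eq_bigr => r _.
rewrite /simplex (@simplex_sign_cone _ _ (L c)); last first.
  have -> : \matrix_(i < k.+2) oapp (fun i : 'I_k.+1 => (L \o m) (vert z r i)) (L c) (unlift ord0 i)
      = \matrix_(i < k.+2) L (oapp (fun i : 'I_k.+1 => m (vert z r i)) c (unlift ord0 i)).
    by apply/matrixP=> i j; rewrite !mxE; case: unliftP.
  apply: family_gp => // i j; case: unliftP => [i' ->|->]; case: unliftP => [j' ->|->] //=.
  - by move/inj_m/vert_inj ->.
  - by move/eqP; rewrite (negPf (mc _)).
  - by move/esym/eqP; rewrite (negPf (mc _)).
congr (_ * _); apply: eq_bigr => i _; congr (_ * simplex_sign _).
by apply/matrixP=> j l; rewrite !mxE; case: unliftP => //= j' _; rewrite ffunE.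
Qed.

Definition in_halfspace (P : 'rV[F]_k -> Prop) :=
  exists l, (forall x, P x -> 0 < x 0 l) \/ (forall x, P x -> x 0 l < 0).

(** Vertices are relabelled one at a time. When [v] changes, both degrees are written with cones
    from the spare label [c v]. A facet without [v] gives the same term before and after; a facet
    with [v] across which [w] jumps gives 0 both times, as its labels and the apex lie in a half
    space. So [pivot_sum0] applies to the difference. *)
Lemma sdeg_homotopy (w : pred V) (I : finType) (L : I -> 'rV[F]_k)
  (a b c : V -> I) :
  family_in_gp L -> injective a -> injective b ->
  (forall u v, [/\ a u != b v, a u != c v & b u != c v]) ->
  (forall z r (i : 'I_k.+1), w z != w (pivot (z, r, i)).1.1 ->
    in_halfspace (fun x => exists2 u, u \in codom (facet z r i) &
      [\/ x = L (a u), x = L (b u) | x = L (c u)])) ->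
  sdeg w (L \o a) = sdeg w (L \o b).
Proof.
move=> gp inj_a inj_b disj jump.
pose m (s : seq V) u := if u \in s then b u else a u.
have inj_m s : injective (m s).
  move=> u v; rewrite /m; case: ifP => us; case: ifP => vs.
  - exact: inj_b.
  - by move/esym/eqP; have [/negPf ->] := disj v u.
  - by move/eqP; have [/negPf ->] := disj u v.
  - exact: inj_a.
have mc s u v : m s u != c v.
  by rewrite /m; case: ifP => _; case: (disj u v).
have step v s : sdeg w (L \o m s) = sdeg w (L \o m (v :: s)).
  apply/eqP; rewrite -subr_eq0; apply/eqP.
  rewrite !(@sdeg_cone w I L _ (c v)) //.
  pose Phi s (p : {ffun 'I_k -> V}) :=
    simplex_sign (\matrix_(j < k.+1) oapp (L \o m s \o p) (L (c v)) (unlift ord0 j)).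
  rewrite -[RHS](@pivot_sum0 n N w (fun p => Phi s p - Phi (v :: s) p)).
    rewrite -sumrB; apply: eq_bigr => z _; rewrite -sumrB; apply: eq_bigr => r _.
    by rewrite -mulrBr -sumrB; congr (_ * _); apply: eq_bigr => i _; rewrite mulrBr.
  move=> z r i wz; have [l hl] := jump z r i wz.
  have [vf|vf] := boolP (v \in codom (facet z r i)); last first.
    apply/eqP; rewrite subr_eq0; apply/eqP; congr simplex_sign; apply/matrixP=> j x; rewrite !mxE.
    case: (unlift _ j) => //= j'; rewrite /m in_cons (_ : (_ == v) = false) //.
    by apply: contraNF vf => /eqP <-; apply: codom_f.
  have Phi0 t : Phi t (facet z r i) = 0.
    apply: (@simplex_sign_halfspace _ _ _ l); have H (j : 'I_k.+1) : exists2 u, u \in codom (facet z r i) &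
        let x := oapp (L \o m t \o facet z r i) (L (c v)) (unlift ord0 j) in
        [\/ x = L (a u), x = L (b u) | x = L (c u)].
      case: unliftP => [j' _|_] /=; last by exists v => //; constructor 3.
      exists (facet z r i j'); first exact: codom_f.
      by rewrite /m; case: ifP; [constructor 2 | constructor 1].
    by case: hl => hl; [left | right] => j; rewrite mxE; apply: hl.
  by rewrite !Phi0 subrr.
have all_steps s : sdeg w (L \o a) = sdeg w (L \o m s).
  elim: s => [|v s IH]; last by rewrite IH; apply: step.
  by congr sdeg.
rewrite (all_steps (enum {: V})) /sdeg.
apply: eq_bigr => z _; apply: eq_bigr => r _; congr (_ * simplex_sign _).
by apply/matrixP=> i j; rewrite !mxE /= /m mem_enum.
Qed.

End SimplicialDegree.

(** * Real analysis in coordinates *)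

Open Scope R_scope.

(** At the supremum of the points up to which [P] holds, the hypothesis carries [P] a little
    further. At [t = a] there is no past, so the hypothesis also starts the induction. *)
Lemma real_induction (a b : R) (P : R -> Prop) :
  (forall t, a <= t <= b -> (forall s, a <= s < t -> P s) ->
     exists d, 0 < d /\ forall s, a <= s <= b -> Rabs (s - t) < d -> P s) ->
  forall t, a <= t <= b -> P t.
Proof.
move=> H t0 Ht0.
pose E t := a <= t <= b /\ forall s, a <= s <= t -> P s.
have [dA [dA0 HA]] : exists d, 0 < d /\ forall s, a <= s <= b -> Rabs (s - a) < d -> P s.
  by apply: H => [|s Hs]; [split; lra | lra].
have Ea : E a.
  split; first by split; lra.
  move=> s Hs; apply: HA; first by split; lra.
  by rewrite (_ : s - a = 0) ?Rabs_R0 //; lra.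
have [m [ub lub]] : {m | is_lub E m}.
  apply: completeness; last by exists a.
  by exists b => t [[_ ]].
have am : a <= m by apply: ub.
have mb : m <= b by apply: lub => t [[_ ]].
have below s : a <= s < m -> P s.
  move=> Hs; apply: NNPP => nP.
  suff: m <= s by lra.
  apply: lub => t [Ht Pt]; apply: Rnot_lt_le => st; apply: nP; apply: Pt; split; lra.
have [d [d0 Hd]] := H m (conj am mb) below.
have Pm s : a <= s <= b -> s < m + d -> P s.
  move=> Hs sd; case: (Rlt_dec s m) => sm; first by apply: below; split; lra.
  by apply: Hd => //; rewrite Rabs_pos_eq; lra.
case: (Rlt_dec t0 (m + d)) => tm; first exact: Pm.
suff : m + d / 2 <= m by lra.
by apply: ub; split; [split; lra | move=> s Hs; apply: Pm; [split|]; lra].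
Qed.

(* [Q t c]: the property in question holds at [t] with constant [c]. *)
Lemma segment_compact (a b : R) (Q : R -> R -> Prop) :
  (forall t c c', 0 < c' <= c -> Q t c -> Q t c') ->
  (forall t, a <= t <= b -> exists d, 0 < d /\
     forall s, a <= s <= b -> Rabs (s - t) < d -> Q s d) ->
  exists c, 0 < c /\ forall t, a <= t <= b -> Q t c.
Proof.
move=> mono loc.
case: (Rle_dec a b) => ab; last by exists 1; split; [lra | move=> t; lra].
have H : forall t, a <= t <= b -> exists c, 0 < c /\ forall s, a <= s <= t -> Q s c.
  apply: real_induction => t Ht IH.
  have [d [d0 Hd]] := loc t Ht.
  have [c [c0 Hc]] : exists c, 0 < c /\ forall s, a <= s <= t - d / 2 -> Q s c.
    case: (Rle_dec a (t - d / 2)) => tad; last by exists 1; split; [lra | move=> s; lra].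
    by apply: IH; split; lra.
  exists (d / 2); split; first by lra.
  move=> s Hs /Rabs_def2 sd; exists (Rmin c d).
  split; first by apply: Rmin_glb_lt.
  move=> u Hu; case: (Rle_dec u (t - d / 2)) => ut.
    apply: (mono _ c); last by apply: Hc; split; lra.
    by split; [apply: Rmin_glb_lt | apply: Rmin_l].
  apply: (mono _ d).
    by split; [apply: Rmin_glb_lt | apply: Rmin_r].
  by apply: Hd; [lra | apply: Rabs_def1; lra].
have [c [c0 Hc]] := H b (conj ab (Rle_refl b)).
by exists c; split.
Qed.

Section Vectors.
Context {k : nat}.
Implicit Types (x y : Vec k) (f g : 'I_k -> R).

Definition close (d : R) x y := forall i, Rabs (y i - x i) < d.

Lemma sumkE f : sumk f = (\sum_i f i)%R.
Proof.
rewrite /sumk -[RHS]big_enum.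
elim: (enum 'I_k) => [|i s IH] /=; first by rewrite big_nil.
by rewrite big_cons IH.
Qed.

Lemma sumk_ext f g : (forall i, f i = g i) -> sumk f = sumk g.
Proof. by move=> fg; congr sumk; apply: functional_extensionality. Qed.

Lemma sumk_le f g : (forall i, f i <= g i) -> sumk f <= sumk g.
Proof.
rewrite /sumk => fg; elim: (enum 'I_k) => [|i s IH] /=; first by lra.
by have := fg i; lra.
Qed.

Lemma sumk_const c : sumk (fun _ : 'I_k => c) = INR k * c.
Proof.
rewrite /sumk -[in RHS](size_enum_ord k).
elim: (enum 'I_k) => [|i s IH] /=; first by rewrite Rmult_0_l.
by rewrite IH; case: (size s) => [|m] /=; lra.
Qed.

Lemma sumk_plus f g : sumk (fun i => f i + g i) = sumk f + sumk g.
Proof.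
rewrite /sumk; elim: (enum 'I_k) => [|i s IH] /=; first by lra.
by rewrite IH; lra.
Qed.

Lemma sumk_scal c f : sumk (fun i => c * f i) = c * sumk f.
Proof.
rewrite /sumk; elim: (enum 'I_k) => [|i s IH] /=; first by lra.
by rewrite IH; lra.
Qed.

Lemma sumk_abs f : Rabs (sumk f) <= sumk (fun i => Rabs (f i)).
Proof.
rewrite /sumk; elim: (enum 'I_k) => [|i s IH] /=; first by rewrite Rabs_R0; lra.
by apply: Rle_trans (Rabs_triang _ _) _; lra.
Qed.

Lemma sumk_ge0 f : (forall i, 0 <= f i) -> 0 <= sumk f.
Proof.
move=> f0; have := @sumk_le (fun=> 0) f f0.
by rewrite sumk_const Rmult_0_r.
Qed.

Lemma sumk_term f i : (forall j, 0 <= f j) -> f i <= sumk f.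
Proof.
move=> f0; rewrite sumkE (bigD1 i) //=.
have : (0 <= \sum_(j < k | j != i) f j)%R.
  by apply: Num.Theory.sumr_ge0 => j _; apply/RleP; apply: f0.
move=> /RleP; rewrite -RplusE => H.
rewrite -[f i in X in X <= _]Rplus_0_r.
by apply: Rplus_le_compat_l.
Qed.

Lemma sumk_derivable (f : 'I_k -> R -> R) (df : 'I_k -> R) t :
  (forall i, derivable_pt_lim (f i) t (df i)) ->
  derivable_pt_lim (fun s => sumk (fun i => f i s)) t (sumk df).
Proof.
move=> H; rewrite /sumk; elim: (enum 'I_k) => [|i s IH] /=.
  exact: derivable_pt_lim_const.
exact: (derivable_pt_lim_plus (f i)).
Qed.

Lemma vnorm_ge x i : Rabs (x i) <= vnorm x.
Proof.
rewrite -sqrt_Rsqr_abs; apply: sqrt_le_1_alt.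
by apply: (@sumk_term (fun j => x j * x j)) => j; nra.
Qed.

Lemma vnorm_le x d : (forall i, Rabs (x i) <= d) -> vnorm x <= INR k * d.
Proof.
move=> H; case: (posnP k) => [k0|k0].
  have -> : INR k = 0 by rewrite k0.
  rewrite Rmult_0_l /vnorm (_ : sumk _ = 0) ?sqrt_0; first by lra.
  by rewrite sumkE big1 // => i; have := ltn_ord i; rewrite {2}k0.
have d0 : 0 <= d by have := H (Ordinal k0); have := Rabs_pos (x (Ordinal k0)); lra.
have k1 : 1 <= INR k by apply: (le_INR 1); apply/ssrnat.leP.
rewrite /vnorm -(sqrt_Rsqr (INR k * d)); last by nra.
apply: sqrt_le_1_alt; apply: (Rle_trans _ (sumk (fun _ : 'I_k => d * d))).
  apply: sumk_le => i; have := H i; split_Rabs; nra.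
rewrite sumk_const /Rsqr; nra.
Qed.

Lemma close_vnorm x y d : vnorm (vsub y x) < d -> close d x y.
Proof. by move=> H i; apply: Rle_lt_trans (vnorm_ge _ i) H. Qed.

Lemma vnorm_close x y d : 0 < d -> close (d / (INR k + 1)) x y -> vnorm (vsub y x) < d.
Proof.
move=> d0 H; have k0 := pos_INR k.
have : vnorm (vsub y x) <= INR k * (d / (INR k + 1)).
  by apply: vnorm_le => i; apply: Rlt_le; apply: H.
have -> : INR k * (d / (INR k + 1)) = d - d / (INR k + 1) by field; lra.
have : 0 < d / (INR k + 1) by apply: Rdiv_lt_0_compat; lra.
by lra.
Qed.

Lemma cont_vecP (g : Vec k -> R) : cont_vec g <->
  forall x eps, 0 < eps -> exists d, 0 < d /\
    forall y, close d x y -> Rabs (g y - g x) < eps.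
Proof.
split=> H x eps e0; have [d [d0 Hd]] := H x eps e0; have k0 := pos_INR k.
  exists (d / (INR k + 1)); split; first by apply: Rdiv_lt_0_compat; lra.
  by move=> y /(vnorm_close d0); apply: Hd.
by exists d; split=> // y /close_vnorm; apply: Hd.
Qed.

Lemma cont_tvecP (g : R -> Vec k -> R) : cont_tvec g <->
  forall t x eps, 0 < eps -> exists d, 0 < d /\
    forall s y, Rabs (s - t) < d -> close d x y -> Rabs (g s y - g t x) < eps.
Proof.
split=> H t x eps e0; have [d [d0 Hd]] := H t x eps e0; have k0 := pos_INR k.
  have dk : 0 < d / (INR k + 1) by apply: Rdiv_lt_0_compat; lra.
  exists (d / (INR k + 1)); split=> // s y sd /(vnorm_close d0); apply: Hd.
  apply: Rlt_le_trans sd _; apply: (Rmult_le_reg_r (INR k + 1)); first by lra.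
  by rewrite /Rdiv Rmult_assoc Rinv_l; [nra | lra].
by exists d; split=> // s y sd /close_vnorm; apply: Hd.
Qed.

Lemma close_weak d d' x y : d <= d' -> close d x y -> close d' x y.
Proof. by move=> dd H i; apply: Rlt_le_trans (H i) dd. Qed.

Lemma box_compact (M : R) (Q : Vec k -> R -> Prop) :
  (forall x c c', 0 < c' <= c -> Q x c -> Q x c') ->
  (forall x, (forall i, - M <= x i <= M) -> exists d, 0 < d /\
     forall y, (forall i, - M <= y i <= M) -> close d x y -> Q y d) ->
  exists c, 0 < c /\ forall x, (forall i, - M <= x i <= M) -> Q x c.
Proof.
move=> mono loc.
pose box y := forall i : 'I_k, - M <= y i <= M.
(* The first [j] coordinates have been made uniform. *)
have H (j : nat) : (j <= k)%nat -> forall x, box x -> exists c, 0 < c /\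
    forall y, box y -> (forall i : 'I_k, (j <= i)%nat -> Rabs (y i - x i) < c) -> Q y c.
  elim: j => [_ x /loc[d [d0 Hd]]|j IH jk x bx].
    by exists d; split=> // y bY cl; apply: Hd => // i; apply: cl.
  pose ij := Ordinal jk.
  pose upd t : Vec k := fun i => if i == ij then t else x i.
  have [||c [c0 Hc]] := @segment_compact (- M) M (fun t c => forall y, box y -> y ij = t ->
     (forall i : 'I_k, (j < i)%nat -> Rabs (y i - x i) < c) -> Q y c).
  - move=> t c c' [c0 cc] Hc y bY yt cl; apply: (mono _ c) => //; apply: Hc => // i ji.
    by have := cl i ji; lra.
  - move=> t Ht; have [|c [c0 Hc]] := IH (ltnW jk) (upd t).
      by move=> i; rewrite /upd; case: eqP => _; [| apply: bx].
    exists c; split=> // s Hs st y bY ys cl; apply: Hc => // i ji.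
    rewrite /upd; case: eqP => [->|/eqP ne]; first by rewrite ys.
    by apply: cl; rewrite ltn_neqAle ji andbT eq_sym.
  exists c; split=> // y bY cl; apply: (Hc (y ij)) => //.
case: (classic (exists x, box x)) => [[x0 bx0]|nobox]; last first.
  by exists 1; split; [lra | move=> x bx; case: nobox; exists x].
have [c [c0 Hc]] := H k (leqnn k) x0 bx0.
exists c; split=> // x bx; apply: Hc => // i.
by rewrite leqNgt ltn_ord.
Qed.

End Vectors.

(** Upper bounds are fed to this lemma and to the compactness lemmas in the form [<= / c], so that
    they, like radii, survive a shrinking of [c]. *)
Lemma finite_radius (I : finType) (P : I -> R -> Prop) :
  (forall i c c', 0 < c' <= c -> P i c -> P i c') ->
  (forall i, exists c, 0 < c /\ P i c) -> exists c, 0 < c /\ forall i, P i c.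
Proof.
move=> mono H.
have [c [c0 Hc]] : exists c, 0 < c /\ forall i, i \in enum I -> P i c.
  elim: (enum I) => [|i s [c [c0 Hc]]]; first by exists 1; split; [lra|].
  have [d [d0 Hd]] := H i; have m0 : 0 < Rmin c d by apply: Rmin_glb_lt.
  exists (Rmin c d); split=> // j; rewrite in_cons => /orP[/eqP ->|/Hc].
    by apply: (mono _ d) => //; split; [|apply: Rmin_r].
  by apply: (mono _ c) => //; split; [|apply: Rmin_l].
by exists c; split=> // i; apply: Hc; rewrite mem_enum.
Qed.

Lemma mvt_bound (g dg : R -> R) (a b L : R) :
  (forall c, derivable_pt_lim g c (dg c)) ->
  (forall c, Rmin a b <= c <= Rmax a b -> Rabs (dg c) <= L) ->
  Rabs (g b - g a) <= L * Rabs (b - a).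
Proof.
move=> dgP H; case: (Rtotal_order a b) => [ab|[->|ab]].
- have [c [-> Hc]] := MVT_cor2 g dg a b ab (fun c _ => dgP c).
  rewrite Rabs_mult; apply: Rmult_le_compat_r; first exact: Rabs_pos.
  by apply: H; rewrite Rmin_left ?Rmax_right; lra.
- by rewrite !Rminus_diag Rabs_R0 Rmult_0_r; lra.
- have [c [E Hc]] := MVT_cor2 g dg b a ab (fun c _ => dgP c).
  rewrite Rabs_minus_sym E Rabs_mult (Rabs_minus_sym b).
  apply: Rmult_le_compat_r; first exact: Rabs_pos.
  by apply: H; rewrite Rmin_right ?Rmax_left; lra.
Qed.

Lemma derivable_cont (g : R -> R) t l : derivable_pt_lim g t l ->
  forall e, 0 < e -> exists d, 0 < d /\ forall s, Rabs (s - t) < d -> Rabs (g s - g t) < e.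
Proof.
move=> H e e0.
have dp : derivable_pt g t by exists l.
have [d [d0 Hd]] := derivable_continuous_pt _ _ dp e e0.
exists d; split=> // s st; case: (Req_dec t s) => [->|ts].
  by rewrite Rminus_diag Rabs_R0.
by apply: Hd; split; [split|].
Qed.

Section Calculus.
Context {k : nat}.
Implicit Types (x y : Vec k).

Definition partials (f : Vec k -> R) (Df : 'I_k -> Vec k -> R) :=
  forall x j, derivable_pt_lim (fun h => f (vadd x (vscal h (evec j)))) 0 (Df j x).

Lemma partials_line f Df x j h : partials f Df ->
  derivable_pt_lim (fun h => f (vadd x (vscal h (evec j)))) h
    (Df j (vadd x (vscal h (evec j)))).
Proof.
move=> H e e0; have [d Hd] := H (vadd x (vscal h (evec j))) j e e0.
exists d => h' h'0 h'd; have := Hd h' h'0 h'd.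
have shift s : vadd (vadd x (vscal h (evec j))) (vscal s (evec j)) =
    vadd x (vscal (h + s) (evec j)).
  by apply: functional_extensionality => i; rewrite /vadd /vscal; lra.
by rewrite !shift Rplus_0_l Rplus_0_r.
Qed.

Lemma lipschitz_box f Df x y r L : partials f Df ->
  (forall z j, close r x z -> Rabs (Df j z) <= L) ->
  close r x y -> Rabs (f y - f x) <= L * sumk (fun i => Rabs (y i - x i)).
Proof.
move=> HD HL xy; case: (posnP k) => [k0|k0].
  have -> : y = x by apply: functional_extensionality => i; have := ltn_ord i; rewrite {2}k0.
  have -> : sumk (fun i => Rabs (x i - x i)) = 0.
    by rewrite sumkE big1 // => i; rewrite Rminus_diag Rabs_R0.
  by rewrite Rminus_diag Rabs_R0 Rmult_0_r; lra.
have r0 : 0 < r by have := xy (Ordinal k0); have := Rabs_pos (y (Ordinal k0) - x (Ordinal k0)); lra.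
have L0 : 0 <= L.
  have := HL x (Ordinal k0); have := Rabs_pos (Df (Ordinal k0) x).
  suff H : close r x x by move=> ? /(_ H); lra.
  by move=> i; rewrite Rminus_diag Rabs_R0.
pose p (s : seq 'I_k) : Vec k := fun i => if i \in s then y i else x i.
have H s : Rabs (f (p s) - f x) <= L * fold_right Rplus 0 (List.map (fun i => Rabs (y i - x i)) s).
  elim: s => [|i s IH] /=.
    rewrite (_ : p [::] = x) //; rewrite Rminus_diag Rabs_R0; lra.
  have yx := Rabs_pos (y i - x i).
  have [is_|is_] := boolP (i \in s).
    have -> : p (i :: s) = p s.
      apply: functional_extensionality => j; rewrite /p in_cons.
      by case: eqP => [->|]; rewrite ?is_.
    by nra.
  pose g h := vadd (p s) (vscal h (evec i)).
  have gE : g (y i - x i) = p (i :: s).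
    apply: functional_extensionality => j; rewrite /g /vadd /vscal /evec /p in_cons.
    by case: eqP => [->|] /=; rewrite ?(negPf is_); lra.
  have g0 : g 0 = p s.
    by apply: functional_extensionality => j; rewrite /g /vadd /vscal; lra.
  have := @mvt_bound (fun h => f (g h)) (fun h => Df i (g h)) 0 (y i - x i) L.
  rewrite gE g0 Rminus_0_r => M.
  have {}M : Rabs (f (p (i :: s)) - f (p s)) <= L * Rabs (y i - x i).
    apply: M => [h|h hb]; first exact: partials_line.
    apply: HL => j; rewrite /g /vadd /vscal /evec /p.
    have := xy j; case: eqP => [->|_].
      rewrite (negPf is_) => xyi.
      have : Rabs (h * 1) <= Rabs (y i - x i).
        by move: hb; rewrite /Rmin /Rmax; case: Rle_dec; split_Rabs; lra.
      by rewrite (_ : x i + h * 1 - x i = h * 1); [lra | ring].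
    case: ifP => _; rewrite Rmult_0_r Rplus_0_r // Rminus_diag Rabs_R0; lra.
  have := Rabs_triang (f (p (i :: s)) - f (p s)) (f (p s) - f x).
  rewrite (_ : _ - _ + _ = f (p (i :: s)) - f x); [lra | ring].
have := H (enum 'I_k); rewrite (_ : p (enum 'I_k) = y) //.
by apply: functional_extensionality => i; rewrite /p mem_enum.
Qed.

(** The spatial derivatives are bounded near a point, so [f] is Lipschitz in [x] uniformly in nearby
    [t]; the derivative in [t] is then needed at the fixed [x] only. *)
Lemma C1_tx_cont (f : R -> Vec k -> Vec k) : C1_tx f -> forall i, cont_tvec (fun t x => f t x i).
Proof.
move=> [Dt [Dx [HDt [HDx [_ cDx]]]]] i; apply/cont_tvecP => t x e e0.
have [r [r0 Hr]] : exists r, 0 < r /\ forall j s y, Rabs (s - t) < r -> close r x y ->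
    Rabs (Dx s y i j) <= / r.
  apply: (@finite_radius _ (fun j r => forall s y, Rabs (s - t) < r -> close r x y ->
    Rabs (Dx s y i j) <= / r)) => [j c c' cc H s y st xy|j].
    apply: (Rle_trans _ (/ c)); last by apply: Rinv_le_contravar; lra.
    by apply: H; [lra | apply: close_weak xy; lra].
  have [d [d0 Hd]] := (cont_tvecP _).1 (cDx i j) t x 1 Rlt_0_1.
  have B0 := Rabs_pos (Dx t x i j).
  have Bi : 0 < / (Rabs (Dx t x i j) + 1) by apply: Rinv_0_lt_compat; lra.
  exists (Rmin d (/ (Rabs (Dx t x i j) + 1))); split; first exact: Rmin_glb_lt.
  move=> s y st xy; have ml := Rmin_l d (/ (Rabs (Dx t x i j) + 1)).
  have mr := Rmin_r d (/ (Rabs (Dx t x i j) + 1)).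
  apply: (Rle_trans _ (Rabs (Dx t x i j) + 1)).
    have : Rabs (Dx s y i j - Dx t x i j) < 1.
      by apply: Hd; [lra | apply: close_weak xy].
    by split_Rabs; lra.
  rewrite -[X in X <= _]Rinv_inv; apply: Rinv_le_contravar => //.
  exact: Rmin_glb_lt.
have [d [d0 Hd]] := derivable_cont (HDt t x i) (e := e / 2) ltac:(lra).
have k0 := pos_INR k.
have q0 : 0 < e * r / (2 * (INR k + 1)) by apply: Rdiv_lt_0_compat; nra.
exists (Rmin (Rmin r d) (e * r / (2 * (INR k + 1)))).
split; first by do 2?apply: Rmin_glb_lt.
move=> s y st xy.
have m1 := Rmin_l (Rmin r d) (e * r / (2 * (INR k + 1))).
have m2 := Rmin_r (Rmin r d) (e * r / (2 * (INR k + 1))).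
have m3 := Rmin_l r d; have m4 := Rmin_r r d.
have := @lipschitz_box (fun y => f s y i) (fun j y => Dx s y i j) x y r (/ r).
have xyr : close r x y by apply: close_weak xy; lra.
move=> H; have {}H := H (fun y j => HDx s y i j) (fun z j => Hr j s z ltac:(lra)) xyr.
have S : sumk (fun j => Rabs (y j - x j)) <= INR k * (e * r / (2 * (INR k + 1))).
  rewrite -sumk_const; apply: sumk_le => j; have := xy j; lra.
have : / r * sumk (fun j => Rabs (y j - x j)) <= e / 2.
  apply: (Rle_trans _ (/ r * (INR k * (e * r / (2 * (INR k + 1)))))).
    by apply: Rmult_le_compat_l => //; apply: Rlt_le; apply: Rinv_0_lt_compat.
  rewrite (_ : _ * _ = e / 2 * (INR k / (INR k + 1))); last by field; lra.
  rewrite -[X in _ <= X]Rmult_1_r; apply: Rmult_le_compat_l; first by lra.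
  by apply: (Rmult_le_reg_r (INR k + 1)); [lra | rewrite /Rdiv Rmult_assoc Rinv_l; lra].
have := Hd s ltac:(lra); split_Rabs; lra.
Qed.

End Calculus.

(** * Dependence of linear equations on initial data *)

(** The inequality makes [(E s + q) * exp (- C * s)] nonincreasing. It is assumed strictly before
    [t] only, since continuation arguments know nothing about [t] itself. *)
Lemma gronwall (E dE : R -> R) C q t : 0 <= t ->
  (forall s, derivable_pt_lim E s (dE s)) ->
  (forall s, 0 < s < t -> dE s <= C * (E s + q)) ->
  E t + q <= (E 0 + q) * exp (C * t).
Proof.
move=> t0 HE H; case: (Req_dec t 0) => [->|tn].
  by rewrite Rmult_0_r exp_0; lra.
pose Z s := (E s + q) * exp (- C * s).
pose dZ s := (dE s + 0) * exp (- C * s) + (E s + q) * (exp (- C * s) * (- C * 1)).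
have HZ s : derivable_pt_lim Z s (dZ s).
  apply: (derivable_pt_lim_mult (fun s => E s + q) (fun s => exp (- C * s))).
    apply: (derivable_pt_lim_plus E (fun _ => q)) => //; exact: derivable_pt_lim_const.
  apply: (derivable_pt_lim_comp (fun s => - C * s) exp); last exact: derivable_pt_lim_exp.
  by apply: (derivable_pt_lim_scal id); apply: derivable_pt_lim_id.
have [c [Ec Hc]] := MVT_cor2 Z dZ 0 t ltac:(lra) (fun c _ => HZ c).
have dZc : dZ c <= 0.
  have -> : dZ c = (dE c - C * (E c + q)) * exp (- C * c) by rewrite /dZ; ring.
  have := H c Hc; have := exp_pos (- C * c); nra.
have ZZ : Z t <= Z 0 by nra.
have e1 : exp (- C * t) * exp (C * t) = 1.
  by rewrite -exp_plus (_ : _ + _ = 0) ?exp_0 //; ring.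
move: ZZ; rewrite /Z Rmult_0_r exp_0 Rmult_1_r => ZZ.
have := exp_pos (C * t) => ep.
have -> : E t + q = (E t + q) * exp (- C * t) * exp (C * t) by rewrite Rmult_assoc e1; ring.
by apply: Rmult_le_compat_r; lra.
Qed.

Lemma exp_nondecreasing x y : x <= y -> exp x <= exp y.
Proof. by case=> [/exp_increasing/Rlt_le | ->]; [|right]. Qed.

Section Odes.
Context {k : nat}.
Implicit Types (x y : Vec k) (u w : R -> Vec k).

Definition energy (x : Vec k) := sumk (fun i => x i * x i).

Lemma energy_ge0 x : 0 <= energy x.
Proof. by apply: sumk_ge0 => i; apply: Rle_0_sqr. Qed.

Lemma energy_close x r : 0 < r -> energy x < r * r -> forall i, Rabs (x i) < r.
Proof.
move=> r0 H i; have := @sumk_term k (fun j => x j * x j) i ltac:(move=> j; nra).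
by move: H; rewrite /energy; split_Rabs; nra.
Qed.

Lemma sumk_abs_sqr x : sumk (fun i => Rabs (x i)) * sumk (fun i => Rabs (x i)) <= INR k * energy x.
Proof.
set S := sumk _; case: (posnP k) => [k0|k0].
  have -> : S = 0 by rewrite /S sumkE big1 // => i; have := ltn_ord i; rewrite {2}k0.
  by rewrite Rmult_0_l; apply: Rmult_le_pos; [apply: pos_INR | apply: energy_ge0].
have k1 : 1 <= INR k by apply: (le_INR 1); apply/ssrnat.leP.
have : 0 <= sumk (fun i => (INR k * Rabs (x i) - S) * (INR k * Rabs (x i) - S)).
  by apply: sumk_ge0 => i; apply: Rle_0_sqr.
have -> : sumk (fun i => (INR k * Rabs (x i) - S) * (INR k * Rabs (x i) - S)) =
   INR k * INR k * energy x + (- 2 * INR k * S * S + INR k * (S * S)).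
  rewrite -[INR k * (S * S)]sumk_const /energy -[INR k * INR k * _]sumk_scal.
  rewrite -[- 2 * INR k * S * S]sumk_scal -!sumk_plus; apply: sumk_ext => i.
  have -> : x i * x i = Rabs (x i) * Rabs (x i) by split_Rabs; ring.
  by ring.
move=> H; apply: (Rmult_le_reg_l (INR k)); lra.
Qed.

(** With [S] the sum of the [Rabs (w s i)], the derivative of the energy is at most [2 * (L * S + q)
    * S <= (2 * L + 1) * (S * S) + q * q], and [S * S <= INR k * energy (w s)]. The remaining
    [INR k + 1] in the exponent covers [q * q]. *)
Lemma energy_growth w dw L q t : 0 <= t -> 0 <= L ->
  (forall s i, derivable_pt_lim (fun s => w s i) s (dw s i)) ->
  (forall s i, 0 < s < t -> Rabs (dw s i) <= L * sumk (fun j => Rabs (w s j)) + q) ->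
  energy (w t) + q * q <= (energy (w 0) + q * q) * exp (((2 * L + 1) * INR k + INR k + 1) * t).
Proof.
move=> t0 L0 dwP Hdw; have k0 := pos_INR k.
apply: (@gronwall (fun s => energy (w s)) (fun s => sumk (fun i => dw s i * w s i + w s i * dw s i))) => //.
  move=> s; apply: (@sumk_derivable k (fun i s => w s i * w s i)) => i.
  by apply: (derivable_pt_lim_mult (fun s => w s i) (fun s => w s i)).
move=> s Hs; set S := sumk (fun j => Rabs (w s j)).
have S2 := sumk_abs_sqr (w s); rewrite -/S in S2.
have S0 : 0 <= S by apply: sumk_ge0 => i; apply: Rabs_pos.
have E0 := energy_ge0 (w s).
apply: (Rle_trans _ (sumk (fun i => (2 * (L * S + q)) * Rabs (w s i)))).
  apply: sumk_le => i; have := Hdw s i Hs; rewrite -/S => H.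
  have := Rabs_pos (w s i); have : dw s i * w s i <= Rabs (dw s i) * Rabs (w s i).
    by rewrite -Rabs_mult; apply: Rle_abs.
  by nra.
rewrite sumk_scal -/S.
have : 2 * q * S <= S * S + q * q by have := Rle_0_sqr (S - q); rewrite /Rsqr; lra.
have LS : L * (S * S) <= L * (INR k * energy (w s)) by apply: Rmult_le_compat_l.
have q2 : 0 <= q * q := Rle_0_sqr q.
have kE : 0 <= INR k * energy (w s) by apply: Rmult_le_pos.
have kq : 0 <= INR k * (q * q) by apply: Rmult_le_pos.
have Lq : 0 <= L * (INR k * (q * q)) by apply: Rmult_le_pos.
lra.
Qed.

Definition cont_curve u := forall i t e, 0 < e -> exists d, 0 < d /\
  forall s, Rabs (s - t) < d -> Rabs (u s i - u t i) < e.

Lemma curve_close u t e : cont_curve u -> 0 < e ->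
  exists d, 0 < d /\ forall s, Rabs (s - t) < d -> close e (u t) (u s).
Proof.
move=> cu e0; have [d [d0 Hd]] : exists d, 0 < d /\ forall i s, Rabs (s - t) < d -> Rabs (u s i - u t i) < e.
  apply: (@finite_radius _ (fun i d => forall s, Rabs (s - t) < d -> Rabs (u s i - u t i) < e)).
    by move=> i c c' cc H s st; apply: H; lra.
  by move=> i; apply: cu.
by exists d; split=> // s st i; apply: Hd.
Qed.

Lemma curve_unif (f : R -> Vec k -> R) u a b e : cont_tvec f -> cont_curve u -> 0 < e ->
  exists d, 0 < d /\ forall t, a <= t <= b -> forall x, close d (u t) x ->
    Rabs (f t x - f t (u t)) < e.
Proof.
move=> /cont_tvecP cf cu e0.
apply: (@segment_compact a b (fun t d => forall x, close d (u t) x ->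
    Rabs (f t x - f t (u t)) < e)) => [t c c' cc H x xc|t _].
  by apply: H; apply: close_weak xc; lra.
have [d [d0 Hd]] := cf t (u t) (e / 2) ltac:(lra).
have [d' [d'0 Hd']] := @curve_close u t (d / 2) cu ltac:(lra).
exists (Rmin d' (d / 2)); split; first by apply: Rmin_glb_lt; lra.
have ml := Rmin_l d' (d / 2); have mr := Rmin_r d' (d / 2).
move=> s _ st x xs; have us := Hd' s ltac:(lra).
have std : Rabs (s - t) < d by lra.
have A1 : Rabs (f s x - f t (u t)) < e / 2.
  by apply: Hd => // i; have := us i; have := xs i; split_Rabs; lra.
have A2 : Rabs (f s (u s) - f t (u t)) < e / 2.
  by apply: Hd => // i; have := us i; lra.
by split_Rabs; lra.
Qed.

Lemma curve_bound (f : R -> Vec k -> R) u a b : cont_tvec f -> cont_curve u ->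
  exists B, 0 <= B /\ forall t, a <= t <= b -> Rabs (f t (u t)) <= B.
Proof.
move=> /cont_tvecP cf cu.
have [c [c0 Hc]] : exists c, 0 < c /\ forall t, a <= t <= b -> Rabs (f t (u t)) <= / c.
  apply: (@segment_compact a b (fun t c => Rabs (f t (u t)) <= / c)).
    by move=> t c c' cc H; apply: Rle_trans H _; apply: Rinv_le_contravar; lra.
  move=> t _; have [d [d0 Hd]] := cf t (u t) 1 ltac:(lra).
  have [d' [d'0 Hd']] := @curve_close u t d cu d0.
  have B0 := Rabs_pos (f t (u t)).
  have Bi : 0 < / (Rabs (f t (u t)) + 1) by apply: Rinv_0_lt_compat; lra.
  exists (Rmin (Rmin d d') (/ (Rabs (f t (u t)) + 1))); split; first by do !apply: Rmin_glb_lt.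
  move=> s _ st.
  have m1 := Rmin_l (Rmin d d') (/ (Rabs (f t (u t)) + 1)).
  have m2 := Rmin_r (Rmin d d') (/ (Rabs (f t (u t)) + 1)).
  have m3 := Rmin_l d d'; have m4 := Rmin_r d d'.
  apply: (Rle_trans _ (Rabs (f t (u t)) + 1)).
    have := Hd s (u s) ltac:(lra) (Hd' s ltac:(lra)); split_Rabs; lra.
  rewrite -[X in X <= _]Rinv_inv; apply: Rinv_le_contravar => //.
  by do !apply: Rmin_glb_lt.
have ci : 0 < / c by apply: Rinv_0_lt_compat.
by exists (/ c); split; [lra|].
Qed.

Lemma solution_cont F u : solves_ode F u -> cont_curve u.
Proof. by move=> H i t e e0; apply: derivable_cont (H t i) e e0. Qed.

(** A Lipschitz constant [/ c] for [psi] is available only in a tube of radius [c] around the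
    reference solution. Real induction keeps the perturbed solution there: while it has stayed
    inside, Gronwall bounds the energy strictly below [m * m], and continuity extends this beyond
    [t]. *)
Lemma flow_cont (psi : R -> Vec k -> Vec k) (Dx : R -> Vec k -> Mat k) (Om : Vec k -> R -> Vec k) T x0 r :
  0 <= T -> is_jacobian_x psi Dx -> (forall i j, cont_tvec (fun t x => Dx t x i j)) ->
  (forall x, Om x 0 = x /\ solves_ode psi (Om x)) -> 0 < r ->
  exists d, 0 < d /\ forall x, close d x0 x ->
    forall t, 0 <= t <= T -> close r (Om x0 t) (Om x t).
Proof.
move=> T0 HDx cDx HOm r0; set u := Om x0.
have cu : cont_curve u := solution_cont (HOm x0).2.
have [c [c0 Hc]] : exists c, 0 < c /\ forall p : 'I_k * 'I_k, forall t, 0 <= t <= T ->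
    forall x, close c (u t) x -> Rabs (Dx t x p.1 p.2) <= / c.
  apply: (@finite_radius _ (fun p c => forall t, 0 <= t <= T ->
    forall x, close c (u t) x -> Rabs (Dx t x p.1 p.2) <= / c)).
    move=> p c c' cc H t Ht x xc; apply: (Rle_trans _ (/ c)).
      by apply: H => //; apply: close_weak xc; lra.
    by apply: Rinv_le_contravar; lra.
  move=> p; have [d [d0 Hd]] := curve_unif 0 T (cDx p.1 p.2) cu Rlt_0_1.
  have [B [B0 HB]] := curve_bound 0 T (cDx p.1 p.2) cu.
  have Bi : 0 < / (B + 1) by apply: Rinv_0_lt_compat; lra.
  exists (Rmin d (/ (B + 1))); split; first exact: Rmin_glb_lt.
  move=> t Ht x xd; apply: (Rle_trans _ (B + 1)).
    have := Hd t Ht x (close_weak (Rmin_l _ _) xd); have := HB t Ht.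
    by split_Rabs; lra.
  rewrite -[X in X <= _]Rinv_inv; apply: Rinv_le_contravar; last exact: Rmin_r.
  exact: Rmin_glb_lt.
pose m := Rmin c r.
have m0 : 0 < m by apply: Rmin_glb_lt.
have mc : m <= c := Rmin_l _ _; have mr : m <= r := Rmin_r _ _.
pose C := (2 * / c + 1) * INR k + INR k + 1.
have k0 := pos_INR k; have ci : 0 < / c by apply: Rinv_0_lt_compat.
have C0 : 0 <= C.
  by rewrite /C; have := Rmult_le_pos (2 * / c + 1) (INR k) ltac:(lra) k0; lra.
have e0 := exp_pos (C * T).
have e1 : 1 <= exp (C * T).
  by rewrite -exp_0; apply: exp_nondecreasing; apply: Rmult_le_pos.
(* The initial energy is at most [INR k * (d * d)] and may grow by the factor [exp (C * T)]; this
   [d] keeps the product below [m * m]. *)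
exists (m / ((INR k + 1) * exp (C * T))).
set d := _ / _.
have d0 : 0 < d by apply: Rdiv_lt_0_compat => //; apply: Rmult_lt_0_compat; lra.
split=> // x xd.
pose w t : Vec k := fun i => Om x t i - u t i.
pose dw t i := psi t (Om x t) i - psi t (u t) i.
have dwP t i : derivable_pt_lim (fun t => w t i) t (dw t i).
  apply: (derivable_pt_lim_minus (fun t => Om x t i) (fun t => u t i)).
    exact: (HOm x).2.
  exact: (HOm x0).2.
have E0 : energy (w 0) * exp (C * T) < m * m.
  apply: (Rle_lt_trans _ (INR k * (d * d) * exp (C * T))).
    apply: Rmult_le_compat_r; first by lra.
    rewrite -sumk_const; apply: sumk_le => i.
    rewrite /w /u !(HOm _).1; have := xd i; split_Rabs; nra.
  have dE : d * (INR k + 1) * exp (C * T) = m by rewrite /d; field; split; lra.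
  have dk : INR k * d < m by nra.
  have : INR k * (d * d) * exp (C * T) = (INR k * d) * (d * exp (C * T)) by ring.
  move=> ->; have : d * exp (C * T) <= m by nra.
  have : 0 < d * exp (C * T) by apply: Rmult_lt_0_compat.
  have : 0 <= INR k * d by nra.
  nra.
have dw_bound t : 0 <= t <= T -> energy (w t) < m * m ->
    forall i, Rabs (dw t i) <= / c * sumk (fun j => Rabs (w t j)) + 0.
  move=> Ht Et i; rewrite Rplus_0_r.
  apply: (@lipschitz_box k (fun y => psi t y i) (fun j y => Dx t y i j) _ _ c).
  - by move=> y j; apply: HDx.
  - by move=> z j; apply: (Hc (i, j)).
  by move=> j; apply: Rlt_le_trans mc; apply: (@energy_close (w t)).
have small t : 0 <= t <= T -> energy (w t) < m * m.
  move: t; apply: real_induction => t Ht IH.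
  have := @energy_growth w dw (/ c) 0 t ltac:(lra) ltac:(lra) dwP.
  rewrite -/C Rmult_0_l !Rplus_0_r => G.
  have {}G : energy (w t) <= energy (w 0) * exp (C * t).
    by apply: G => s i Hs; apply: dw_bound; [lra | apply: IH; lra].
  have ee : exp (C * t) <= exp (C * T).
    by apply: exp_nondecreasing; apply: Rmult_le_compat_l; lra.
  have Et : energy (w t) < m * m.
    by have := energy_ge0 (w 0); nra.
  have dE : derivable_pt_lim (fun s => energy (w s)) t
      (sumk (fun i => dw t i * w t i + w t i * dw t i)).
    apply: (@sumk_derivable k (fun i s => w s i * w s i)) => i.
    by apply: (derivable_pt_lim_mult (fun s => w s i) (fun s => w s i)).
  have [d' [d'0 Hd']] := derivable_cont dE (e := m * m - energy (w t)) ltac:(lra).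
  by exists d'; split=> // s _ /Hd'; split_Rabs; lra.
by move=> t Ht i; apply: Rlt_le_trans mr; apply: (@energy_close (w t)) => //; apply: small.
Qed.

(** By [flow_cont] the coefficients along [Om x] are within [q] of those along [Om x0]. The
    difference [w] of the two solutions starts at 0 and solves a linear equation with forcing of
    order [q], so Gronwall bounds [w T] by a multiple of [q]. *)
Lemma linear_solution_cont (psi : R -> Vec k -> Vec k) (Dx : R -> Vec k -> Mat k)
  (Om : Vec k -> R -> Vec k) (b : R -> Vec k -> Vec k) (eta : Vec k -> R -> Vec k) T :
  0 <= T -> is_jacobian_x psi Dx -> (forall i j, cont_tvec (fun t x => Dx t x i j)) ->
  (forall x, Om x 0 = x /\ solves_ode psi (Om x)) ->
  (forall i, cont_tvec (fun t x => b t x i)) ->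
  (forall x, eta x 0 = vzero /\
     solves_ode (fun t y => vadd (b t (Om x t)) (mulmv (Dx t (Om x t)) y)) (eta x)) ->
  forall i, cont_vec (fun x => eta x T i).
Proof.
move=> T0 HDx cDx HOm cb Heta i0; apply/cont_vecP => x0 e e0.
set u := Om x0; set v := eta x0.
have cu : cont_curve u := solution_cont (HOm x0).2.
have cv : cont_curve v := solution_cont (Heta x0).2.
have k0 := pos_INR k.
have [c [c0 Hc]] : exists c, 0 < c /\ forall p : 'I_k * 'I_k, forall t, 0 <= t <= T ->
    Rabs (Dx t (u t) p.1 p.2) <= / c /\ Rabs (v t p.1) <= / c.
  apply: (@finite_radius _ (fun p c => forall t, 0 <= t <= T ->
    Rabs (Dx t (u t) p.1 p.2) <= / c /\ Rabs (v t p.1) <= / c)).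
    move=> p c c' cc H t Ht; have [H1 H2] := H t Ht.
    by split; [apply: Rle_trans H1 _ | apply: Rle_trans H2 _];
      apply: Rinv_le_contravar; lra.
  move=> p; have [B [B0 HB]] := curve_bound 0 T (cDx p.1 p.2) cu.
  have cp : cont_tvec (fun (_ : R) (y : Vec k) => y p.1).
    by apply/cont_tvecP => t x e' e'0; exists e'; split=> // s y _ /(_ p.1).
  have [B' [B'0 HB']] := curve_bound 0 T cp cv.
  have Bi : 0 < B + B' + 1 by lra.
  exists (/ (B + B' + 1)); split; first exact: Rinv_0_lt_compat.
  by move=> t Ht; rewrite Rinv_inv; have := HB t Ht; have := HB' t Ht; lra.
have ci : 0 < / c by apply: Rinv_0_lt_compat.
pose L := / c + 1.
pose C := (2 * L + 1) * INR k + INR k + 1.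
have ep := exp_pos (C * T).
(* The forcing will be at most [Q = q * (1 + INR k * / c)], and Gronwall gives
   [energy (w T) <= Q * Q * exp (C * T)], which is at most the square of [q * K]. *)
pose K := (1 + INR k * / c) * (1 + exp (C * T)).
have K1 : 1 <= K.
  by rewrite /K; have := Rmult_le_pos _ _ k0 (Rlt_le _ _ ci); nra.
pose q := Rmin 1 (e / (K + 1)).
have q0 : 0 < q by apply: Rmin_glb_lt; [lra | apply: Rdiv_lt_0_compat; lra].
have q1 : q <= 1 := Rmin_l _ _.
have qK : q * K < e.
  apply: (Rle_lt_trans _ (e / (K + 1) * K)).
    by apply: Rmult_le_compat_r; [lra | apply: Rmin_r].
  have -> : e / (K + 1) * K = e - e / (K + 1) by field; lra.
  have H : 0 < e / (K + 1) by apply: Rdiv_lt_0_compat; lra.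
  by lra.
have [r [r0 Hr]] : exists r, 0 < r /\ forall p : 'I_k * 'I_k, forall t, 0 <= t <= T ->
    forall x, close r (u t) x -> Rabs (Dx t x p.1 p.2 - Dx t (u t) p.1 p.2) < q /\
      Rabs (b t x p.1 - b t (u t) p.1) < q.
  apply: (@finite_radius _ (fun p r => forall t, 0 <= t <= T ->
    forall x, close r (u t) x -> Rabs (Dx t x p.1 p.2 - Dx t (u t) p.1 p.2) < q /\
      Rabs (b t x p.1 - b t (u t) p.1) < q)).
    by move=> p c1 c' cc H t Ht x xc; apply: H => //; apply: close_weak xc; lra.
  move=> p; have [d [d0 Hd]] := curve_unif 0 T (cDx p.1 p.2) cu q0.
  have [d' [d'0 Hd']] := curve_unif 0 T (cb p.1) cu q0.
  exists (Rmin d d'); split; first exact: Rmin_glb_lt.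
  move=> t Ht x xd; split.
    by apply: Hd => //; apply: close_weak xd; apply: Rmin_l.
  by apply: Hd' => //; apply: close_weak xd; apply: Rmin_r.
have [d [d0 Hd]] := flow_cont x0 T0 HDx cDx HOm r0.
exists d; split=> // x xd; have {Hd} near := Hd x xd.
pose w t : Vec k := fun i => eta x t i - v t i.
pose dw t i := (b t (Om x t) i + mulmv (Dx t (Om x t)) (eta x t) i) -
  (b t (u t) i + mulmv (Dx t (u t)) (v t) i).
have dwP t i : derivable_pt_lim (fun t => w t i) t (dw t i).
  apply: (derivable_pt_lim_minus (fun t => eta x t i) (fun t => v t i)).
    exact: (Heta x).2.
  exact: (Heta x0).2.
pose Q := q * (1 + INR k * / c).
have L0 : 0 <= L by rewrite /L; lra.
have := @energy_growth w dw L Q T T0 L0 dwP.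
rewrite -/C => G.
have w0 : energy (w 0) = 0.
  rewrite /energy (@sumk_ext _ _ (fun=> 0)); first by rewrite sumk_const Rmult_0_r.
  by move=> i; rewrite /w /v !(Heta _).1; ring.
rewrite w0 Rplus_0_l in G.
have {}G : energy (w T) + Q * Q <= Q * Q * exp (C * T).
  apply: G => t i Ht; have Ht' : 0 <= t <= T by lra.
  have dwE : dw t i = (b t (Om x t) i - b t (u t) i) +
     sumk (fun j => (Dx t (Om x t) i j - Dx t (u t) i j) * v t j + Dx t (Om x t) i j * w t j).
    have -> : sumk (fun j => (Dx t (Om x t) i j - Dx t (u t) i j) * v t j + Dx t (Om x t) i j * w t j)
      = mulmv (Dx t (Om x t)) (eta x t) i + (- 1) * mulmv (Dx t (u t)) (v t) i.
      rewrite /mulmv -sumk_scal -sumk_plus; apply: sumk_ext => j; rewrite /w; ring.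
    by rewrite /dw; ring.
  rewrite dwE; apply: Rle_trans (Rabs_triang _ _) _.
  have B1 := (Hr (i, i) t Ht' _ (near t Ht')).2; rewrite /= in B1.
  have B2 : Rabs (sumk (fun j => (Dx t (Om x t) i j - Dx t (u t) i j) * v t j + Dx t (Om x t) i j * w t j))
     <= sumk (fun j => q * / c + L * Rabs (w t j)).
    apply: Rle_trans (sumk_abs _) _; apply: sumk_le => j.
    apply: Rle_trans (Rabs_triang _ _) _; rewrite !Rabs_mult.
    have := (Hr (i, j) t Ht' _ (near t Ht')).1; rewrite /= => D1.
    have [/= D2 _] := Hc (i, j) t Ht'.
    have [/= _ D3] := Hc (j, j) t Ht'.
    apply: Rplus_le_compat.
      by apply: Rmult_le_compat; try apply: Rabs_pos; lra.
    apply: Rmult_le_compat_r; first exact: Rabs_pos.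
    by rewrite /L; split_Rabs; lra.
  have S : sumk (fun j => q * / c + L * Rabs (w t j)) =
      INR k * (q * / c) + L * sumk (fun j => Rabs (w t j)).
    by rewrite sumk_plus sumk_const sumk_scal.
  by rewrite /Q; lra.
have E : energy (w T) <= Q * Q * exp (C * T) by have := Rle_0_sqr Q; rewrite /Rsqr; lra.
change (Rabs (w T i0) < e); apply: energy_close => //.
apply: (Rle_lt_trans _ (q * K * (q * K))); last first.
  have H : 0 <= q * K by apply: Rmult_le_pos; lra.
  by nra.
apply: Rle_trans E _.
have Q0 : 0 <= Q * Q by have := Rle_0_sqr Q; rewrite /Rsqr; lra.
have -> : q * K * (q * K) = Q * Q * ((1 + exp (C * T)) * (1 + exp (C * T))).
  by rewrite /Q /K; ring.
by apply: Rmult_le_compat_l => //; nra.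
Qed.

End Odes.

(** * Smoothed piecewise linear interpolation *)

(** [srelu e] is of class C^1 and equals [Rmax 0] outside the interval from [-e]
    to [e]. *)
Definition relu2 (t : R) := Rmax 0 t * Rmax 0 t.
Definition srelu (e t : R) := (relu2 (t + e) - relu2 (t - e)) / (4 * e).

Lemma relu2_derivable t : derivable_pt_lim relu2 t (2 * Rmax 0 t).
Proof.
move=> e e0; exists (mkposreal e e0) => h h0 /= he.
have -> : (relu2 (t + h) - relu2 t) / h - 2 * Rmax 0 t =
    (relu2 (t + h) - relu2 t - 2 * Rmax 0 t * h) / h by field.
rewrite /Rdiv Rabs_mult Rabs_inv.
have ha : 0 < Rabs h by apply: Rabs_pos_lt.
apply: (Rmult_lt_reg_r (Rabs h)) => //; rewrite Rmult_assoc Rinv_l ?Rmult_1_r; last by lra.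
apply: (Rle_lt_trans _ (Rabs h * Rabs h)); last by nra.
rewrite -Rabs_mult (Rabs_pos_eq (h * h)); last by nra.
rewrite /relu2 /Rmax; do 2 case: Rle_dec => ?; apply: Rabs_le; split; nra.
Qed.

(** Half of [relu2] is an antiderivative of [Rmax 0], so [srelu e t] is the mean of [Rmax 0] over
    the interval from [t - e] to [t + e], and its derivative is a difference quotient of
    [Rmax 0]. *)
Lemma srelu_derivable e t : 0 < e ->
  derivable_pt_lim (srelu e) t ((2 * Rmax 0 (t + e) - 2 * Rmax 0 (t - e)) / (4 * e)).
Proof.
move=> e0; have D s : derivable_pt_lim (fun t => relu2 (t + s)) t (2 * Rmax 0 (t + s)).
  rewrite -[X in derivable_pt_lim _ _ X]Rmult_1_r.
  apply: (derivable_pt_lim_comp (fun t => t + s) relu2); last exact: relu2_derivable.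
  rewrite -[X in derivable_pt_lim _ _ X]Rplus_0_r.
  by apply: derivable_pt_lim_plus; [apply: derivable_pt_lim_id | apply: derivable_pt_lim_const].
have := derivable_pt_lim_scal _ (/ (4 * e)) _ _ (derivable_pt_lim_minus _ _ _ _ _ (D e) (D (- e))).
have -> : / (4 * e) * (2 * Rmax 0 (t + e) - 2 * Rmax 0 (t + - e)) =
    (2 * Rmax 0 (t + e) - 2 * Rmax 0 (t - e)) / (4 * e).
  by rewrite /Rdiv /Rminus; ring.
apply: derivable_pt_lim_ext => s.
by rewrite /mult_real_fct /minus_fct /srelu /Rdiv /Rminus; ring.
Qed.

Lemma srelu_pos e t : 0 < e -> e <= t -> srelu e t = t.
Proof.
by move=> e0 et; rewrite /srelu /relu2 !Rmax_right; [field | | ]; lra.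
Qed.

Lemma srelu_neg e t : 0 < e -> t <= - e -> srelu e t = 0.
Proof.
by move=> e0 et; rewrite /srelu /relu2 !Rmax_left; [field | | ]; lra.
Qed.

Lemma srelu_exact e t : 0 < e -> e <= Rabs t -> srelu e t = Rmax 0 t.
Proof.
move=> e0; rewrite /Rabs /Rmax; case: Rcase_abs => t0 et; case: Rle_dec => // t1; try lra.
- by rewrite srelu_neg; lra.
by rewrite srelu_pos; lra.
Qed.

Lemma srelu_approx e t : 0 < e -> Rabs (srelu e t - Rmax 0 t) <= e.
Proof.
move=> e0; case: (Rle_dec e (Rabs t)) => et.
  by rewrite srelu_exact // Rminus_diag Rabs_R0; lra.
have {}et : - e < t < e by move: et; split_Rabs; lra.
rewrite /srelu /relu2 (Rmax_right 0 (t + e)) ?(Rmax_left 0 (t - e)); try lra.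
have -> : ((t + e) * (t + e) - 0 * 0) / (4 * e) = (t + e) * ((t + e) / (4 * e)) by field; lra.
have H1 : 0 < (t + e) / (4 * e) by apply: Rdiv_lt_0_compat; lra.
have H2 : (t + e) / (4 * e) <= / 2.
  by apply: (Rmult_le_reg_r (4 * e)); [lra | rewrite /Rdiv Rmult_assoc Rinv_l; lra].
by apply: Rabs_le; rewrite /Rmax; case: Rle_dec => ?; split; nra.
Qed.

Definition fmax (s : seq R) := foldr Rmax 0 s.
(** Smoothed form of [Rmax x m = m + Rmax 0 (x - m)]; every step adds an error of at most [e]. *)
Definition smax e (s : seq R) := foldr (fun x m => m + srelu e (x - m)) 0 s.

Lemma fmax_ge0 s : 0 <= fmax s.
Proof.
by elim: s => [|x s IH] /=; [lra | apply: Rle_trans IH (Rmax_r _ _)].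
Qed.

Lemma smax_approx e s : 0 < e -> Rabs (smax e s - fmax s) <= INR (size s) * e.
Proof.
move=> e0; elim: s => [|x s IH]; first by rewrite /= Rminus_diag Rabs_R0; lra.
rewrite [size _]/= S_INR /=; set m := smax e s in IH *.
have := srelu_approx (x - m) e0.
have : Rabs (m + Rmax 0 (x - m) - Rmax x (fmax s)) <= Rabs (m - fmax s).
  by rewrite /Rmax; do 2 case: Rle_dec => ?; split_Rabs; lra.
by split_Rabs; lra.
Qed.

Section Family.
Context (I : eqType) (u : I -> R).

Lemma fmax_mem s : fmax (map u s) = 0 \/ exists2 i, i \in s & fmax (map u s) = u i.
Proof.
elim: s => [|i s IH] /=; first by left.
rewrite /Rmax; case: Rle_dec => _; last by right; exists i; rewrite ?mem_head.
case: IH => [|[j js E]]; first by left.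
by right; exists j; rewrite // in_cons js orbT.
Qed.

Lemma fmax_ub s i : i \in s -> u i <= fmax (map u s).
Proof.
elim: s => // j s IH; rewrite in_cons /= => /orP[/eqP ->|/IH H]; first exact: Rmax_l.
by apply: Rle_trans H (Rmax_r _ _).
Qed.

Lemma fmax_eq s m : 0 <= m -> (forall i, i \in s -> u i <= m) ->
  m = 0 \/ (exists2 i, i \in s & m = u i) -> fmax (map u s) = m.
Proof.
move=> m0 ub att; apply: Rle_antisym.
  by case: (fmax_mem s) => [->//|[i si ->]]; apply: ub.
by case: att => [->|[i si ->]]; [apply: fmax_ge0 | apply: fmax_ub].
Qed.

Lemma smax_exact e s : 0 < e -> uniq s -> (forall i, i \in s -> e <= Rabs (u i)) ->
  (forall i j, i != j -> e <= Rabs (u i - u j)) ->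
  smax e (map u s) = fmax (map u s).
Proof.
move=> e0; elim: s => //= i s IH /andP[si us] u0 sep.
rewrite IH // => [|j js]; last by apply: u0; rewrite in_cons js orbT.
rewrite srelu_exact //; first by rewrite /Rmax; do 2 case: Rle_dec => ?; lra.
case: (fmax_mem s) => [->|[j js ->]].
  by rewrite Rminus_0_r; apply: u0; rewrite mem_head.
by apply: sep; apply: contraNneq si => ->.
Qed.

End Family.

Section Hat.
Context {k : nat}.

(** The piecewise linear function on the Kuhn triangulation which is 1 at the origin
    and 0 at the other lattice points. *)
Definition hat (u : Vec k) := Rmax 0 (1 - fmax (map u (enum 'I_k)) -
  fmax (map (fun i => - u i) (enum 'I_k))).
Definition shat e (u : Vec k) := srelu e (1 - smax e (map u (enum 'I_k)) -
  smax e (map (fun i => - u i) (enum 'I_k))).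

Lemma shat_approx e u : 0 < e -> Rabs (shat e u - hat u) <= (2 * INR k + 1) * e.
Proof.
move=> e0; rewrite /shat /hat; set P := fmax _; set Q := fmax _; set p := smax _ _; set q := smax _ _.
have := smax_approx (map u (enum 'I_k)) e0; rewrite size_map size_enum_ord -/P -/p.
have := smax_approx (map (fun i => - u i) (enum 'I_k)) e0; rewrite size_map size_enum_ord -/Q -/q.
have := srelu_approx (1 - p - q) e0.
rewrite /Rmax; do 2 case: Rle_dec => ?; split_Rabs; lra.
Qed.

Lemma hat_gt0 u : hat u <> 0 ->
  [/\ forall i, u i < 1, forall i, - 1 < u i & forall i j, u i - u j < 1].
Proof.
rewrite /hat => H; have {H} : 0 < 1 - fmax (map u (enum 'I_k)) -
  fmax (map (fun i => - u i) (enum 'I_k)).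
  by move: H; rewrite /Rmax; case: Rle_dec => ?; lra.
have P i : u i <= fmax (map u (enum 'I_k)) by apply: fmax_ub; rewrite mem_enum.
have Q i : - u i <= fmax (map (fun i => - u i) (enum 'I_k)).
  by apply: (fmax_ub (fun i => - u i)); rewrite mem_enum.
have P0 := fmax_ge0 (map u (enum 'I_k)).
have Q0 := fmax_ge0 (map (fun i => - u i) (enum 'I_k)).
by move=> H; split=> i; [have := P i | have := Q i | move=> j; have := P i; have := Q j]; lra.
Qed.

(** Up to sign, the arguments of the inner [srelu] are the [u i] and their differences. The outer
    argument is 1, [1 - u i], [1 + u j] or [1 - (u i - u j)], according to where the two maxima are
    attained. All must avoid the smoothing interval. *)
Lemma shat_exact e (u : Vec k) : 0 < e -> e <= 1 ->
  (forall i, e <= Rabs (u i)) -> (forall i, e <= Rabs (1 - u i)) ->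
  (forall i, e <= Rabs (1 + u i)) -> (forall i j, i != j -> e <= Rabs (u i - u j)) ->
  (forall i j, i != j -> e <= Rabs (1 - (u i - u j))) -> shat e u = hat u.
Proof.
move=> e0 e1 u0 u1 u1' sep sep1.
rewrite /shat smax_exact ?enum_uniq // (smax_exact (u := fun i => - u i)) ?enum_uniq //.
- rewrite srelu_exact //.
  have P0 := fmax_ge0 (map u (enum 'I_k)).
  have Q0 := fmax_ge0 (map (fun i => - u i) (enum 'I_k)).
  case: (fmax_mem u (enum 'I_k)) => [EP|[i _ EP]];
    case: (fmax_mem (fun i => - u i) (enum 'I_k)) => [EQ|[j _ EQ]]; rewrite EP EQ.
  + by rewrite !Rminus_0_r Rabs_R1.
  + by rewrite Rminus_0_r /Rminus Ropp_involutive.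
  + by rewrite Rminus_0_r.
  (* One index cannot attain both maxima: this would force [u i = 0]. *)
  have [ij|ij] := eqVneq i j.
    by rewrite EP in P0; rewrite EQ -ij in Q0; have := u0 i; split_Rabs; lra.
  by have := sep1 i j ij; rewrite (_ : 1 - u i - - u j = 1 - (u i - u j)); [|ring].
- by move=> i _; rewrite Rabs_Ropp.
- by move=> i j ij; rewrite (_ : - u i - - u j = u j - u i); [apply: sep; rewrite eq_sym | ring].
Qed.

End Hat.

Section C1.
Context {k : nat}.
Implicit Types (f g : Vec k -> R).

Definition C1fun f := cont_vec f /\
  exists Df : 'I_k -> Vec k -> R, partials f Df /\ forall j, cont_vec (Df j).

Lemma cont_vec_const c : cont_vec (fun _ : Vec k => c).
Proof.
by move=> x e e0; exists 1; split; [lra | move=> y _; rewrite Rminus_diag Rabs_R0].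
Qed.

Lemma cont_vec_plus f g : cont_vec f -> cont_vec g -> cont_vec (fun x => f x + g x).
Proof.
move=> cf cg x e e0.
have [d [d0 Hd]] := cf x (e / 2) ltac:(lra).
have [d' [d'0 Hd']] := cg x (e / 2) ltac:(lra).
exists (Rmin d d'); split; first exact: Rmin_glb_lt.
move=> y yx; have := Rmin_l d d'; have := Rmin_r d d' => m1 m2.
by have := Hd y ltac:(lra); have := Hd' y ltac:(lra); split_Rabs; lra.
Qed.

Lemma cont_vec_mult f g : cont_vec f -> cont_vec g -> cont_vec (fun x => f x * g x).
Proof.
move=> cf cg x e e0.
pose B := Rabs (f x) + Rabs (g x) + 1 + e.
have B0 : 0 < B by have := Rabs_pos (f x); have := Rabs_pos (g x); rewrite /B; lra.
have eB : 0 < e / (3 * B) by apply: Rdiv_lt_0_compat; lra.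
have [d [d0 Hd]] := cf x _ eB.
have [d' [d'0 Hd']] := cg x _ eB.
exists (Rmin d d'); split; first exact: Rmin_glb_lt.
move=> y yx; have := Rmin_l d d'; have := Rmin_r d d' => m1 m2.
have Ha := Hd y ltac:(lra); have Hb := Hd' y ltac:(lra).
have -> : f y * g y - f x * g x = (f y - f x) * (g y - g x) + (f x * (g y - g x) + g x * (f y - f x)) by ring.
set q := e / (3 * B) in eB Ha Hb.
have qB : q * B = e / 3 by rewrite /q; field; lra.
have q1 : q < 1 by rewrite /B in qB; have := Rabs_pos (f x); have := Rabs_pos (g x); nra.
apply: Rle_lt_trans (Rabs_triang _ _) _; rewrite Rabs_mult.
have := Rabs_triang (f x * (g y - g x)) (g x * (f y - f x)); rewrite !Rabs_mult.
have := Rabs_pos (f x); have := Rabs_pos (g x).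
have := Rabs_pos (f y - f x); have := Rabs_pos (g y - g x).
rewrite /B in qB *; nra.
Qed.

Lemma cont_vec_comp (phi : R -> R) f :
  (forall t, continuity_pt phi t) -> cont_vec f -> cont_vec (fun x => phi (f x)).
Proof.
move=> cp cf x e e0; have [d [d0 Hd]] := cp (f x) e e0.
have [d' [d'0 Hd']] := cf x d d0; exists d'; split=> // y /Hd' yx.
case: (Req_dec (f x) (f y)) => [->|ne]; first by rewrite Rminus_diag Rabs_R0.
by apply: Hd; split; [split|].
Qed.

Lemma C1fun_const c : C1fun (fun=> c).
Proof.
split; first exact: cont_vec_const.
exists (fun _ _ => 0); split; last by move=> _; apply: cont_vec_const.
by move=> x j; apply: derivable_pt_lim_const.
Qed.

Lemma C1fun_coord l : C1fun (fun x => x l).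
Proof.
split.
  by move=> x e e0; exists e; split=> // y /close_vnorm.
exists (fun j _ => evec j l); split; last by move=> j; apply: cont_vec_const.
move=> x j; rewrite -[evec j l]Rplus_0_l /vadd /vscal.
apply: (derivable_pt_lim_plus (fun _ => x l) (fun h => h * evec j l)).
  exact: derivable_pt_lim_const.
have E : 1 * evec j l + id 0 * 0 = evec j l by rewrite /id; ring.
rewrite -[X in derivable_pt_lim _ _ X]E.
apply: (derivable_pt_lim_mult id (fun _ => evec j l)).
  exact: derivable_pt_lim_id.
exact: derivable_pt_lim_const.
Qed.

Lemma C1fun_plus f g : C1fun f -> C1fun g -> C1fun (fun x => f x + g x).
Proof.
move=> [cf [Df [Pf cDf]]] [cg [Dg [Pg cDg]]]; split; first exact: cont_vec_plus.
exists (fun j x => Df j x + Dg j x); split; last by move=> j; apply: cont_vec_plus.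
by move=> x j; apply: derivable_pt_lim_plus; [apply: Pf | apply: Pg].
Qed.

Lemma C1fun_scal c f : C1fun f -> C1fun (fun x => c * f x).
Proof.
move=> [cf [Df [Pf cDf]]]; split.
  by apply: cont_vec_mult => //; apply: cont_vec_const.
exists (fun j x => c * Df j x); split; last first.
  by move=> j; apply: cont_vec_mult => //; apply: cont_vec_const.
by move=> x j; apply: derivable_pt_lim_scal; apply: Pf.
Qed.

Lemma C1fun_comp (phi dphi : R -> R) f :
  (forall t, derivable_pt_lim phi t (dphi t)) -> (forall t, continuity_pt dphi t) ->
  C1fun f -> C1fun (fun x => phi (f x)).
Proof.
move=> Dphi cdphi [cf [Df [Pf cDf]]].
have cphi t : continuity_pt phi t.
  by apply: derivable_continuous_pt; exists (dphi t); apply: Dphi.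
split; first exact: cont_vec_comp.
exists (fun j x => dphi (f x) * Df j x); split; last first.
  by move=> j; apply: cont_vec_mult => //; apply: cont_vec_comp.
move=> x j; have fx : f x = f (vadd x (vscal 0 (evec j))).
  by congr f; apply: functional_extensionality => i; rewrite /vadd /vscal; ring.
apply: (derivable_pt_lim_comp (fun h => f (vadd x (vscal h (evec j)))) phi).
  exact: Pf.
by rewrite -fx.
Qed.

Lemma C1fun_srelu e f : 0 < e -> C1fun f -> C1fun (fun x => srelu e (f x)).
Proof.
move=> e0; apply: C1fun_comp => [t|t]; first exact: srelu_derivable.
have cm : forall s, continuity_pt (fun t => Rmax 0 (t + s)) t.
  move=> s d d0; exists d; split=> // y [_] /=; rewrite /R_dist /Rdist.
  by rewrite /Rmax; do 2 case: Rle_dec => ?; split_Rabs; lra.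
apply: (continuity_pt_mult (fun t => 2 * Rmax 0 (t + e) - 2 * Rmax 0 (t - e)) (fun _ => / (4 * e))).
  apply: (continuity_pt_minus (fun t => 2 * Rmax 0 (t + e)) (fun t => 2 * Rmax 0 (t - e))).
    by apply: (continuity_pt_scal (fun t => Rmax 0 (t + e))); apply: cm.
  by apply: (continuity_pt_scal (fun t => Rmax 0 (t - e))); apply: (cm (- e)).
by apply: continuity_pt_const.
Qed.

Lemma C1fun_minus f g : C1fun f -> C1fun g -> C1fun (fun x => f x - g x).
Proof.
move=> Cf Cg; have := C1fun_plus Cf (C1fun_scal (- 1) Cg).
by congr C1fun; apply: functional_extensionality => x; ring.
Qed.

Lemma C1fun_smax (I : Type) (u : I -> Vec k -> R) e s : 0 < e -> (forall i, C1fun (u i)) ->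
  C1fun (fun x => smax e (map (fun i => u i x) s)).
Proof.
move=> e0 Cu; elim: s => [|i s IH] /=; first exact: C1fun_const.
apply: C1fun_plus => //; apply: C1fun_srelu => //; exact: C1fun_minus.
Qed.

Lemma C1fun_shat m (u : 'I_m -> Vec k -> R) e : 0 < e -> (forall i, C1fun (u i)) ->
  C1fun (fun x => shat e (fun i => u i x)).
Proof.
move=> e0 Cu; apply: C1fun_srelu => //; apply: C1fun_minus.
  by apply: C1fun_minus; [apply: C1fun_const | apply: C1fun_smax].
apply: (C1fun_smax (u := fun i x => - u i x)) => // i.
have := C1fun_scal (- 1) (Cu i); congr C1fun; apply: functional_extensionality => x; ring.
Qed.

Lemma C1fun_sum (I : finType) (u : I -> Vec k -> R) : (forall i, C1fun (u i)) ->
  C1fun (fun x => \sum_i u i x)%R.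
Proof.
move=> Cu; elim: (index_enum I) => [|i s IH].
  have := C1fun_const 0; congr C1fun; apply: functional_extensionality => x.
  by rewrite big_nil.
have := C1fun_plus (Cu i) IH; congr C1fun; apply: functional_extensionality => x.
by rewrite big_cons.
Qed.

End C1.

(** * Barycentric coordinates in Kuhn simplices *)

Section Barycentric.
Context (n N : nat).
Local Notation k := n.+1.
Local Notation V := {ffun 'I_k -> 'I_N.+2}.
Implicit Types (y : Vec k) (z v : V) (r : 'S_k).

Definition frac y z (l : 'I_k) : R := y l - INR (z l).

(** The fractional parts of [y] in the order of their ranks, framed by 1 and 0; the
    barycentric coordinates are the successive differences. *)
Definition lev y z r (m : nat) : R :=
  if m is m'.+1 then
    if @insub _ (fun m => m < k)%N _ m' is Some j then frac y z ((r^-1)%g j) else 0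
  else 1.

Definition bary y z r (i : nat) : R := lev y z r i - lev y z r i.+1.

Lemma lev_ord y z r (j : 'I_k) : lev y z r j.+1 = frac y z ((r^-1)%g j).
Proof. by rewrite /lev valK. Qed.

Lemma lev_rank y z r l : lev y z r (r l).+1 = frac y z l.
Proof. by rewrite lev_ord permK. Qed.

Lemma lev_max y z r : lev y z r k.+1 = 0.
Proof. by rewrite /lev insubF // ltnn. Qed.

Lemma sum_bary_lt y z r m : (\sum_(i < m) bary y z r i)%R = 1 - lev y z r m.
Proof.
elim: m => [|m IH]; first by rewrite big_ord0 /= Rminus_diag.
rewrite big_ord_recr IH /bary.
change (1 - lev y z r m + (lev y z r m - lev y z r m.+1) = 1 - lev y z r m.+1).
by ring.
Qed.

Lemma sum_bary y z r : (\sum_(i < k.+1) bary y z r i)%R = 1.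
Proof. by rewrite sum_bary_lt lev_max Rminus_0_r. Qed.

Lemma lev_gap y z r e m m' : 0 <= e -> (forall i : 'I_k.+1, e <= bary y z r i) ->
  (m < m' <= k.+1)%N -> e <= lev y z r m - lev y z r m'.
Proof.
move=> e0 He /andP[]; elim: m' => // m' IH; rewrite ltnS leq_eqVlt => /orP[/eqP <-|mm'] km'.
  exact: (He (Ordinal km')).
have := IH mm' (ltnW km'); have := He (Ordinal km'); rewrite /bary /=; lra.
Qed.

Lemma lev_mono y z r m m' : (forall i : 'I_k.+1, 0 <= bary y z r i) ->
  (m <= m' <= k.+1)%N -> lev y z r m' <= lev y z r m.
Proof.
move=> b0 /andP[]; rewrite leq_eqVlt => /orP[/eqP ->|mm'] km'; first by lra.
by have := @lev_gap y z r 0 m m' (Rle_refl 0) b0; rewrite mm' km' => /(_ isT); lra.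
Qed.

Lemma frac_bounds y z r e l : 0 <= e -> (forall i : 'I_k.+1, e <= bary y z r i) ->
  e <= frac y z l <= 1 - e.
Proof.
move=> e0 He; rewrite -(lev_rank y z r).
have rk := ltn_ord (r l).
have := @lev_gap y z r e 0 (r l).+1 e0 He ltac:(lia).
have := @lev_gap y z r e (r l).+1 k.+1 e0 He ltac:(lia).
by rewrite lev_max /=; lra.
Qed.

Lemma INR_vert z r i l : (z l < N.+1)%N ->
  INR (vert z r i l) = INR (z l) + (if (r l < i)%N then 1 else 0).
Proof.
move=> zl; rewrite ffunE; case: ifP => ri.
  rewrite -[1]/(INR 1) -plus_INR; congr INR.
  by rewrite /= modnDmr modn_small // addn1.
by rewrite Rplus_0_r GRing.addr0.
Qed.

(** The coordinate [N.+1] is excluded because raising it would wrap around to 0. *)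
Definition in_cells z := forall l, (z l < N.+1)%N.

Definition diff y v : Vec k := fun l => y l - INR (v l).

Lemma diff_vert y z r i l : in_cells z ->
  diff y (vert z r i) l = frac y z l - (if (r l < i)%N then 1 else 0).
Proof. by move=> zc; rewrite /diff INR_vert // /frac; ring. Qed.

(** Relative to vertex [i], the coordinates of rank at least [i] are fractional parts, with maximum
    [lev y z r i.+1]; the others are fractional parts minus 1, and the maximum of their negatives is
    [1 - lev y z r i]. The formula of [hat] then yields the difference of two successive levels. *)
Lemma hat_vert y z r (i : 'I_k.+1) : in_cells z ->
  (forall i : 'I_k.+1, 0 <= bary y z r i) -> hat (diff y (vert z r i)) = bary y z r i.
Proof.
move=> zc b0; have mono := lev_mono b0.
have ik : (i <= k)%N by rewrite -ltnS.
have fl l : 0 <= frac y z l <= 1 by have := frac_bounds l (Rle_refl 0) b0; lra.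
have P : fmax (map (diff y (vert z r i)) (enum 'I_k)) = lev y z r i.+1.
  apply: fmax_eq.
  - by rewrite -(lev_max y z r); apply: mono; rewrite ltnS ik leqnn.
  - move=> l _; rewrite diff_vert //; case: ltnP => ri.
      have : 0 <= lev y z r i.+1 by rewrite -(lev_max y z r); apply: mono; rewrite ltnS ik leqnn.
      have := fl l; lra.
    rewrite -(lev_rank y z r) Rminus_0_r; apply: mono.
    by rewrite !ltnS ri ltnW ?ltn_ord.
  move: ik; rewrite leq_eqVlt => /orP[/eqP ->|ik]; first by left; rewrite lev_max.
  right; exists ((r^-1)%g (Ordinal ik)); first by rewrite mem_enum.
  by rewrite diff_vert // permKV ltnn -(lev_rank y z r) permKV Rminus_0_r.
have Q : fmax (map (fun l => - diff y (vert z r i) l) (enum 'I_k)) = 1 - lev y z r i.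
  apply: (fmax_eq (u := fun l => - diff y (vert z r i) l)).
  - have : lev y z r i <= lev y z r 0 by apply: mono; rewrite leq0n ltnW.
    by rewrite /=; lra.
  - move=> l _; rewrite diff_vert //; case: ltnP => ri.
      have : lev y z r i <= frac y z l.
        by rewrite -(lev_rank y z r); apply: mono; rewrite ri ltnW.
      by lra.
    have : lev y z r i <= lev y z r 0 by apply: mono; rewrite leq0n ltnW.
    have := fl l; rewrite /=; lra.
  case: (posnP i) => [->|i0]; first by left; rewrite /= Rminus_diag.
  have ik' : (i.-1 < k)%N by rewrite prednK.
  right; exists ((r^-1)%g (Ordinal ik')); first by rewrite mem_enum.
  have -> : lev y z r i = frac y z ((r^-1)%g (Ordinal ik')).
    by rewrite -lev_ord; congr lev; rewrite /= prednK.
  have lt_i : (Ordinal ik' < i)%N by rewrite /= prednK.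
  by rewrite diff_vert // permKV lt_i; ring.
rewrite /hat P Q (_ : 1 - _ - _ = bary y z r i); last by rewrite /bary; ring.
by rewrite Rmax_right.
Qed.

(** A nonzero value forces every [v l] to be [z l] or [z l + 1], and the raised coordinates to have
    larger fractional parts than the others. The raised ones are thus the first in rank, and the
    vertex index is the least rank of a coordinate that is not raised. *)
Lemma hat_support y z r v : in_cells z -> (forall i : 'I_k.+1, 0 <= bary y z r i) ->
  hat (diff y v) <> 0 -> exists i : 'I_k.+1, v = vert z r i.
Proof.
move=> zc b0 /hat_gt0[u1 u1' uu].
have fl l : 0 <= frac y z l <= 1 by have := frac_bounds l (Rle_refl 0) b0; lra.
have vz l : v l = z l :> nat \/ v l = (z l).+1 :> nat.
  have := u1 l; have := u1' l; have := fl l; rewrite /diff /frac => f1 d1 d2.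
  have /ssrnat.ltP a1 : (z l < (v l).+1)%coq_nat by apply: INR_lt; rewrite S_INR; lra.
  have /ssrnat.ltP a2 : (v l < (z l).+2)%coq_nat by apply: INR_lt; rewrite !S_INR; lra.
  by move: a1 a2; rewrite !ltnS => a1; rewrite leq_eqVlt ltnS => /orP[/eqP|a2]; [right|left; apply/eqP; rewrite eqn_leq a1 a2].
case: (pickP (fun l => v l == z l :> nat)) => [l0 l0z|none].
  case: (@arg_minnP _ l0 (fun l => v l == z l :> nat) (fun l => nat_of_ord (r l)) l0z).
  move=> l1 /eqP l1z l1min; exists (widen_ord (leqnSn k) (r l1)).
  apply/ffunP=> l; apply: val_inj => /=; apply: INR_eq; rewrite INR_vert //=.
  case: (vz l) => vl; last first.
    rewrite vl S_INR; case: ifP => // /negbT; rewrite -leqNgt leq_eqVlt.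
    case/orP => [/eqP/val_inj/perm_inj E|rl]; first by move: vl; rewrite -E l1z; lia.
    have := uu l1 l; rewrite /diff l1z vl S_INR -/(frac y z l1).
    have : lev y z r (r l).+1 <= lev y z r (r l1).+1.
      by apply: lev_mono => //; rewrite !ltnS ltnW //= ltnW // ltn_ord.
    rewrite !lev_rank /frac; lra.
  by rewrite vl ltnNge l1min ?vl // Rplus_0_r.
exists ord_max; apply/ffunP=> l; apply: val_inj => /=; apply: INR_eq; rewrite INR_vert //=.
rewrite ltn_ord -S_INR; congr INR; case: (vz l) => // vl.
by have := none l; rewrite vl eqxx.
Qed.

Lemma hat_sum (c : V -> R) y z r : in_cells z -> (forall i : 'I_k.+1, 0 <= bary y z r i) ->
  (\sum_v c v * hat (diff y v))%R = (\sum_(i < k.+1) c (vert z r i) * bary y z r i)%R.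
Proof.
move=> zc b0.
pose A := [set vert z r i | i : 'I_k.+1].
rewrite (bigID (mem A)) /= [X in (_ + X)%R]big1 ?GRing.addr0; last first.
  move=> v vA; case: (Req_dec (hat (diff y v)) 0) => [->|/(hat_support zc b0)[i vi]].
    by rewrite GRing.mulr0.
  by case/negP: vA; rewrite vi; apply: imset_f.
rewrite big_imset /=; last by move=> i j _ _; apply: vert_inj.
by apply: eq_bigr => i _; rewrite hat_vert.
Qed.

Lemma far_from_integers a e (m : Z) : e <= a <= 1 - e -> e <= Rabs (a - IZR m).
Proof.
move=> ae; case: (Z_le_gt_dec m 0) => m0.
  by have := IZR_le _ _ m0; split_Rabs; lra.
have : Z.le 1 m by lia.
by move=> /IZR_le; split_Rabs; lra.
Qed.

(** Successive levels differ by at least [e], so fractional parts and the distances between them lie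
    between [e] and [1 - e]. Hence the quantities in [shat_exact] keep distance [e] from the
    integers, for every lattice point [v] at once. *)
Lemma shat_diff e y z r v : 0 < e -> (forall i : 'I_k.+1, e <= bary y z r i) ->
  shat e (diff y v) = hat (diff y v).
Proof.
move=> e0 He; have e0' := Rlt_le _ _ e0.
have F l := frac_bounds l e0' He.
have dE l : diff y v l = frac y z l - IZR (Z.sub (Z.of_nat (v l)) (Z.of_nat (z l))).
  by rewrite minus_IZR -!INR_IZR_INZ /diff /frac; ring.
have D l m : e <= Rabs (diff y v l - IZR m).
  rewrite dE (_ : _ - _ - _ = frac y z l - IZR (Z.add (Z.sub (Z.of_nat (v l)) (Z.of_nat (z l))) m)).
    exact: far_from_integers.
  by rewrite plus_IZR; ring.
have gap l l' : (r l < r l')%N -> e <= frac y z l - frac y z l' <= 1 - e.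
  move=> ll; have rl := ltn_ord (r l').
  have := @lev_gap y z r e (r l).+1 (r l').+1 e0' He ltac:(lia); rewrite !lev_rank.
  by have := F l; have := F l'; lra.
have DD l l' m : l != l' -> e <= Rabs (diff y v l - diff y v l' - IZR m).
  move=> ll'; rewrite !dE.
  set a := Z.sub (Z.of_nat (v l)) _; set b := Z.sub (Z.of_nat (v l')) _.
  case: (ltngtP (r l) (r l')) => [/gap g|/gap g|/val_inj/perm_inj E]; last by rewrite E eqxx in ll'.
    rewrite (_ : _ - _ - _ - _ = (frac y z l - frac y z l') - IZR (Z.add (Z.sub a b) m)).
      exact: far_from_integers.
    by rewrite plus_IZR minus_IZR; ring.
  rewrite (_ : _ - _ - _ - _ = - ((frac y z l' - frac y z l) - IZR (Z.sub (Z.sub b a) m))).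
    by rewrite Rabs_Ropp; apply: far_from_integers.
  by rewrite !minus_IZR; ring.
apply: shat_exact => //.
- by have := F ord0; lra.
- by move=> l; have := D l Z0; rewrite Rminus_0_r.
- by move=> l; have := D l (Zpos xH); rewrite Rabs_minus_sym.
- by move=> l; have := D l (Zneg xH); rewrite (_ : _ - _ = 1 + diff y v l) //; ring.
- by move=> l l' ll; have := DD l l' Z0 ll; rewrite Rminus_0_r.
by move=> l l' ll; have := DD l l' (Zpos xH) ll; rewrite Rabs_minus_sym.
Qed.

End Barycentric.

(** * Determinants, and the location of points in the triangulation *)

Lemma fold_right_sum (s : seq nat) (f : nat -> R) :
  fold_right Rplus 0 (List.map f s) = (\sum_(i <- s) f i)%R.
Proof. by elim: s => [|i s IH] /=; rewrite ?big_nil ?big_cons ?IH. Qed.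

Lemma detnE m (A : nat -> nat -> R) : detn m A = (\det (\matrix_(i < m, j < m) A i j))%R.
Proof.
elim: m A => [|m IH] A; first by rewrite det_mx00.
rewrite (expand_det_row _ ord0) [LHS]/detn -/detn fold_right_sum.
rewrite -[iota 0 m.+1]/(index_iota 0 m.+1) big_mkord; apply: eq_bigr => j _.
rewrite mxE /cofactor IH add0n RpowE.
rewrite !RmultE [X in (X * _)%R]GRing.mulrC -GRing.mulrA.
congr (_ * (_ * \det _))%R; apply/matrixP=> a b; rewrite !mxE lift0 /= /bump.
by case: ltnP => /=; rewrite ?add1n ?add0n.
Qed.

Lemma detE k (A : Mat k) : det A = (\det (\matrix_(i < k, j < k) A i j))%R.
Proof.
rewrite /det detnE; congr (\det _)%R; apply/matrixP=> i j; rewrite !mxE /ext_mat.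
by rewrite !valK.
Qed.

Lemma nat_floor B x : 0 <= x < INR B -> exists2 m : nat, (m < B)%N & INR m <= x < INR m + 1.
Proof.
elim: B => [|B IH]; first by rewrite /=; lra.
rewrite S_INR => H; case: (Rlt_dec x (INR B)) => xB.
  have [|m mB Hm] := IH; first by split; lra.
  by exists m => //; apply: ltnW.
by exists B => //; split; lra.
Qed.

Lemma increasing_ord_ge k (f : 'I_k -> 'I_k) :
  (forall i j : 'I_k, (i < j)%N -> (f i < f j)%N) -> forall i : 'I_k, (i <= f i)%N.
Proof.
move=> mono [i ik]; elim: i ik => [|i IH] ik //=.
by have := mono (Ordinal (ltnW ik)) (Ordinal ik) (ltnSn i); have := IH (ltnW ik); rewrite /=; lia.
Qed.

Section Locate.
Context (n N : nat).
Local Notation k := n.+1.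
Local Notation V := {ffun 'I_k -> 'I_N.+2}.
Implicit Types (y : Vec k) (z v : V) (r : 'S_k).

Lemma sorting_perm (t : 'I_k -> R) : exists r : 'S_k,
  forall l l', (r l < r l')%N -> t l' <= t l.
Proof.
pose ge (a b : 'I_k) := (t b <= t a)%R.
pose s := sort ge (enum 'I_k).
have ps : perm_eq s (enum 'I_k) by rewrite perm_sort.
have us : uniq s by rewrite (perm_uniq ps) enum_uniq.
have ms l : l \in s by rewrite (perm_mem ps) mem_enum.
have ss : size s = k by rewrite (perm_size ps) size_enum_ord.
have ls l : (index l s < k)%N by rewrite -{2}ss index_mem.
have inj : injective (fun l => Ordinal (ls l)).
  move=> l l' /(congr1 val) /= E; rewrite -(nth_index l (ms l)) E nth_index //.
exists (perm inj) => l l'; rewrite !permE /= => ll.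
have tr : transitive ge by move=> a b c ba cb; exact: Order.POrderTheory.le_trans cb ba.
have sorted_s : sorted ge s by apply: sort_sorted => a b; exact: Order.TotalTheory.le_total.
have rf : reflexive ge by move=> a; exact: Order.POrderTheory.lexx.
have ins a : index a s \in [pred i | (i < size s)%N] by rewrite inE index_mem.
have := sorted_leq_nth tr rf l sorted_s _ _ (ins l) (ins l') (ltnW ll).
by rewrite !nth_index // => /RleP.
Qed.

Lemma locate y : (forall l, 0 <= y l < INR N.+1) ->
  exists z r, in_cells z /\ forall i : 'I_k.+1, 0 <= bary y z r i.
Proof.
move=> Hy.
have /fin_all_exists[f Hf] l : exists m : 'I_N.+1, INR m <= y l < INR m + 1.
  by have [m mN Hm] := nat_floor (Hy l); exists (Ordinal mN).
pose z : V := [ffun l => widen_ord (leqnSn N.+1) (f l)].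
have fz l : 0 <= frac y z l < 1.
  by rewrite /frac ffunE /=; have := Hf l; lra.
have [r Hr] := sorting_perm (frac y z).
exists z, r; split; first by move=> l; rewrite ffunE /= ltn_ord.
move=> i; rewrite /bary; case: (unliftP ord0 i) => [j ->|->].
  rewrite lift0 lev_ord; case: (ltnP j.+1 k) => jk; last first.
    have -> : j.+1 = k by have := ltn_ord j; lia.
    by rewrite lev_max; have := fz ((r^-1)%g j); lra.
  rewrite -[j.+1]/(nat_of_ord (Ordinal jk)) lev_ord.
  have := Hr ((r^-1)%g j) ((r^-1)%g (Ordinal jk)).
  by rewrite !permKV ltnSn => /(_ isT); lra.
rewrite -[(nat_of_ord ord0).+1]/((nat_of_ord (ord0 : 'I_k)).+1) lev_ord /=.
by have := fz ((r^-1)%g ord0); lra.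
Qed.

(** The fractional parts lie strictly between 0 and 1, which determines [z], and decrease strictly
    with the rank, which determines [r]: an increasing self-map of an ordinal is nowhere below the
    identity. *)
Lemma bary_unique y z z' r r' e : 0 < e ->
  (forall i : 'I_k.+1, e <= bary y z r i) -> (forall i : 'I_k.+1, e <= bary y z' r' i) ->
  z = z' /\ r = r'.
Proof.
move=> e0 H H'.
have zz : z = z'.
  apply/ffunP=> l; apply: val_inj => /=; apply: INR_eq.
  have := frac_bounds l (Rlt_le _ _ e0) H; have := frac_bounds l (Rlt_le _ _ e0) H'.
  rewrite /frac => f1 f2.
  have a1 : (z l < (z' l).+1)%coq_nat by apply: INR_lt; rewrite S_INR; lra.
  have a2 : (z' l < (z l).+1)%coq_nat by apply: INR_lt; rewrite S_INR; lra.
  by congr INR; lia.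
split=> //; subst z'.
have order (r1 r2 : 'S_k) : (forall i : 'I_k.+1, e <= bary y z r1 i) ->
    (forall i : 'I_k.+1, e <= bary y z r2 i) -> forall l, (r1 l <= r2 l)%N.
  move=> H1 H2 l.
  have gap (r0 : 'S_k) l1 l2 : (forall i : 'I_k.+1, e <= bary y z r0 i) -> (r0 l1 < r0 l2)%N ->
      frac y z l2 < frac y z l1.
    move=> H0 ll; have rl := ltn_ord (r0 l2).
    have := @lev_gap _ _ y z r0 e (r0 l1).+1 (r0 l2).+1 (Rlt_le _ _ e0) H0 ltac:(lia).
    by rewrite !lev_rank; lra.
  have := @increasing_ord_ge k (fun i => r2 ((r1^-1)%g i)) _ (r1 l).
  rewrite permK; apply=> i j ij.
  have g1 := gap r1 ((r1^-1)%g i) ((r1^-1)%g j) H1; rewrite !permKV in g1.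
  have {}g1 := g1 ij.
  case: (ltngtP (r2 ((r1^-1)%g i)) (r2 ((r1^-1)%g j))) => // [/gap|/val_inj/perm_inj E].
    by move=> /(_ H2); lra.
  by rewrite E in g1; lra.
by apply/permP=> l; apply: val_inj; apply/eqP; rewrite eqn_leq !order.
Qed.

End Locate.

(** If the segment avoided the boundary, membership in [U] would spread from [a] to [b] by real
    induction: a limit of points of [U] is in the closure, hence in [U], and then so are nearby
    points. *)
Lemma boundary_crossing k (U : Vec k -> Prop) (a b : Vec k) :
  is_open U -> U a -> ~ U b ->
  exists s, 0 <= s <= 1 /\ boundary U (fun l => a l + s * (b l - a l)).
Proof.
move=> openU Ua nUb; apply: NNPP => nobd.
pose p s : Vec k := fun l => a l + s * (b l - a l).
have p0 : p 0 = a by apply: functional_extensionality => l; rewrite /p; ring.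
have p1 : p 1 = b by apply: functional_extensionality => l; rewrite /p; ring.
have cp : cont_curve p.
  move=> l t e e0; pose q := Rabs (b l - a l) + 1.
  have q0 : 0 < q by rewrite /q; have := Rabs_pos (b l - a l); lra.
  exists (e / q); split; first exact: Rdiv_lt_0_compat.
  move=> s st; rewrite /p (_ : _ - _ = (s - t) * (b l - a l)); last by ring.
  rewrite Rabs_mult; apply: (Rle_lt_trans _ (Rabs (s - t) * q)).
    by apply: Rmult_le_compat_l; [apply: Rabs_pos | rewrite /q; lra].
  have -> : e = e / q * q by field; lra.
  exact: Rmult_lt_compat_r.
have H : forall s, 0 <= s <= 1 -> U (p s).
  apply: real_induction => t Ht IH.
  have Upt : U (p t).
    apply: NNPP => nU; apply: nobd; exists t; split=> //; split=> // e e0.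
    have ek : 0 < e / (INR k + 1) by apply: Rdiv_lt_0_compat => //; have := pos_INR k; lra.
    have [d [d0 Hd]] := curve_close t cp ek.
    have tp : 0 < t by case: (Req_dec t 0) => t0; [rewrite t0 p0 in nU | lra].
    pose s := Rmax 0 (t - d / 2).
    have st : 0 <= s < t by rewrite /s /Rmax; case: Rle_dec => ?; lra.
    exists (p s); split; first exact: IH.
    apply: vnorm_close => //; apply: Hd.
    by rewrite /s /Rmax; case: Rle_dec => ?; split_Rabs; lra.
  have [e [e0 He]] := openU _ Upt.
  have ek : 0 < e / (INR k + 1) by apply: Rdiv_lt_0_compat => //; have := pos_INR k; lra.
  have [d [d0 Hd]] := curve_close t cp ek.
  by exists d; split=> // s _ st; apply: He; apply: vnorm_close => //; apply: Hd.
by apply: nUb; rewrite -p1; apply: H; lra.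
Qed.

(** * The degree *)

Lemma derivable_locally_affine (g : R -> R) A B d : 0 < d ->
  (forall s, Rabs s < d -> g s = A + s * B) -> derivable_pt_lim g 0 B.
Proof.
move=> d0 H e e0; exists (mkposreal d d0) => s s0 /= sd.
rewrite Rplus_0_l !H ?Rabs_R0 // (_ : _ - B = 0) ?Rabs_R0 //.
by field.
Qed.

Lemma in_map_enum (T : finType) (X : Type) (f : T -> X) (A : pred T) x :
  In x (List.map f (enum A)) <-> exists2 a, A a & x = f a.
Proof.
have H s : In x (List.map f s) <-> exists2 a, a \in s & x = f a.
  elim: s => [|b s IH] /=; first by split=> // -[].
  rewrite IH; split=> [[<-|[a sa ->]]|[a]].
  - by exists b; rewrite ?mem_head.
  - by exists a; rewrite // inE sa orbT.
  by rewrite inE => /orP[/eqP -> ->|sa ->]; [left | right; exists a].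
rewrite H; split=> -[a aA ->]; exists a => //; first by rewrite mem_enum in aA.
by rewrite mem_enum.
Qed.

Lemma NoDup_map_enum (T : finType) (X : Type) (f : T -> X) (A : pred T) :
  (forall a b, A a -> A b -> f a = f b -> a = b) -> NoDup (List.map f (enum A)).
Proof.
move=> inj; have : forall a, a \in enum A -> A a by move=> a; rewrite mem_enum.
elim: (enum A) (enum_uniq A) => [_ _|a s IH /= /andP[as_ us] H]; first exact: NoDup_nil.
apply: NoDup_cons; last by apply: IH => // b bs; apply: H; rewrite inE bs orbT.
have Hs : forall s', (forall b, b \in s' -> A b /\ b != a) -> ~ In (f a) (List.map f s').
  elim=> [|b s' IH'] H' //= -[E|].
    have [Ab] := H' b (mem_head _ _); rewrite (inj b a) ?eqxx //.
    by apply: H; rewrite mem_head.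
  by apply: IH' => b' b's; apply: H'; rewrite inE b's orbT.
apply: Hs => b bs; split; first by apply: H; rewrite inE bs orbT.
by apply: contraNneq as_ => <-.
Qed.

Lemma Zsum_map_enum (T : finType) (f : T -> Z) (A : pred T) :
  fold_right Z.add Z0 (List.map f (enum A)) = (\sum_(a | A a) f a)%R.
Proof.
rewrite -[RHS]big_enum /=; elim: (enum A) => [|a s IH] /=; first by rewrite big_nil.
by rewrite big_cons IH.
Qed.

Lemma abs_sum (I : finType) (f : I -> R) : Rabs (\sum_i f i)%R <= (\sum_i Rabs (f i))%R.
Proof.
elim: (index_enum I) => [|i s IH]; first by rewrite !big_nil Rabs_R0; right.
by rewrite !big_cons; apply: Rle_trans (Rabs_triang _ _) _; apply: Rplus_le_compat_l.
Qed.

Lemma sum_le (I : finType) (f g : I -> R) : (forall i, f i <= g i) ->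
  (\sum_i f i)%R <= (\sum_i g i)%R.
Proof.
move=> fg; elim: (index_enum I) => [|i s IH]; first by rewrite !big_nil; right.
by rewrite !big_cons; apply: Rplus_le_compat.
Qed.

Lemma sum_minus (I : finType) (f g : I -> R) :
  (\sum_i f i)%R - (\sum_i g i)%R = (\sum_i (f i - g i))%R.
Proof.
elim: (index_enum I) => [|i s IH]; first by rewrite !big_nil; apply: Rminus_diag.
rewrite !big_cons -IH.
change (f i + (\sum_(j <- s) f j)%R - (g i + (\sum_(j <- s) g j)%R) =
  f i - g i + ((\sum_(j <- s) f j)%R - (\sum_(j <- s) g j)%R)).
by ring.
Qed.

Section BaryMore.
Context (n N : nat).
Local Notation k := n.+1.
Local Notation V := {ffun 'I_k -> 'I_N.+2}.
Implicit Types (y : Vec k) (z v : V) (r : 'S_k).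

Lemma bary_inj y y' z r : (forall i : 'I_k.+1, bary y z r i = bary y' z r i) -> y = y'.
Proof.
move=> E; apply: functional_extensionality => l.
suff : frac y z l = frac y' z l by rewrite /frac; lra.
rewrite -!(lev_rank _ _ r).
have : forall m, (m <= k.+1)%N -> lev y z r m = lev y' z r m.
  move=> m mk.
  have E2 : (\sum_(i < m) bary y z r i)%R = (\sum_(i < m) bary y' z r i)%R.
    apply: eq_bigr => i _; have ik : (i < k.+1)%N by apply: leq_trans mk.
    exact: (E (Ordinal ik)).
  by rewrite !sum_bary_lt in E2; lra.
by apply; have := ltn_ord (r l); lia.
Qed.

Lemma bary_exists z r (b : 'I_k.+1 -> R) : (\sum_i b i)%R = 1 ->
  exists y, forall i : 'I_k.+1, bary y z r i = b i.
Proof.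
move=> b1.
pose B m := (\sum_(j < k.+1 | (j < m)%N) b j)%R.
exists (fun l => INR (z l) + (1 - B (r l).+1)) => i.
have levE m : (m <= k.+1)%N -> lev (fun l => INR (z l) + (1 - B (r l).+1)) z r m = 1 - B m.
  case: m => [_|m]; first by rewrite /= /B big_pred0 // Rminus_0_r.
  rewrite ltnS leq_eqVlt => /orP[/eqP ->|mk].
    rewrite lev_max /B (eq_bigl xpredT) ?b1 ?Rminus_diag // => j.
    by rewrite ltn_ord.
  by rewrite -[m]/(nat_of_ord (Ordinal mk)) lev_ord /frac permKV; ring.
have ik := ltn_ord i.
rewrite /bary !levE //; last by rewrite ltnW.
have -> : B i.+1 = b i + B i.
  rewrite /B (bigD1 i) //=; congr (_ + _)%R; apply: eq_bigl => j.
  by rewrite ltnS ltn_neqAle andbC -val_eqE.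
by ring.
Qed.

End BaryMore.

Lemma halfspace_near n (q : Vec n.+1) c tau (P : 'rV[R]_n.+1 -> Prop) :
  tau < c -> (exists l, c <= Rabs (q l)) ->
  (forall x, P x -> forall i, Rabs (x ord0 i - q i) <= tau) -> in_halfspace P.
Proof.
move=> tl [l cl] H; exists l.
case: (Rle_dec 0 (q l)) => ql; [left | right] => x /H/(_ l) xl; apply/RltP.
  by change (0 < @fun_of_matrix R 1 n.+1 x ord0 l); move: cl xl; clear -tl ql; split_Rabs; lra.
by change (@fun_of_matrix R 1 n.+1 x ord0 l < 0); move: cl xl; clear -tl ql; split_Rabs; lra.
Qed.

(** * From labels close to a map to its degree *)

Section DegreeOfLabels.
Context (n N : nat).
Local Notation k := n.+1.
Local Notation V := {ffun 'I_k -> 'I_N.+2}.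
Context (U : Vec k -> Prop) (F : Vec k -> Vec k) (M h c tau : R).
Context (L : V -> 'rV[R]_k) (w : pred V).

Definition cell_coord (x : Vec k) : Vec k := fun l => (x l + M) / h.
Definition from_cell (y : Vec k) : Vec k := fun l => h * y l - M.
Definition grid_point (v : V) : Vec k := from_cell (fun l => INR (v l)).
Definition near (p : Vec k) (v : V) := forall l, Rabs (diff (cell_coord p) v l) <= 1.

Hypothesis h0 : 0 < h.
Hypothesis openU : is_open U.
Hypothesis box : forall x, closure U x -> forall l, 1 <= cell_coord x l <= INR N - 1.
Hypothesis wP : forall z, w z <-> U (grid_point z).
Hypothesis label_near : forall p, closure U p -> forall v, near p v ->
  forall i, Rabs (L v ord0 i - F p i) <= tau.
Hypothesis bdP : forall p, boundary U p -> exists l, c <= Rabs (F p l).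
Hypothesis tau0 : 0 < tau.
Hypothesis tauc : INR k * (2 * tau) < c.
Hypothesis coef_nz : forall z r (i : 'I_k.+1), (coef (simplex L z r) i != 0)%R.

Lemma cell_coordK x : from_cell (cell_coord x) = x.
Proof.
by apply: functional_extensionality => l; rewrite /from_cell /cell_coord; field; lra.
Qed.

Lemma from_cellK y : cell_coord (from_cell y) = y.
Proof.
by apply: functional_extensionality => l; rewrite /from_cell /cell_coord; field; lra.
Qed.

Lemma U_closure x : U x -> closure U x.
Proof.
move=> Ux r r0; exists x; split=> //; apply: Rle_lt_trans r0.
rewrite -[X in _ <= X](Rmult_0_r (INR k)); apply: vnorm_le => i.
by rewrite /vsub Rminus_diag Rabs_R0; lra.
Qed.

Lemma tau_lt : tau < c.
Proof.
have : 1 <= INR k by rewrite S_INR; have := pos_INR n; lra.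
by nra.
Qed.

Lemma simplex_sign_near_boundary p z r : boundary U p -> (forall i : 'I_k.+1, near p (vert z r i)) ->
  simplex_sign (simplex L z r) = 0%R.
Proof.
move=> bp nearp.
have [|l Hl] := @halfspace_near n (F p) c tau (fun x => exists i : 'I_k.+1, x = L (vert z r i))
  tau_lt (bdP bp).
  by move=> x [i ->]; apply: label_near => //; case: bp.
apply: (@simplex_sign_halfspace _ _ _ l).
by case: Hl => Hl; [left | right] => i; rewrite mxE; apply: Hl; exists i.
Qed.

(** The segment from the base vertex to [x] stays in one cell, and a boundary point on it is within
    one mesh width of all vertices in every coordinate. This is why testing [U] at the base vertex
    is as good as testing it at a zero. *)
Lemma simplex_sign_crossing x z r : in_cells z -> (forall i : 'I_k.+1, 0 <= bary (cell_coord x) z r i) ->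
  ~ (U x <-> U (grid_point z)) -> simplex_sign (simplex L z r) = 0%R.
Proof.
move=> zc b0 nE.
have [s [s01 bp]] : exists s, 0 <= s <= 1 /\
    boundary U (fun l => grid_point z l + s * (x l - grid_point z l)).
  case: (classic (U x)) => Ux; case: (classic (U (grid_point z))) => Uz; try by exfalso; tauto.
    have [s [s01 bp]] := boundary_crossing openU Ux Uz.
    exists (1 - s); split; first by lra.
    by move: bp; congr boundary; apply: functional_extensionality => l; ring.
  by have [s [s01 bp]] := boundary_crossing openU Uz Ux; exists s.
apply: simplex_sign_near_boundary bp _ => i l.
rewrite diff_vert // /frac /cell_coord.
have E : x l = h * (INR (z l) + frac (cell_coord x) z l) - M.
  by rewrite /frac /cell_coord; field; lra.
rewrite /grid_point /from_cell E.
have -> : (h * INR (z l) - M + s * (h * (INR (z l) + frac (cell_coord x) z l) - M - (h * INR (z l) - M)) + M) / h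
   - INR (z l) = s * frac (cell_coord x) z l by field; lra.
have := frac_bounds l (Rle_refl 0) b0; set f := frac _ _ _ => f01.
by case: ifP => _; apply: Rabs_le; nra.
Qed.

Lemma in_cells_of_U z : U (grid_point z) -> in_cells z.
Proof.
move=> /U_closure/box H l; have := H l; rewrite /grid_point from_cellK => Hl.
by apply/ssrnat.ltP; apply: INR_lt; rewrite S_INR; lra.
Qed.

Definition PL (x : Vec k) : Vec k := fun i =>
  (\sum_v L v ord0 i * hat (diff (cell_coord x) v))%R.
Definition smoothPL e (x : Vec k) : Vec k := fun i =>
  (\sum_v L v ord0 i * shat e (diff (cell_coord x) v))%R.

Lemma PL_bary x z r : in_cells z -> (forall i : 'I_k.+1, 0 <= bary (cell_coord x) z r i) ->
  forall a, PL x a = (\sum_(i < k.+1) L (vert z r i) ord0 a * bary (cell_coord x) z r i)%R.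
Proof. by move=> zc b0 a; rewrite /PL (hat_sum (fun v => L v ord0 a) zc b0). Qed.

Lemma smoothPL_exact e x (z : V) (r : 'S_k) : 0 < e -> (forall i : 'I_k.+1, e <= bary (cell_coord x) z r i) ->
  smoothPL e x = PL x.
Proof.
move=> e0 He; apply: functional_extensionality => a; apply: eq_bigr => v _.
by rewrite (shat_diff v e0 He).
Qed.

Lemma smoothPL_approx : exists W, 0 < W /\ forall e x a, 0 < e ->
  Rabs (smoothPL e x a - PL x a) <= W * e.
Proof.
pose W := (\sum_(v : V) \sum_a Rabs (L v ord0 a))%R.
have W0 v : 0 <= (\sum_a Rabs (L v ord0 a))%R.
  by have := @sum_le _ (fun=> 0) (fun a => Rabs (L v ord0 a)) (fun a => Rabs_pos _); rewrite big1.
have W1 : 0 <= W.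
  by have := @sum_le _ (fun=> 0) (fun v : V => (\sum_a Rabs (L v ord0 a))%R) W0; rewrite big1.
have k0 := pos_INR k.
exists (W * (2 * INR k + 1) + 1); split; first by nra.
move=> e x a e0; rewrite /smoothPL /PL sum_minus; apply: Rle_trans (abs_sum _) _.
apply: (Rle_trans _ (\sum_(v : V) (\sum_a Rabs (L v ord0 a)) * ((2 * INR k + 1) * e))%R).
  apply: sum_le => v; rewrite -[X in Rabs X]Rmult_minus_distr_l Rabs_mult.
  apply: Rmult_le_compat; try exact: Rabs_pos; last exact: shat_approx.
  have := @sumk_term k (fun a => Rabs (L v ord0 a)) a (fun a => Rabs_pos _).
  by rewrite sumkE.
rewrite -GRing.mulr_suml -/W -RmultE.
by clearbody W; change (W * ((2 * INR k + 1) * e) <= (W * (2 * INR k + 1) + 1) * e); lra.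
Qed.

Lemma smoothPL_C1 e a : 0 < e -> C1fun (fun x => smoothPL e x a).
Proof.
move=> e0; apply: C1fun_sum => v; apply: C1fun_scal.
apply: (C1fun_shat (u := fun l x => diff (cell_coord x) v l)) => // l.
have := C1fun_plus (C1fun_scal (/ h) (C1fun_coord l)) (C1fun_const (k := k) (M / h - INR (v l))).
by congr C1fun; apply: functional_extensionality => x; rewrite /diff /cell_coord /=; field; lra.
Qed.

(** There are finitely many simplices, so [small_combination] gives a margin depending on the labels
    only. The smoothing parameter can be chosen afterwards, so small that zeros of the smoothed map
    fall where smoothing changes nothing. *)
Lemma nondegenerate_margin : exists e, 0 < e /\ forall (y : Vec k) (z : V) (r : 'S_k),
  (forall i : 'I_k.+1, 0 <= bary y z r i) ->
  (forall a, Rabs (\sum_(i < k.+1) L (vert z r i) ord0 a * bary y z r i)%R <= e) ->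
  (simplex_sign (simplex L z r) != 0)%R /\ forall i : 'I_k.+1, e <= bary y z r i.
Proof.
pose P (p : V * 'S_k) e := forall y : Vec k,
  (forall i : 'I_k.+1, 0 <= bary y p.1 p.2 i) ->
  (forall a, Rabs (\sum_(i < k.+1) L (vert p.1 p.2 i) ord0 a * bary y p.1 p.2 i)%R <= e) ->
  (simplex_sign (simplex L p.1 p.2) != 0)%R /\ forall i : 'I_k.+1, e <= bary y p.1 p.2 i.
have mono p d d' : 0 < d' <= d -> P p d -> P p d'.
  move=> dd H y b0 Ha; have [|D0 Hd] := H y b0.
    by move=> a; apply: Rle_trans (Ha a) _; lra.
  by split=> // i; apply: Rle_trans (Hd i); lra.
have [|e [e0 He]] := finite_radius mono; last first.
  by exists e; split=> // y z r; apply: (He (z, r)).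
move=> [z r] /=; have [e /RltP e0 He] := small_combination (fun i => coef_nz z r i).
exists e; split; first exact: e0.
move=> y b0 Ha; have [||a|D0 Hb] := He (\row_(i < k.+1) bary y z r i)%R.
- by move=> i; rewrite mxE; apply/RleP; apply: b0.
- by rewrite -[RHS](sum_bary y z r); apply: eq_bigr => i _; rewrite mxE.
- rewrite mxE -RabsE; apply/RleP; apply: Rle_trans (Ha a); right; congr Rabs.
  by apply: eq_bigr => i _; rewrite !mxE GRing.mulrC.
by split=> // i; have := Hb i; rewrite mxE => /RleP.
Qed.

(** The derivative along coordinate [l] is the step from vertex [r l] to the next one, divided by
    [h]. So the transposed Jacobian is [h^-1] times the matrix of consecutive differences with its
    rows permuted by [r]. *)
Lemma sign_det_jacobian (J : Mat k) z r : (simplex_sign (simplex L z r) != 0)%R ->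
  (forall a l, J a l = (L (vert z r (r l).+1) ord0 a - L (vert z r (r l)) ord0 a) / h) ->
  sgnZ (det J) = ((-1) ^+ r * simplex_sign (simplex L z r))%R.
Proof.
move=> D0 HJ.
pose S := simplex L z r.
pose Delta := (\matrix_(i < k) (row (lift ord0 i) S - row (widen_ord (leqnSn k) i) S))%R.
have E : det J = ((h^-1) ^+ k * ((-1) ^+ r * \det Delta))%R.
  rewrite detE -det_tr.
  have -> : ((\matrix_(i, j) J i j)^T = h^-1 *: row_perm r Delta)%R.
    apply/matrixP=> l a; rewrite !mxE HJ /Rdiv RinvE lift0 /= GRing.mulrC.
    by rewrite RmultE.
  by rewrite detZ row_permE det_mulmx det_perm.
have hk : (0 < (h^-1) ^+ k)%R.
  by apply: Num.Theory.exprn_gt0; rewrite Num.Theory.invr_gt0; apply/RltP.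
have sgn_pos t : (0 < t)%R -> sgnZ t = (1 : Z)%R.
  by move=> /RltP t0; rewrite /sgnZ; case: Rlt_dec.
have sgn_neg t : (t < 0)%R -> sgnZ t = (-1 : Z)%R.
  move=> /RltP t0; rewrite /sgnZ; case: Rlt_dec => t1; last by case: Rlt_dec.
  by case: (Rlt_irrefl t); apply: Rlt_trans t0 t1.
have /= := sign_det_differences D0; rewrite -/S -/Delta E.
case=> -[-> d0].
  case: (odd_perm r) => /=; rewrite ?expr1 ?expr0 GRing.mulr1 ?GRing.mulN1r ?GRing.mul1r.
    by apply: sgn_neg; rewrite GRing.mulrN Num.Theory.oppr_lt0 Num.Theory.mulr_gt0.
  by apply: sgn_pos; rewrite Num.Theory.mulr_gt0.
case: (odd_perm r) => /=; rewrite ?GRing.expr1 ?GRing.expr0 ?GRing.mulN1r ?GRing.mul1r.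
  by rewrite GRing.opprK; apply: sgn_pos; rewrite Num.Theory.mulr_gt0 // Num.Theory.oppr_gt0.
by apply: sgn_neg; rewrite Num.Theory.pmulr_rlt0.
Qed.

(** Moving [x] by [s] along coordinate [l] changes only the level [(r l).+1]: the amount [s / h]
    passes from barycentric coordinate [r l] to the next one. The margin [2 * e] leaves room for
    this: for [|s| < e * h] all coordinates remain at least [e], where the smoothed map is
    affine. *)
Lemma jacobian_at_zero e G J x z r : is_jacobian G J -> G = smoothPL e -> 0 < e ->
  in_cells z -> (forall i : 'I_k.+1, 2 * e <= bary (cell_coord x) z r i) ->
  forall a l, J x a l = (L (vert z r (r l).+1) ord0 a - L (vert z r (r l)) ord0 a) / h.
Proof.
move=> HJ GE e0 zc He a l.
have := HJ x a l; set g := fun s => _; move=> Hg.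
apply: (uniqueness_limite g 0) => //.
pose xs s := vadd x (vscal s (evec l)).
have fracE s m : frac (cell_coord (xs s)) z m =
    frac (cell_coord x) z m + (if m == l then s / h else 0).
  rewrite /frac /cell_coord /xs /vadd /vscal /evec eq_sym.
  by case: eqP => _; field; lra.
have levE s m : (m <= k.+1)%N -> lev (cell_coord (xs s)) z r m =
    lev (cell_coord x) z r m + (if m == (r l).+1 then s / h else 0).
  case: m => [_|m]; first by rewrite /=; ring.
  rewrite ltnS leq_eqVlt => /orP[/eqP ->|mk].
    by rewrite !lev_max eqSS gtn_eqF ?ltn_ord //; ring.
  rewrite -[m]/(nat_of_ord (Ordinal mk)) !lev_ord fracE eqSS; congr (_ + _).
  have -> // : ((r^-1)%g (Ordinal mk) == l) = (nat_of_ord (Ordinal mk) == r l).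
  by rewrite -(inj_eq (@perm_inj _ r)) permKV.
have baryE s (i : 'I_k.+1) : bary (cell_coord (xs s)) z r i =
    bary (cell_coord x) z r i + s / h * ((if i == (r l).+1 :> nat then 1 else 0) -
      (if i == r l :> nat then 1 else 0)).
  have E1 := levE s i (ltnW (ltn_ord i)); have E2 := levE s i.+1 (ltn_ord i).
  rewrite /bary E1 E2 eqSS.
  by case: ifP => _; case: ifP => _; ring.
apply: (@derivable_locally_affine _ (g 0) _ (e * h)); first by nra.
move=> s sh.
have sh' : Rabs (s / h) < e.
  rewrite /Rdiv Rabs_mult Rabs_inv (Rabs_pos_eq h); last by lra.
  by apply: (Rmult_lt_reg_r h) => //; rewrite Rmult_assoc Rinv_l; lra.
have He' (i : 'I_k.+1) : e <= bary (cell_coord (xs s)) z r i.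
  rewrite baryE; have := He i; set q := s / h in sh' *.
  by case: ifP => _; case: ifP => _; split_Rabs; lra.
have gE t : (forall i : 'I_k.+1, e <= bary (cell_coord (xs t)) z r i) ->
    g t = (\sum_(i < k.+1) L (vert z r i) ord0 a * bary (cell_coord (xs t)) z r i)%R.
  move=> Ht; rewrite /g GE -/(xs t) (smoothPL_exact e0 Ht) (PL_bary (r := r) zc) //.
  by move=> i; have := Ht i; lra.
have x0 : xs 0 = x.
  by apply: functional_extensionality => m; rewrite /xs /vadd /vscal; ring.
rewrite !gE //; last by move=> i; rewrite x0; have := He i; lra.
have move_term (p q t : R) : p - q = t -> p = q + t by lra.
apply: move_term.
rewrite sum_minus.
pose i0 : 'I_k.+1 := widen_ord (leqnSn k) (r l); pose i1 : 'I_k.+1 := lift ord0 (r l).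
have i10 : i1 != i0 by rewrite -val_eqE /= /bump /=; lia.
rewrite (bigD1 i1 isT) (bigD1 i0); last by rewrite eq_sym.
rewrite big1; last first.
  move=> i /andP[/andP[_ ii1] ii0]; rewrite !baryE.
  have -> : (i == (r l).+1 :> nat) = false.
    by apply/negbTE; move: ii1; rewrite -val_eqE.
  have -> : (i == r l :> nat) = false by apply/negbTE.
  set lc := L _ _ _; set t := bary _ _ _ _.
  by change (lc * (t + s / h * (0 - 0)) - lc * (t + 0 / h * (0 - 0)) = 0); field; lra.
rewrite !baryE.
have -> : nat_of_ord i1 = (r l).+1 by rewrite /i1 lift0.
have -> : nat_of_ord i0 = r l by [].
rewrite !eqxx.
have -> : ((r l).+1 == r l) = false by lia.
have -> : (nat_of_ord (r l) == (r l).+1) = false by lia.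
set l1 := L _ _ _; set l0 := L _ _ _; set t1 := bary _ _ _ _; set t0 := bary _ _ _ _.
change (l1 * (t1 + s / h * (1 - 0)) - l1 * (t1 + 0 / h * (1 - 0)) +
  (l0 * (t0 + s / h * (0 - 1)) - l0 * (t0 + 0 / h * (0 - 1)) + 0) = s * ((l1 - l0) / h)).
by field; lra.
Qed.

(** The zeros of [smoothPL e] in [U] correspond to the simplices with base vertex in [U] and nonzero
    [simplex_sign], one zero in each, whose barycentric coordinates are the normalised
    coefficients. *)
Theorem degree_of_labels : is_degree F U (sdeg w L).
Proof.
have [m [m0 Hm]] := nondegenerate_margin.
have [W [W0 HW]] := smoothPL_approx.
(* The first entry gives the margin [2 * e <= m] for the Jacobian. The second makes the smoothing
   error at most [m], so that [Hm] locates the zeros, and at most [tau], for the distance to [F]. *)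
pose e := Rmin (m / 2) (Rmin m tau / W).
have mt : 0 < Rmin m tau by apply: Rmin_glb_lt.
have e0 : 0 < e by apply: Rmin_glb_lt; [lra | apply: Rdiv_lt_0_compat].
have em : 2 * e <= m by have := Rmin_l (m / 2) (Rmin m tau / W); rewrite -/e; lra.
have eW : W * e <= Rmin m tau.
  apply: (Rle_trans _ (W * (Rmin m tau / W))); last by right; field; lra.
  by apply: Rmult_le_compat_l; [lra | apply: Rmin_r].
have approx x a : Rabs (smoothPL e x a - PL x a) <= Rmin m tau.
  by apply: Rle_trans eW; apply: HW.
have /fin_all_exists[Df HDf] a : exists Df : 'I_k -> Vec k -> R,
    partials (fun x => smoothPL e x a) Df /\ forall j, cont_vec (Df j).
  by have [] := smoothPL_C1 a e0.
pose J : Vec k -> Mat k := fun x a l => Df a l x.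
have HJ : is_jacobian (smoothPL e) J by move=> x a l; apply: (HDf a).1.
have loc x : closure U x -> exists z r, in_cells z /\
    forall i : 'I_k.+1, 0 <= bary (cell_coord x) (z : V) r i.
  move=> /box Hx; apply: locate => l; have := Hx l; rewrite S_INR; lra.
have zero_bary x z r : in_cells z -> (forall i : 'I_k.+1, 0 <= bary (cell_coord x) z r i) ->
    smoothPL e x = vzero -> (simplex_sign (simplex L z r) != 0)%R /\
      forall i : 'I_k.+1, m <= bary (cell_coord x) z r i.
  move=> zc b0 Gx; apply: Hm => // a; rewrite -PL_bary //.
  have := approx x a; rewrite Gx /vzero Rabs_minus_sym Rminus_0_r.
  by have := Rmin_l m tau; lra.
pose A := [pred p : V * 'S_k | w p.1 && (simplex_sign (simplex L p.1 p.2) != 0)%R].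
have /choice[pt Hpt] (p : V * 'S_k) : exists x, A p ->
    [/\ U x, smoothPL e x = vzero & forall i : 'I_k.+1, m <= bary (cell_coord x) p.1 p.2 i].
  case: p => z r; rewrite /A /=; case: (boolP (w z && _)) => [/andP[wz D0]|_]; last first.
    by exists vzero.
  have Uz := (wP z).1 wz; have zc := in_cells_of_U Uz.
  have [bf b1 bp] := barycentric_gt0 D0.
  set b := (\row_i _)%R in bf b1 bp.
  have [y Hy] := bary_exists z r b1.
  exists (from_cell y) => _; rewrite from_cellK.
  have b0 (i : 'I_k.+1) : 0 <= bary y z r i.
    by rewrite Hy; apply: Rlt_le; apply/RltP; apply: bp.
  have sum0 a : (\sum_(i < k.+1) L (vert z r i) ord0 a * bary y z r i)%R = 0.
    have := congr1 (fun C : 'rV[R]_k => C ord0 a) bf; rewrite !mxE => E.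
    rewrite -[RHS]E; apply: eq_bigr => i _.
    by rewrite Hy !mxE GRing.mulrC.
  have [_ bm] := Hm y z r b0 ltac:(by move=> a; rewrite sum0 Rabs_R0; lra).
  have Ux : U (from_cell y).
    apply: NNPP => nU; move/eqP: D0; apply; apply: (@simplex_sign_crossing (from_cell y)) => //.
      by rewrite from_cellK.
    by tauto.
  split=> //; rewrite (@smoothPL_exact e _ z r) ?from_cellK //; last first.
    by move=> i; have := bm i; lra.
  by apply: functional_extensionality => a; rewrite (@PL_bary _ z r) ?from_cellK // sum0.
have wz_of x z r : U x -> in_cells z -> (forall i : 'I_k.+1, 0 <= bary (cell_coord x) z r i) ->
    (simplex_sign (simplex L z r) != 0)%R -> w z.
  move=> Ux zc b0 D0; apply/wP; apply: NNPP => nU; move/eqP: D0; apply.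
  by apply: (@simplex_sign_crossing x) => //; tauto.
have pt_unique x z r (p := (z, r)) : U x -> in_cells z ->
    (forall i : 'I_k.+1, 0 <= bary (cell_coord x) z r i) -> smoothPL e x = vzero ->
    A p /\ x = pt p.
  move=> Ux zc b0 Gx; have [D0 bm] := zero_bary x z r zc b0 Gx.
  have Ap : A p by rewrite /A /= D0 andbT (wz_of x z r).
  split=> //; have [Upt Gpt bpt] := Hpt p Ap.
  rewrite -(cell_coordK x) -(cell_coordK (pt p)); congr from_cell.
  apply: (@bary_inj _ _ _ _ z r) => i.
  have bz y : smoothPL e y = vzero -> (forall i : 'I_k.+1, m <= bary (cell_coord y) z r i) ->
      bary (cell_coord y) z r i = (coef (simplex L z r) i / \sum_j coef (simplex L z r) j)%R.
    move=> Gy bY.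
    set b := (\row_(i < k.+1) bary (cell_coord y) z r i)%R.
    have bf : (b *m simplex L z r = 0)%R.
      apply/matrixP=> u a; rewrite !mxE.
      have := congr1 (fun f : Vec k => f a) Gy.
      rewrite (@smoothPL_exact e _ z r) //; last by move=> j; have := bY j; lra.
      rewrite (@PL_bary _ z r) //; last by move=> j; have := bY j; lra.
      move=> E; rewrite -[RHS]E; apply: eq_bigr => j _.
      by rewrite !mxE GRing.mulrC.
    have b1 : (\sum_j b ord0 j = 1)%R.
      by rewrite -[RHS](sum_bary (cell_coord y) z r); apply: eq_bigr => j _; rewrite mxE.
    by have := barycentric_zero D0 bf b1 i; rewrite mxE.
  by rewrite !bz.
exists (smoothPL e), J, c, (List.map pt (enum A)).
split; first exact: HJ.
split; first by move=> a l; apply: (HDf a).2.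
split.
  move=> x cx; have [z [r [zc b0]]] := loc x cx.
  (* One [tau] is for interpolation, an average of labels within [tau] of [F x], and one for
     smoothing; [INR k] passes from coordinates to the Euclidean norm. *)
  apply: (Rle_lt_trans _ (INR k * (2 * tau))) => //.
  apply: vnorm_le => a; rewrite /vsub.
  have := approx x a; have := Rmin_r m tau.
  suff : Rabs (PL x a - F x a) <= tau by split_Rabs; lra.
  rewrite (PL_bary zc b0).
  have -> : F x a = (\sum_(i < k.+1) F x a * bary (cell_coord x) z r i)%R.
    by rewrite -GRing.mulr_sumr sum_bary GRing.mulr1.
  rewrite sum_minus; apply: Rle_trans (abs_sum _) _.
  apply: (Rle_trans _ (\sum_(i < k.+1) tau * bary (cell_coord x) z r i)%R); last first.
    by rewrite -GRing.mulr_sumr sum_bary GRing.mulr1; right.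
  apply: sum_le => i.
  rewrite -[X in Rabs X]Rmult_minus_distr_r Rabs_mult (Rabs_pos_eq (bary _ _ _ _)) //.
  apply: Rmult_le_compat_r => //; apply: label_near => // l.
  rewrite diff_vert //; have := frac_bounds l (Rle_refl 0) b0.
  by case: ifP => _ fl; apply: Rabs_le; lra.
split.
  by move=> y /bdP[l cl]; apply: Rle_trans cl (vnorm_ge _ _).
have Jpt p : A p -> sgnZ (det (J (pt p))) = ((-1) ^+ p.2 * simplex_sign (simplex L p.1 p.2))%R.
  move=> Ap; have [Upt Gpt bpt] := Hpt p Ap.
  move: (Ap) => /andP[wz D0]; apply: sign_det_jacobian => //.
  apply: (jacobian_at_zero HJ) => //; first exact: in_cells_of_U ((wP _).1 wz).
  by move=> i; have := bpt i; lra.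
split.
  move=> x Ux Gx; have [z [r [zc b0]]] := loc x (U_closure Ux).
  have [Ap ->] := pt_unique x z r Ux zc b0 Gx.
  have sgn0 : sgnZ 0 = Z0.
    by rewrite /sgnZ; case: (Rlt_dec 0 0) => // H; have := Rlt_irrefl 0 H.
  move=> E; have := Jpt _ Ap; rewrite E sgn0.
  move/andP: Ap => [_ /negP D0] E'; apply: D0.
  by move/esym/eqP: E'; rewrite GRing.mulf_eq0 GRing.signr_eq0.
split.
  apply: NoDup_map_enum => -[z r] [z' r'] Ap Ap' E.
  have [_ _ b1] := Hpt _ Ap; have [_ _ b2] := Hpt _ Ap'; rewrite -E in b2.
  by have /= [-> ->] := bary_unique m0 b1 b2.
split.
  move=> x; rewrite in_map_enum; split=> [[p Ap ->]|[Ux Gx]].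
    by have [Upt Gpt _] := Hpt p Ap.
  have [z [r [zc b0]]] := loc x (U_closure Ux).
  by have [Ap E] := pt_unique x z r Ux zc b0 Gx; exists (z, r).
rewrite List.map_map Zsum_map_enum (eq_bigr _ (fun p => Jpt p)).
rewrite /sdeg pair_big_dep /=.
rewrite (bigID (fun p : V * 'S_k => (simplex_sign (simplex L p.1 p.2) != 0)%R)) /=.
rewrite [X in (_ + X)%R]big1 ?GRing.addr0; last first.
  by move=> p /andP[_ /negPn/eqP ->]; rewrite GRing.mulr0.
by apply: eq_bigl => p; rewrite andbT.
Qed.

End DegreeOfLabels.

(** * Invariance of the degree under affine homotopies *)

Lemma convex_comb_lt lam a b a' b' e : 0 <= lam <= 1 ->
  Rabs (a' - a) < e -> Rabs (b' - b) < e ->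
  Rabs (lam * a' + (1 - lam) * b' - (lam * a + (1 - lam) * b)) < e.
Proof.
move=> Hl Ha Hb.
have -> : lam * a' + (1 - lam) * b' - (lam * a + (1 - lam) * b) =
  lam * (a' - a) + (1 - lam) * (b' - b) by ring.
apply: Rle_lt_trans (Rabs_triang _ _) _; rewrite !Rabs_mult.
rewrite (Rabs_pos_eq lam) ?(Rabs_pos_eq (1 - lam)); try lra.
have Pa := Rabs_pos (a' - a); have Pb := Rabs_pos (b' - b).
by case: (Rle_dec lam (/ 2)) => ?; nra.
Qed.

Section PivotCells.
Context (n N : nat).
Local Notation k := n.+1.
Local Notation V := {ffun 'I_k -> 'I_N.+2}.

Lemma in_cells_pivot (z : V) (r : 'S_k) (i : 'I_k.+1) :
  (forall l, (0 < z l < N)%N) -> in_cells (pivot (z, r, i)).1.1.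
Proof.
move=> zi l; have /andP[z0 zN] := zi l; rewrite /pivot.
have zN1 : (z l < N.+1)%N by apply: ltnW.
case: (eqVneq i ord0) => _.
  rewrite ffunE; case: (r l == ord0); last first.
    by rewrite GRing.addr0.
  by rewrite /= modnDmr modn_small addn1.
case: (eqVneq i ord_max) => _ //.
rewrite ffunE; case: (r l == ord_max); last by rewrite GRing.subr0.
set u := (z l - 1)%R; have uE : z l = (u + 1)%R by rewrite /u GRing.subrK.
clearbody u.
rewrite ltnNge; apply/negP => uN; have uN' : nat_of_ord u = N.+1.
  by have := ltn_ord u; move: uN; lia.
have := congr1 (@nat_of_ord _) uE; rewrite /= modnDmr uN' addn1 modnn.
by lia.
Qed.

End PivotCells.

Section Homotopy.
Context (n : nat).
Local Notation k := n.+1.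
Context (U : Vec k -> Prop) (F0 F1 : Vec k -> Vec k).
Hypothesis openU : is_open U.
Hypothesis boundedU : is_bounded U.
Hypothesis cF0 : forall i, cont_vec (fun x => F0 x i).
Hypothesis cF1 : forall i, cont_vec (fun x => F1 x i).

Definition mix (lam : R) (x : Vec k) : Vec k := fun i => lam * F1 x i + (1 - lam) * F0 x i.
Hypothesis mix_nz : forall lam x, 0 <= lam <= 1 -> boundary U x -> mix lam x <> vzero.

Lemma closure_bound : exists B, 0 <= B /\ forall x, closure U x -> forall i, - B <= x i <= B.
Proof.
have [B HB] := boundedU; exists (Rabs B + 1); split; first by have := Rabs_pos B; lra.
move=> x cx i; have [y [Uy yx]] := cx 1 Rlt_0_1.
have := vnorm_ge y i; have := HB y Uy; have := vnorm_ge (vsub y x) i.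
by rewrite {1}/vsub; have := Rle_abs B; split_Rabs; lra.
Qed.

Lemma mix_near lam lam' x x' i e : 0 <= lam <= 1 -> 0 <= lam' <= 1 -> 0 < e ->
  Rabs (F0 x' i - F0 x i) < e -> Rabs (F1 x' i - F1 x i) < e ->
  Rabs (mix lam' x' i - mix lam x i) < e + Rabs (lam' - lam) * Rabs (F1 x i - F0 x i).
Proof.
move=> Hl Hl' e0 H0 H1.
rewrite (_ : _ - _ = (lam' * (F1 x' i - F1 x i) + (1 - lam') * (F0 x' i - F0 x i)) +
  (lam' - lam) * (F1 x i - F0 x i)); last by rewrite /mix; ring.
apply: Rle_lt_trans (Rabs_triang _ _) _; rewrite -Rabs_mult; apply: Rplus_lt_compat_r.
have := @convex_comb_lt lam' _ _ _ _ e Hl' H1 H0; congr (Rabs _ < _); ring.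
Qed.

Lemma mix_cont e x0 : 0 < e -> exists d, 0 < d /\ forall lam lam' x, 0 <= lam <= 1 -> 0 <= lam' <= 1 ->
  Rabs (lam' - lam) < d -> close d x0 x -> forall i, Rabs (mix lam' x i - mix lam x0 i) < e.
Proof.
move=> e0.
have [d [d0 Hd]] : exists d, 0 < d /\ forall i : 'I_k, (forall x, close d x0 x ->
    Rabs (F0 x i - F0 x0 i) < e / 2 /\ Rabs (F1 x i - F1 x0 i) < e / 2) /\
    d * (Rabs (F1 x0 i - F0 x0 i)) <= e / 2.
  apply: (@finite_radius _ (fun i d => (forall x, close d x0 x ->
    Rabs (F0 x i - F0 x0 i) < e / 2 /\ Rabs (F1 x i - F1 x0 i) < e / 2) /\
    d * (Rabs (F1 x0 i - F0 x0 i)) <= e / 2)).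
    move=> i c c' cc [H1 H2]; split; first by move=> x xc; apply: H1; apply: close_weak xc; lra.
    by have := Rabs_pos (F1 x0 i - F0 x0 i); nra.
  move=> i.
  have [d [d0 Hd]] := (cont_vecP _).1 (cF0 i) x0 (e / 2) ltac:(lra).
  have [d' [d'0 Hd']] := (cont_vecP _).1 (cF1 i) x0 (e / 2) ltac:(lra).
  set q := Rabs (F1 x0 i - F0 x0 i); have q0 : 0 <= q := Rabs_pos _.
  have dq : 0 < e / 2 / (q + 1) by apply: Rdiv_lt_0_compat; lra.
  exists (Rmin (Rmin d d') (e / 2 / (q + 1))).
  have m1 := Rmin_l (Rmin d d') (e / 2 / (q + 1)).
  have m2 := Rmin_r (Rmin d d') (e / 2 / (q + 1)).
  have m3 := Rmin_l d d'; have m4 := Rmin_r d d'.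
  split; first by do !apply: Rmin_glb_lt.
  split.
    by move=> x xc; split; [apply: Hd | apply: Hd']; apply: close_weak xc; lra.
  have E : e / 2 / (q + 1) * (q + 1) = e / 2 by field; lra.
  by nra.
exists d; split=> // lam lam' x Hl Hl' ll xx i; have [H1 H2] := Hd i; have [A1 A2] := H1 x xx.
have := @mix_near lam lam' x0 x i (e / 2) Hl Hl' ltac:(lra) A1 A2.
by have := Rabs_pos (F1 x0 i - F0 x0 i); nra.
Qed.

(** Compactness of the unit interval in [lam] at each boundary point, then of a box in [x]. Other
    points are harmless: the boundary is closed, so they have neighbourhoods free of it. *)
Lemma boundary_margin : exists c, 0 < c /\ forall x, boundary U x -> forall lam, 0 <= lam <= 1 ->
  exists l, c <= Rabs (mix lam x l).
Proof.
have [B [B0 HB]] := closure_bound.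
have [||c [c0 Hc]] := @box_compact k B (fun x c => boundary U x -> forall lam, 0 <= lam <= 1 ->
  exists l, c <= Rabs (mix lam x l)).
- move=> x c c' cc H bx lam Hl; have [l cl] := H bx lam Hl; exists l; lra.
- move=> x0 _; case: (classic (boundary U x0)) => bx0; last first.
    case: (classic (U x0)) => Ux0.
      have [r [r0 Hr]] := openU Ux0.
      have k0 := pos_INR k.
      exists (r / (INR k + 1)); split; first by apply: Rdiv_lt_0_compat; lra.
      by move=> y _ xy [_ nUy]; case: nUy; apply: Hr; apply: vnorm_close.
    have [r [r0 Hr]] : exists r, 0 < r /\ forall y, U y -> ~ vnorm (vsub y x0) < r.
      apply: NNPP => H; apply: bx0; split=> // r r0; apply: NNPP => H'; apply: H.
      by exists r; split=> // y Uy yr; apply: H'; exists y.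
    have k0 := pos_INR k.
    exists (r / (INR k + 1) / 2); have rk : 0 < r / (INR k + 1) by apply: Rdiv_lt_0_compat; lra.
    split; first by lra.
    move=> y _ xy [cy _]; have [u [Uu uy]] := cy (r / (INR k + 1) / 2) ltac:(lra).
    case: (Hr u Uu); apply: vnorm_close => // i.
    by have := xy i; have := close_vnorm uy i; split_Rabs; lra.
  have [||c [c0 Hc]] := @segment_compact 0 1 (fun lam c => forall x, close c x0 x ->
      exists l, c <= Rabs (mix lam x l)).
  + move=> lam c c' cc H x xc; have [|l cl] := H x; first by apply: close_weak xc; lra.
    by exists l; lra.
  + move=> lam Hl.
    have [l nz] : exists l, mix lam x0 l <> 0.
      apply: NNPP => H; apply: (mix_nz Hl bx0); apply: functional_extensionality => l.
      by apply: NNPP => nz; apply: H; exists l.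
    have a0 : 0 < Rabs (mix lam x0 l) by apply: Rabs_pos_lt.
    have [d [d0 Hd]] := @mix_cont (Rabs (mix lam x0 l) / 2) x0 ltac:(lra).
    exists (Rmin d (Rabs (mix lam x0 l) / 2)); split; first by apply: Rmin_glb_lt; lra.
    have m1 := Rmin_l d (Rabs (mix lam x0 l) / 2).
    have m2 := Rmin_r d (Rabs (mix lam x0 l) / 2).
    move=> lam' Hl' ll x xx; exists l.
    have := Hd lam lam' x Hl Hl' ltac:(lra) (close_weak m1 xx) l.
    by move: m2; split_Rabs; lra.
  exists c; split=> // y _ xy _ lam Hl; exact: Hc.
exists c; split=> // x bx lam Hl; apply: Hc => // i.
by apply: HB; case: bx.
Qed.

(** The point [y] is not confined to the closure of [U]: cells meeting it may have vertices outside,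
    whose labels must be controlled as well. *)
Lemma mix_unif e : 0 < e -> exists d, 0 < d /\ forall x, closure U x -> forall y, close d x y ->
  forall lam, 0 <= lam <= 1 -> forall i, Rabs (mix lam y i - mix lam x i) < e.
Proof.
move=> e0; have [B [B0 HB]] := closure_bound.
have [||c [c0 Hc]] := @box_compact k B (fun x c => forall y, close c x y ->
  forall lam, 0 <= lam <= 1 -> forall i, Rabs (mix lam y i - mix lam x i) < e).
- by move=> x c c' cc H y xy; apply: H; apply: close_weak xy; lra.
- move=> x0 _; have [d [d0 Hd]] := @mix_cont (e / 2) x0 ltac:(lra).
  exists (d / 2); split; first by lra.
  move=> x _ xx y xy lam Hl i.
  have ll : Rabs (lam - lam) < d by rewrite Rminus_diag Rabs_R0.
  have xx' : close d x0 x by apply: close_weak xx; lra.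
  have := Hd lam lam x Hl Hl ll xx' i.
  have xy' : close d x0 y by move=> j; have := xx j; have := xy j; split_Rabs; lra.
  by have := Hd lam lam y Hl Hl ll xy' i; split_Rabs; lra.
by exists c; split=> // x cx; apply: Hc => i; apply: HB.
Qed.

Lemma mix_gap : exists B, 0 < B /\ forall x, closure U x -> forall i, Rabs (F1 x i - F0 x i) <= B.
Proof.
have [B [B0 HB]] := closure_bound.
have [||c [c0 Hc]] := @box_compact k B (fun x c => forall i, Rabs (F1 x i - F0 x i) <= / c).
- move=> x c c' cc H i; apply: Rle_trans (H i) _; apply: Rinv_le_contravar; lra.
- move=> x0 _; have [d [d0 Hd]] := @mix_cont 1 x0 ltac:(lra).
  have [b [b0 Hb]] : exists b, 0 < b /\ forall i : 'I_k, Rabs (F1 x0 i - F0 x0 i) + 2 <= / b.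
    apply: (@finite_radius _ (fun i b => Rabs (F1 x0 i - F0 x0 i) + 2 <= / b)).
      by move=> i b b' bb H; apply: Rle_trans H _; apply: Rinv_le_contravar; lra.
    move=> i; have := Rabs_pos (F1 x0 i - F0 x0 i) => p.
    exists (/ (Rabs (F1 x0 i - F0 x0 i) + 2)); split; first by apply: Rinv_0_lt_compat; lra.
    by rewrite Rinv_inv; right.
  exists (Rmin d b); split; first exact: Rmin_glb_lt.
  move=> x _ xx i; have xd := close_weak (Rmin_l d b) xx.
  have ll t : Rabs (t - t) < d by rewrite Rminus_diag Rabs_R0.
  have A1 := Hd 1 1 x ltac:(lra) ltac:(lra) (ll 1) xd i.
  have A0 := Hd 0 0 x ltac:(lra) ltac:(lra) (ll 0) xd i.
  rewrite /mix !Rmult_1_l Rminus_diag !Rmult_0_l !Rplus_0_r in A1.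
  rewrite /mix Rminus_0_r !Rmult_1_l !Rmult_0_l !Rplus_0_l in A0.
  apply: (Rle_trans _ (/ b)).
    by apply: Rle_trans (Hb i); split_Rabs; lra.
  by apply: Rinv_le_contravar; [apply: Rmin_glb_lt | apply: Rmin_r].
exists (/ c); split; first exact: Rinv_0_lt_compat.
by move=> x cx; apply: Hc => i; apply: HB.
Qed.

Theorem degree_homotopy : exists d, is_degree F1 U d /\ is_degree F0 U d.
Proof.
have [c [c0 Hc]] := boundary_margin.
have k1 : 1 <= INR k by rewrite S_INR; have := pos_INR n; lra.
pose tau := c / (4 * INR k).
have tau0 : 0 < tau by apply: Rdiv_lt_0_compat; lra.
have tauc : INR k * (2 * tau) < c.
  by rewrite (_ : INR k * (2 * tau) = c / 2); [lra | rewrite /tau; field; lra].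
(* The tolerance [tau] is shared out: a quarter for the oscillation over one mesh width, a quarter
   for the perturbation into general position, a quarter for one step in [lam]. *)
have [d [d0 Hd]] := @mix_unif (tau / 4) ltac:(lra).
have [B [B0 HB]] := mix_gap.
have [m0 Hm0] := INR_unbounded (B / (tau / 4)).
pose m := m0.+1.
have mp : 0 < INR m by apply: lt_0_INR; apply/ssrnat.ltP.
have Hm : B / INR m < tau / 4.
  have : B / (tau / 4) < INR m by rewrite S_INR; lra.
  move=> H; apply: (Rmult_lt_reg_r (INR m)) => //.
  rewrite /Rdiv Rmult_assoc Rinv_l; last by lra.
  have E : B = B / (tau / 4) * (tau / 4) by field; lra.
  by rewrite Rmult_1_r [X in X < _]E; nra.
have [Bx [Bx0 HBx]] := closure_bound.
(* A vertex of a cell is within [h] in every coordinate, while [close d] is strict. [M] and [N]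
   leave a margin of at least one cell around [U]. *)
pose h := d / 2; have h0 : 0 < h by rewrite /h; lra.
pose M := Bx + 2 * h.
have [N HN] := INR_unbounded ((Bx + M) / h + 1).
have box x : closure U x -> forall l, 1 <= cell_coord M h x l <= INR N - 1.
  move=> cx l; have := HBx x cx l; rewrite /cell_coord => xl.
  split.
    apply: (Rmult_le_reg_r h) => //; rewrite /Rdiv Rmult_assoc Rinv_l; last by lra.
    by rewrite /M; lra.
  have : (x l + M) / h <= (Bx + M) / h; last by lra.
  by apply: Rmult_le_compat_r; [apply: Rlt_le; apply: Rinv_0_lt_compat | lra].
pose V := {ffun 'I_k -> 'I_N.+2}.
pose lam (j : nat) := INR j / INR m.
have lam01 (j : 'I_m.+1) : 0 <= lam j <= 1.
  have jm : INR j <= INR m by apply: le_INR; apply/ssrnat.leP; rewrite -ltnS.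
  have j0 := pos_INR j; split; first by apply: Rmult_le_pos => //; apply: Rlt_le; apply: Rinv_0_lt_compat.
  by apply: (Rmult_le_reg_r (INR m)) => //; rewrite /lam /Rdiv Rmult_assoc Rinv_l; lra.
(* One index per step in [lam], vertex and kind of label: [true] for the labels proper, [false] for
   the apexes of cones. A single perturbation puts all of them in general position together. *)
pose I := ('I_m.+1 * V * bool)%type.
pose q := tau / 4; have q0 : 0 < q by rewrite /q; lra.
have [L [Lnear Lgp]] := @perturb R I k
  (fun p : I => (\row_i mix (lam p.1.1) (grid_point M h p.1.2) i)%R) q
  ltac:(apply/RltP; exact: q0).
have {}Lnear (p : I) i : Rabs (L p ord0 i - mix (lam p.1.1) (grid_point M h p.1.2) i) < tau / 4.
  by have /RltP := Lnear p i; rewrite mxE.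
pose w (z : V) : bool := if excluded_middle_informative (U (grid_point M h z)) then true else false.
have wP z : w z <-> U (grid_point M h z).
  by rewrite /w; case: excluded_middle_informative.
have label_near p : closure U p -> forall (j : 'I_m.+1) (v : V) b, near M h p v ->
    forall i, Rabs (L (j, v, b) ord0 i - mix (lam j) p i) <= tau / 2.
  move=> cp j v b nv i.
  have cl : close d p (grid_point M h v).
    move=> l; have := nv l; rewrite /diff /cell_coord /grid_point /from_cell => nl.
    rewrite (_ : _ - p l = - h * ((p l + M) / h - INR (v l))); last by field; lra.
    rewrite Rabs_mult Rabs_Ropp (Rabs_pos_eq h); last by lra.
    by rewrite /h in h0 nl *; nra.
  have := Hd p cp _ cl (lam j) (lam01 j) i; have := Lnear (j, v, b) i; rewrite /=.
  by split_Rabs; lra.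
pose lab (j : 'I_m.+1) (v : V) : I := (j, v, true).
have lab_inj j : injective (lab j) by move=> u v [].
have deg (j : 'I_m.+1) : is_degree (mix (lam j)) U (sdeg w (L \o lab j)).
  apply: (@degree_of_labels n N U (mix (lam j)) M h c tau) => //.
  - move=> p cp v nv i; apply: Rle_trans (label_near p cp j v true nv i) _; lra.
  - by move=> p bp; apply: Hc.
  by move=> z r i; apply: coef_neq0.
have step (j : 'I_m) : sdeg w (L \o lab (widen_ord (leqnSn m) j)) = sdeg w (L \o lab (lift ord0 j)).
  pose j0 := widen_ord (leqnSn m) j; pose j1 := lift ord0 j.
  apply: (@sdeg_homotopy _ _ _ w I L _ _ (fun v => (j0, v, false))) => //.
    move=> u v; split; rewrite /lab !xpair_eqE ?andbF //.
    by rewrite -val_eqE /= /bump /= add1n ltn_eqF.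
  have half (p : Vec k) (z : V) (r : 'S_k) (i : 'I_k.+1) : boundary U p ->
      (forall u, u \in codom (facet z r i) -> near M h p u) ->
      in_halfspace (fun x => exists2 u, u \in codom (facet z r i) &
        [\/ x = L (lab j0 u), x = L (lab j1 u) | x = L (j0, u, false)]).
    move=> bp nearp; have cp := bp.1.
    have lamE : lam j1 - lam j0 = / INR m.
      by rewrite /lam /j1 lift0 S_INR [nat_of_ord j0]/=; field; lra.
    have mixE a : Rabs (mix (lam j1) p a - mix (lam j0) p a) < tau / 4.
      have -> : mix (lam j1) p a - mix (lam j0) p a = / INR m * (F1 p a - F0 p a).
        by rewrite -lamE /mix; ring.
      rewrite Rabs_mult (Rabs_pos_eq (/ _)); last by apply: Rlt_le; apply: Rinv_0_lt_compat.
      apply: Rle_lt_trans Hm; rewrite /Rdiv Rmult_comm.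
      apply: Rmult_le_compat_r; last exact: HB.
      by apply: Rlt_le; apply: Rinv_0_lt_compat.
    have tc : tau < c by nra.
    apply: (halfspace_near tc (Hc p bp (lam j0) (lam01 j0))) => x.
    case=> v vf; have nv := nearp v vf.
    have bnd j' b := label_near p cp j' v b nv.
    have shift (t a b e1 e2 e : R) : Rabs (t - b) <= e1 -> Rabs (b - a) < e2 ->
        e1 + e2 <= e -> Rabs (t - a) <= e by split_Rabs; lra.
    case=> -> a.
    - by apply: Rle_trans (bnd j0 true a) _; lra.
    - by apply: shift (bnd j1 true a) (mixE a) _; lra.
    - by apply: Rle_trans (bnd j0 false a) _; lra.
  have grid_interior (z : V) : U (grid_point M h z) -> forall l, (0 < z l < N)%N.
    move=> /U_closure/box zb l; have := zb l; rewrite /grid_point from_cellK // => zl.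
    apply/andP; split; apply/ssrnat.ltP; apply: INR_lt; rewrite /=; lra.
  (* The segment between the two base vertices meets the boundary. The facet belongs to both cells,
     so its vertices are within one mesh width of either base vertex in every coordinate, hence also
     of that boundary point. *)
  have key (z : V) (r : 'S_k) (i : 'I_k.+1) : U (grid_point M h z) -> ~ U (grid_point M h (pivot (z, r, i)).1.1) ->
      in_halfspace (fun x => exists2 u, u \in codom (facet z r i) &
        [\/ x = L (lab j0 u), x = L (lab j1 u) | x = L (j0, u, false)]).
    move=> Uz nUz'; have zi := grid_interior z Uz.
    have zc : in_cells z by move=> l; have /andP[_ /ltnW] := zi l.
    have zc' := in_cells_pivot r i zi.
    have [s [s01 bp]] := boundary_crossing openU Uz nUz'.
    apply: half bp _ => u /codomP[j' uE] l.
    have u1 : u = vert z r (lift i j') by rewrite uE ffunE.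
    have u2 : u = vert (pivot (z, r, i)).1.1 (pivot (z, r, i)).1.2 (lift (pivot (z, r, i)).2 j').
      by rewrite uE -facet_pivot ffunE.
    have e1 : INR (z l) <= INR (u l) <= INR (z l) + 1.
      by rewrite u1 INR_vert //; case: ifP => _; lra.
    have e2 : INR ((pivot (z, r, i)).1.1 l) <= INR (u l) <= INR ((pivot (z, r, i)).1.1 l) + 1.
      by rewrite u2 INR_vert //; case: ifP => _; lra.
    move: e1 e2; rewrite /diff /cell_coord /grid_point /from_cell.
    set a := INR (z l); set b := INR ((pivot (z, r, i)).1.1 l); set v := INR (u l) => e1 e2.
    have -> : (h * a - M + s * (h * b - M - (h * a - M)) + M) / h - v =
      (1 - s) * (a - v) + s * (b - v) by field; lra.
    by apply: Rabs_le; nra.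
  move=> z r i wz.
  case: (boolP (w z)) => wz1.
    apply: key; first exact/wP.
    by move=> /wP wz2; rewrite wz1 wz2 in wz.
  have wz2 : w (pivot (z, r, i)).1.1 by move: wz; rewrite (negPf wz1); case: (w _).
  rewrite -(facet_pivot z r i).
  have := pivotK (z, r, i).
  case: (pivot (z, r, i)) wz2 => [[z' r'] i'] wz2 E.
  apply: key; first exact/wP.
  by rewrite E => /wP; apply/negP.
have all_steps j (jm : (j < m.+1)%N) :
    sdeg w (L \o lab ord0) = sdeg w (L \o lab (Ordinal jm)).
  elim: j jm => [|j IH] jm; first by congr (sdeg w (L \o lab _)); apply: val_inj.
  rewrite (IH (ltnW jm)).
  have := step (Ordinal (jm : (j < m)%N)).
  have -> : widen_ord (leqnSn m) (Ordinal (jm : (j < m)%N)) = Ordinal (ltnW jm) by apply: val_inj.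
  by have -> : lift ord0 (Ordinal (jm : (j < m)%N)) = Ordinal jm by apply: val_inj.
exists (sdeg w (L \o lab ord0)); split.
  have lam1 : lam (ord_max : 'I_m.+1) = 1 by apply: Rinv_r; change (INR m <> 0); lra.
  have -> : F1 = mix (lam (ord_max : 'I_m.+1)).
    apply: functional_extensionality => x; apply: functional_extensionality => i.
    by rewrite /mix lam1; ring.
  rewrite (all_steps m (ltnSn m)) (_ : Ordinal _ = ord_max); last exact: val_inj.
  exact: deg.
have lam0 : lam (ord0 : 'I_m.+1) = 0 by apply: Rmult_0_l.
have -> : F0 = mix (lam (ord0 : 'I_m.+1)).
  apply: functional_extensionality => x; apply: functional_extensionality => i.
  by rewrite /mix lam0; ring.
exact: deg.
Qed.

End Homotopy.

(** The triangulation lives in dimension [n.+1]. In dimension 0 the boundary is empty, every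
    determinant is 1, and [F] is its own approximation. *)
Lemma degree_dim0 (U : Vec 0 -> Prop) (F : Vec 0 -> Vec 0) : exists d, is_degree F U d.
Proof.
have uniq0 (x y : Vec 0) : x = y by apply: functional_extensionality => -[].
have nobd y : ~ boundary U y.
  by move=> [cy nUy]; have [u [Uu _]] := cy 1 Rlt_0_1; apply: nUy; rewrite (uniq0 y u).
have det1 (A : Mat 0) : det A = 1 by [].
pose J : Vec 0 -> Mat 0 := fun _ _ _ => 0.
have [zs [ndzs zsP]] : exists zs : list (Vec 0), NoDup zs /\ forall x, In x zs <-> (U x /\ F x = vzero).
  case: (classic (U vzero)) => U0.
    exists [:: vzero]; split; first by apply: NoDup_cons => //; apply: NoDup_nil.
    by move=> x; rewrite (uniq0 x vzero); split=> // _; left.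
  exists [::]; split; first exact: NoDup_nil.
  by move=> x; rewrite (uniq0 x vzero); split=> [|[]].
exists (fold_right Z.add Z0 (List.map (fun x => sgnZ (det (J x))) zs)), F, J, 1, zs.
split; first by move=> x [].
split; first by move=> [].
split.
  move=> x _; apply: Rle_lt_trans Rlt_0_1.
  by rewrite -(Rmult_0_l 0); apply: vnorm_le => -[].
split; first by move=> y /nobd.
by split; [move=> x _ _; rewrite det1; lra | split].
Qed.

(** * Application to the linearised equation *)

Lemma linear_ode_zero k (A : R -> Mat k) (w : R -> Vec k) L T : 0 <= T -> 0 <= L ->
  (forall t i j, 0 <= t <= T -> Rabs (A t i j) <= L) ->
  solves_ode (fun t y => mulmv (A t) y) w -> w 0 = vzero -> w T = vzero.
Proof.
move=> T0 L0 HA Hw w0.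
have := @energy_growth k w (fun t => mulmv (A t) (w t)) L 0 T T0 L0 Hw.
have -> : energy (w 0) = 0.
  by rewrite w0 /energy /vzero (@sumk_ext _ _ (fun=> 0)) ?sumk_const ?Rmult_0_r // => i; ring.
rewrite !Rmult_0_l !Rplus_0_r Rmult_0_l => G.
have E : energy (w T) <= 0.
  apply: G => t i Ht; rewrite Rplus_0_r -sumk_scal.
  apply: Rle_trans (sumk_abs _) _; apply: sumk_le => j; rewrite Rabs_mult.
  by apply: Rmult_le_compat_r; [apply: Rabs_pos | apply: HA; lra].
apply: functional_extensionality => i; apply: NNPP => wi.
have := @energy_close k (w T) (Rabs (w T i)) (Rabs_pos_lt _ wi).
have ai := Rabs_pos_lt _ wi.
by move=> H; have := H ltac:(nra) i; lra.
Qed.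

Theorem theorem2 (k : nat) (T : R) (psi : R -> Vec k -> Vec k)
  (Jpsi : R -> Vec k -> Mat k) (Omega : R -> R -> Vec k -> Vec k)
  (U : Vec k -> Prop) (phi1 phi2 : R -> Vec k -> Vec k)
  (eta : R -> R -> R -> Vec k -> Vec k) :
  0 < T ->
  C1_tx psi -> periodic_t T psi ->
  is_jacobian_x psi Jpsi ->
  (* Omega t t0 xi = solution of x' = psi(t,x), x(t0) = xi, for all times *)
  (forall t0 xi, Omega t0 t0 xi = xi /\
                 solves_ode psi (fun t => Omega t t0 xi)) ->
  is_open U -> is_bounded U ->
  (* (A0) *)
  (forall xi, boundary U xi -> Omega T 0 xi = xi) ->
  C1_tx phi1 -> periodic_t T phi1 ->
  C1_tx phi2 -> periodic_t T phi2 ->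
  (* eta lam t s xi = solution of
       y' = phi_lam(t, Omega(t,0,xi)) + psi'_x(t, Omega(t,0,xi)) y, y(s) = 0,
     with phi_lam = lam phi1 + (1 - lam) phi2 *)
  (forall lam s xi, 0 <= lam <= 1 ->
     eta lam s s xi = vzero /\
     solves_ode
       (fun t y => vadd (vadd (vscal lam (phi1 t (Omega t 0 xi)))
                              (vscal (1 - lam) (phi2 t (Omega t 0 xi))))
                        (mulmv (Jpsi t (Omega t 0 xi)) y))
       (fun t => eta lam t s xi)) ->
  (forall lam s xi, 0 <= lam <= 1 -> 0 <= s <= T -> boundary U xi ->
     vsub (eta lam T s xi) (eta lam 0 s xi) <> vzero) ->
  exists d : Z, is_degree (fun xi => eta 1 T 0 xi) U d /\
                is_degree (fun xi => eta 0 T 0 xi) U d.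
Proof.
move=> T0 C1psi _ HJ HOm openU boundedU _ C1phi1 _ C1phi2 _ Heta Hnz.
case: k psi Jpsi Omega U phi1 phi2 eta C1psi HJ HOm openU boundedU C1phi1 C1phi2 Heta Hnz
  => [|n] psi Jpsi Omega U phi1 phi2 eta C1psi HJ HOm openU boundedU C1phi1 C1phi2 Heta Hnz.
  have -> : (fun xi => eta 1 T 0 xi) = (fun xi => eta 0 T 0 xi).
    by apply: functional_extensionality => x; apply: functional_extensionality => -[].
  by have [d Hd] := degree_dim0 U (fun xi => eta 0 T 0 xi); exists d.
have T0' : 0 <= T by lra.
(* [Jpsi] is only known to be a Jacobian; by uniqueness of derivatives it agrees with the continuous
   one provided by [C1_tx]. *)
have cJ i j : cont_tvec (fun t x => Jpsi t x i j).
  have [Dt [Dx [_ [HDx [_ cDx]]]]] := C1psi.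
  have -> : (fun t x => Jpsi t x i j) = (fun t x => Dx t x i j); last exact: cDx.
  apply: functional_extensionality => t; apply: functional_extensionality => x.
  exact: uniqueness_limite (HJ t x i j) (HDx t x i j).
pose Om x t := Omega t 0 x.
have HOm' x : Om x 0 = x /\ solves_ode psi (Om x) := HOm 0 x.
have ceta lam : 0 <= lam <= 1 -> forall i, cont_vec (fun x => eta lam T 0 x i).
  move=> Hl.
  apply: (@linear_solution_cont _ psi Jpsi Om
    (fun t x => vadd (vscal lam (phi1 t x)) (vscal (1 - lam) (phi2 t x)))
    (fun x t => eta lam t 0 x) T T0' HJ cJ HOm').
    move=> i; apply/cont_tvecP => t x e e0.
    have [d [d0 Hd]] := (cont_tvecP _).1 (C1_tx_cont C1phi1 i) t x e e0.
    have [d' [d'0 Hd']] := (cont_tvecP _).1 (C1_tx_cont C1phi2 i) t x e e0.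
    exists (Rmin d d'); split; first exact: Rmin_glb_lt.
    have m1 := Rmin_l d d'; have m2 := Rmin_r d d'.
    move=> s y st xy.
    have A1 := Hd s y ltac:(lra) (close_weak m1 xy).
    have A2 := Hd' s y ltac:(lra) (close_weak m2 xy).
    by apply: (@convex_comb_lt lam).
  by move=> x; apply: Heta.
have mixE lam x : 0 <= lam <= 1 ->
    mix (fun xi => eta 0 T 0 xi) (fun xi => eta 1 T 0 xi) lam x = eta lam T 0 x.
  move=> Hl; have H1 : 0 <= 1 <= 1 by lra.
  have H0 : 0 <= 0 <= 1 by lra.
  (* This is the defect of affinity in [lam]. The forcing is affine in [lam], so [w] solves the
     homogeneous linear equation, and it starts at 0. *)
  pose w t : Vec n.+1 := fun i => eta lam t 0 x i - (lam * eta 1 t 0 x i + (1 - lam) * eta 0 t 0 x i).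
  have cu : cont_curve (Om x) := solution_cont (HOm' x).2.
  have [c [c0 Hc]] : exists c, 0 < c /\ forall p : 'I_n.+1 * 'I_n.+1, forall t, 0 <= t <= T ->
      Rabs (Jpsi t (Om x t) p.1 p.2) <= / c.
    apply: (@finite_radius _ (fun p c => forall t, 0 <= t <= T ->
      Rabs (Jpsi t (Om x t) p.1 p.2) <= / c)).
      by move=> p c c' cc H t Ht; apply: Rle_trans (H t Ht) _; apply: Rinv_le_contravar; lra.
    move=> p; have [B [B0 HB]] := curve_bound 0 T (cJ p.1 p.2) cu.
    exists (/ (B + 1)); split; first by apply: Rinv_0_lt_compat; lra.
    by move=> t Ht; rewrite Rinv_inv; have := HB t Ht; lra.
  have ci : 0 < / c by apply: Rinv_0_lt_compat.
  have wT : w T = vzero.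
    apply: (@linear_ode_zero _ (fun t => Jpsi t (Om x t)) w (/ c) T T0' ltac:(lra)).
    - by move=> t i j; apply: (Hc (i, j)).
    - move=> t i.
      have D := (Heta lam 0 x Hl).2 t i.
      have D1 := (Heta 1 0 x H1).2 t i; have D0 := (Heta 0 0 x H0).2 t i.
      have := derivable_pt_lim_minus _ _ _ _ _ D (derivable_pt_lim_plus _ _ _ _ _
        (derivable_pt_lim_scal _ lam _ _ D1) (derivable_pt_lim_scal _ (1 - lam) _ _ D0)).
      congr derivable_pt_lim.
      rewrite /vadd /vscal /Om /w.
      set A := Jpsi t (Omega t 0 x); set v := fun _ => _ - _.
      have E : mulmv A v i + (lam * mulmv A (eta 1 t 0 x) i + (1 - lam) * mulmv A (eta 0 t 0 x) i)
          = mulmv A (eta lam t 0 x) i.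
        rewrite /mulmv -!sumk_scal -!sumk_plus; apply: sumk_ext => j.
        by rewrite /v; ring.
      by rewrite -E; ring.
    apply: functional_extensionality => i; rewrite /w.
    by rewrite (Heta lam 0 x Hl).1 (Heta 1 0 x H1).1 (Heta 0 0 x H0).1 /vzero; ring.
  apply: functional_extensionality => i.
  by have := congr1 (fun f : Vec n.+1 => f i) wT; rewrite /w /vzero /mix; lra.
apply: degree_homotopy => //.
- by apply: ceta; lra.
- by apply: ceta; lra.
(* At [s = 0] the subtracted value [eta lam 0 0 x] is 0, so the hypothesis speaks of [eta lam T 0 x]
   itself. *)
move=> lam x Hl bx; rewrite mixE // => E.
apply: (Hnz lam 0 x Hl ltac:(lra) bx); rewrite E (Heta lam 0 x Hl).1.
by apply: functional_extensionality => i; rewrite /vsub /vzero; ring.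
Qed.
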